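(* For any memoryless multiple access channel (MAC) $(\mathcal{X}_1\times\mathcal{X}_2,P(y|x_1,x_2),\mathcal{Y})$ with a $(\mathbf{C}^{\mathrm{in}},\mathbf{C}^{\mathrm{out}})$-cooperation facilitator, the rate region $\mathscr{R}(\mathbf{C}^{\mathrm{in}},\mathbf{C}^{\mathrm{out}})$ is achievable; that is, every rate pair $(R_1,R_2)\in\mathscr{R}(\mathbf{C}^{\mathrm{in}},\mathbf{C}^{\mathrm{out}})$ is achievable. Here $\mathscr{R}(\mathbf{C}^{\mathrm{in}},\mathbf{C}^{\mathrm{out}})$ is the set of all pairs of nonnegative reals $(R_1,R_2)$ for which there exist nonnegative constants $C_{10},C_{20}$, auxiliary random variables $U,V_1,V_2$ and a distribution of the form $P(u,v_1,v_2)P(x_1|u,v_1)P(x_2|u,v_2)$ such that, for both $(i,j)=(1,2)$ and $(i,j)=(2,1)$, $$C_{i0}\le\min\{C_i^{\mathrm{in}},C_j^{\mathrm{out}}\},\qquad I(V_1;V_2|U)\le (C_1^{\mathrm{out}}-C_{20})+(C_2^{\mathrm{out}}-C_{10}),$$ and $$\begin{aligned} R_i &< I(X_i;Y|U,V_1,V_2,X_j)+C_i^{\mathrm{in}},\\ R_i &< I(X_i;Y|U,V_j,X_j)+C_{i0},\\ R_1+R_2 &< I(X_1,X_2;Y|U,V_1,V_2)+C_1^{\mathrm{in}}+C_2^{\mathrm{in}},\\ R_1+R_2 &< I(X_1,X_2;Y|U,V_i)+C_i^{\mathrm{in}}+C_{j0},\\ R_1+R_2 &< I(X_1,X_2;Y|U)+C_{10}+C_{20},\\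 R_1+R_2 &< I(X_1,X_2;Y), \end{aligned}$$ all mutual informations being computed under $P(u,v_1,v_2)P(x_1|u,v_1)P(x_2|u,v_2)P(y|x_1,x_2)$.
   Context: Notation: $[k]=\{1,\dots,k\}$; $[2^{nC}]$ means $[\lfloor 2^{nC}\rfloor]$; logarithms and mutual informations are in base 2. A memoryless MAC $(\mathcal{X}_1\times\mathcal{X}_2,P(y|x_1,x_2),\mathcal{Y})$ has two inputs and one output, with $P(y^n|x_1^n,x_2^n)=\prod_{t=1}^n P(y_t|x_{1t},x_{2t})$. Distributions are written in discrete notation ($P(\cdot)$ is a probability mass function); the auxiliary alphabets $\mathcal{U},\mathcal{V}_1,\mathcal{V}_2$ are arbitrary. Let $\mathbf{C}^{\mathrm{in}}=(C_1^{\mathrm{in}},C_2^{\mathrm{in}})$ and $\mathbf{C}^{\mathrm{out}}=(C_1^{\mathrm{out}},C_2^{\mathrm{out}})$ have nonnegative entries. An $(n,M_1,M_2)$ code for the MAC with a $(\mathbf{C}^{\mathrm{in}},\mathbf{C}^{\mathrm{out}})$-cooperation facilitator (CF) consists of mappings, for $i=1,2$, $\varphi_i:[M_i]\to[2^{nC_i^{\mathrm{in}}}]$ (encoder $i$ to CF), $\psi_i:[2^{nC_1^{\mathrm{in}}}]\times[2^{nC_2^{\mathrm{in}}}]\to[2^{nC_i^{\mathrm{out}}}]$ (CF to encoder $i$), $f_i:[M_i]\times[2^{nC_i^{\mathrm{out}}}]\to\mathcal{X}_i^n$ (encoder $i$ to channel), and a decoder $g:\mathcal{Y}^n\to[M_1]\times[M_2]$.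 The messages $W_1,W_2$ are independent and uniform on $[M_1]$, $[M_2]$; the channel inputs are $X_i^n=f_i\big(W_i,\psi_i(\varphi_1(W_1),\varphi_2(W_2))\big)$, and $Y^n$ is the channel output. The error probability is $P_e^{(n)}=\Pr\{g(Y^n)\ne(W_1,W_2)\}$. A pair of nonnegative reals $(R_1,R_2)$ is achievable if for every $\epsilon>0$ and all sufficiently large $n$ there is an $(n,M_1,M_2)$ code with $P_e^{(n)}\le\epsilon$ and $\frac1n\log M_i>R_i-\epsilon$ for $i=1,2$. *)

(* Defs.v *)
(* MathComp-Analysis development: the reals are an arbitrary [R : realType]. *)
From mathcomp Require Export all_boot all_order all_algebra.
From mathcomp Require Export all_classical all_reals all_analysis.

Set Implicit Arguments.
Unset Strict Implicit.
Unset Printing Implicit Defensive.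

Import Order.TTheory GRing.Theory Num.Theory.
Import numFieldNormedType.Exports.

Local Open Scope classical_set_scope.
Local Open Scope ring_scope.

(* Alphabets are arbitrary choice types, with no finiteness or countability
   assumption; laws are probability mass functions on them, which forces their
   support to be countable.  Sums are therefore unordered sums [\esum]. *)

Definition is_pmf (R : realType) (T : choiceType) (p : T -> R) : Prop :=
  (forall t, 0 <= p t) /\ \esum_(t in [set: T]) (p t)%:E = 1%E.

(* [fine] is harmless for a pmf: the sum lies in [0, 1]. *)
Definition Prob (R : realType) (T : choiceType) (p : T -> R) (E : set T) : R :=
  fine (\esum_(t in E) (p t)%:E).

Definition law (R : realType) (T A : choiceType) (p : T -> R) (X : T -> A)
    (a : A) : R :=
  Prob p (X @^-1` [set a]).

(* [\esum] is meaningful for nonnegative terms only, hence the splitting. *)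
Definition signed_sum (R : realType) (T : choiceType) (f : T -> R) : \bar R :=
  (\esum_(t in [set: T]) (Num.max (f t) 0)%:E
   - \esum_(t in [set: T]) (Num.max (- f t) 0)%:E)%E.

Definition log2 (R : realType) (x : R) : R := ln x / ln 2.

(* Mutual informations are extended reals, since they may be infinite on
   infinite alphabets.  The negative part of the sum is always finite, so the
   difference in [signed_sum] is never of the form +oo - +oo.  Terms of zero
   probability vanish because 0 * x = 0; all other terms have nonzero
   denominators. *)
Definition mutual_info (R : realType) (T A B : choiceType) (p : T -> R)
    (X : T -> A) (Y : T -> B) : \bar R :=
  let pX := law p X in
  let pY := law p Y in
  let pXY := law p (fun t => (X t, Y t)) in
  signed_sum (fun s : A * B =>
    let: (x, y) := s in
    pXY (x, y) * log2 (pXY (x, y) / (pX x * pY y))).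

(* I(X;Y|Z) = sum p(x,y,z) log2 (p(x,y|z) / (p(x|z) p(y|z))) *)
Definition cond_mutual_info (R : realType) (T A B C : choiceType) (p : T -> R)
    (X : T -> A) (Y : T -> B) (Z : T -> C) : \bar R :=
  let pZ := law p Z in
  let pXZ := law p (fun t => (X t, Z t)) in
  let pYZ := law p (fun t => (Y t, Z t)) in
  let pXYZ := law p (fun t => (X t, Y t, Z t)) in
  signed_sum (fun s : A * B * C =>
    let: (x, y, z) := s in
    pXYZ (x, y, z)
    * log2 ((pXYZ (x, y, z) / pZ z)
            / ((pXZ (x, z) / pZ z) * (pYZ (y, z) / pZ z)))).

(* [W x1 x2 y] is P(y | x1, x2). *)
Definition is_mac (R : realType) (X1 X2 Y : choiceType)
    (W : X1 -> X2 -> Y -> R) : Prop :=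
  forall x1 x2, is_pmf (W x1 x2).

Definition mac_ext (R : realType) (X1 X2 Y : choiceType)
    (W : X1 -> X2 -> Y -> R) (n : nat)
    (x1 : n.-tuple X1) (x2 : n.-tuple X2) (y : n.-tuple Y) : R :=
  \prod_(t < n) W (tnth x1 t) (tnth x2 t) (tnth y t).

(* floor (2 ^ (n C)); the index set [2^(nC)] is ['I_(num_idx n C)]. *)
Definition num_idx (R : realType) (n : nat) (C : R) : nat :=
  Num.truncn (2 `^ (n%:R * C)).

Record cf_code (R : realType) (X1 X2 Y : choiceType)
    (Cin1 Cin2 Cout1 Cout2 : R) (n M1 M2 : nat) : Type := CFCode {
  to_cf1 : 'I_M1 -> 'I_(num_idx n Cin1);
  to_cf2 : 'I_M2 -> 'I_(num_idx n Cin2);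
  from_cf1 : 'I_(num_idx n Cin1) -> 'I_(num_idx n Cin2) ->
             'I_(num_idx n Cout1);
  from_cf2 : 'I_(num_idx n Cin1) -> 'I_(num_idx n Cin2) ->
             'I_(num_idx n Cout2);
  enc1 : 'I_M1 -> 'I_(num_idx n Cout1) -> n.-tuple X1;
  enc2 : 'I_M2 -> 'I_(num_idx n Cout2) -> n.-tuple X2;
  dec : n.-tuple Y -> 'I_M1 * 'I_M2
}.

Definition input1 (R : realType) (X1 X2 Y : choiceType)
    (Cin1 Cin2 Cout1 Cout2 : R) (n M1 M2 : nat)
    (c : cf_code X1 X2 Y Cin1 Cin2 Cout1 Cout2 n M1 M2)
    (w1 : 'I_M1) (w2 : 'I_M2) : n.-tuple X1 :=
  enc1 c w1 (from_cf1 c (to_cf1 c w1) (to_cf2 c w2)).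

Definition input2 (R : realType) (X1 X2 Y : choiceType)
    (Cin1 Cin2 Cout1 Cout2 : R) (n M1 M2 : nat)
    (c : cf_code X1 X2 Y Cin1 Cin2 Cout1 Cout2 n M1 M2)
    (w1 : 'I_M1) (w2 : 'I_M2) : n.-tuple X2 :=
  enc2 c w2 (from_cf2 c (to_cf1 c w1) (to_cf2 c w2)).

(* Joint law of (W1, W2, Y^n), the messages being independent and uniform. *)
Definition code_law (R : realType) (X1 X2 Y : choiceType)
    (W : X1 -> X2 -> Y -> R) (Cin1 Cin2 Cout1 Cout2 : R) (n M1 M2 : nat)
    (c : cf_code X1 X2 Y Cin1 Cin2 Cout1 Cout2 n M1 M2)
    (t : 'I_M1 * 'I_M2 * n.-tuple Y) : R :=
  let: (w1, w2, y) := t in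
  M1%:R^-1 * M2%:R^-1 * mac_ext W (input1 c w1 w2) (input2 c w1 w2) y.

Definition error_prob (R : realType) (X1 X2 Y : choiceType)
    (W : X1 -> X2 -> Y -> R) (Cin1 Cin2 Cout1 Cout2 : R) (n M1 M2 : nat)
    (c : cf_code X1 X2 Y Cin1 Cin2 Cout1 Cout2 n M1 M2) : R :=
  Prob (code_law W c) [set t | dec c t.2 <> t.1].

(* Message sets are nonempty, so that the uniform laws on them and log2 M_i
   make sense. *)
Definition achievable (R : realType) (X1 X2 Y : choiceType)
    (W : X1 -> X2 -> Y -> R) (Cin1 Cin2 Cout1 Cout2 : R) (R1 R2 : R) : Prop :=
  [/\ 0 <= R1, 0 <= R2 &
   forall eps : R, 0 < eps ->
   \forall n \near \oo,
   exists (M1 M2 : nat)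
     (c : cf_code X1 X2 Y Cin1 Cin2 Cout1 Cout2 n M1 M2),
   [/\ (0 < M1)%N, (0 < M2)%N, error_prob W c <= eps,
       n%:R^-1 * log2 M1%:R > R1 - eps &
       n%:R^-1 * log2 M2%:R > R2 - eps]].

(* P(u,v1,v2) P(x1|u,v1) P(x2|u,v2) P(y|x1,x2) *)
Definition joint_law (R : realType) (U V1 V2 X1 X2 Y : choiceType)
    (puv : U * V1 * V2 -> R) (q1 : U -> V1 -> X1 -> R)
    (q2 : U -> V2 -> X2 -> R) (W : X1 -> X2 -> Y -> R)
    (t : U * V1 * V2 * X1 * X2 * Y) : R :=
  let: (u, v1, v2, x1, x2, y) := t in
  puv (u, v1, v2) * q1 u v1 x1 * q2 u v2 x2 * W x1 x2 y.

Definition rate_region (R : realType) (X1 X2 Y : choiceType)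
    (W : X1 -> X2 -> Y -> R) (Cin1 Cin2 Cout1 Cout2 : R) : set (R * R) :=
  [set r : R * R | let: (R1, R2) := r in
   [/\ 0 <= R1, 0 <= R2 &
   exists (C10 C20 : R) (U V1 V2 : choiceType)
     (puv : U * V1 * V2 -> R)
     (q1 : U -> V1 -> X1 -> R) (q2 : U -> V2 -> X2 -> R),
   let P := joint_law puv q1 q2 W in
   let u (t : U * V1 * V2 * X1 * X2 * Y) := let: (u, _, _, _, _, _) := t in u in
   let v1 (t : U * V1 * V2 * X1 * X2 * Y) := let: (_, v, _, _, _, _) := t in v in
   let v2 (t : U * V1 * V2 * X1 * X2 * Y) := let: (_, _, v, _, _, _) := t in v in
   let x1 (t : U * V1 * V2 * X1 * X2 * Y) := let: (_, _, _, x, _, _) := t in x in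
   let x2 (t : U * V1 * V2 * X1 * X2 * Y) := let: (_, _, _, _, x, _) := t in x in
   let y (t : U * V1 * V2 * X1 * X2 * Y) := let: (_, _, _, _, _, y) := t in y in
   let x12 t := (x1 t, x2 t) in
   [/\ 0 <= C10, 0 <= C20, is_pmf puv,
       forall a b, is_pmf (q1 a b) & forall a b, is_pmf (q2 a b)] /\
   [/\ C10 <= Num.min Cin1 Cout2,
       C20 <= Num.min Cin2 Cout1 &
       (cond_mutual_info P v1 v2 u <= ((Cout1 - C20) + (Cout2 - C10))%:E)%E] /\
   [/\ (R1%:E < cond_mutual_info P x1 y (fun t => (u t, v1 t, v2 t, x2 t))
                + Cin1%:E)%E,
       (R2%:E < cond_mutual_info P x2 y (fun t => (u t, v1 t, v2 t, x1 t))
                + Cin2%:E)%E,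
       (R1%:E < cond_mutual_info P x1 y (fun t => (u t, v2 t, x2 t))
                + C10%:E)%E &
       (R2%:E < cond_mutual_info P x2 y (fun t => (u t, v1 t, x1 t))
                + C20%:E)%E] /\
   [/\ ((R1 + R2)%:E < cond_mutual_info P x12 y (fun t => (u t, v1 t, v2 t))
                       + Cin1%:E + Cin2%:E)%E,
       ((R1 + R2)%:E < cond_mutual_info P x12 y (fun t => (u t, v1 t))
                       + Cin1%:E + C20%:E)%E &
       ((R1 + R2)%:E < cond_mutual_info P x12 y (fun t => (u t, v2 t))
                       + Cin2%:E + C10%:E)%E] /\
   ((R1 + R2)%:E < cond_mutual_info P x12 y u + C10%:E + C20%:E)%E /\
   ((R1 + R2)%:E < mutual_info P x12 y)%E]].

(* Main.v *)
(* Random superposition coding.  A message of user i is split into a part a_i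
   that the facilitator passes on to the other encoder, a part b_i known to the
   facilitator only, and a private part c_i.  Codewords u(a), v_i(a, b_i, z_i)
   and x_i(.., c_i) are drawn along P(u), P(v_i|u), P(x_i|u,v_i); the
   facilitator chooses the pair (z_1, z_2) that makes (u, v_1, v_2) jointly
   typical.  Since v_1, v_2 are drawn independently given u, such a pair exists
   with high probability as soon as its number exceeds 2^(m I(V1;V2|U)) (second
   moment method), and a typical pair has probability at most
   2^(-m I(V1;V2|U)).  In the union bound over wrong messages the true indices
   z, which depend on the whole codebook, are summed over as well: the two
   effects cancel up to 2^(o(m)).  The decoder puts a threshold on the nine
   likelihood ratios whose mean logarithms are the nine mutual informations;
   Markov's inequality bounds false alarms and a truncated law of large numbers,
   valid when the information is infinite, bounds missed detections.
   A code of length n uses only m = (1 - kap) n letters, which makes the covering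
   condition strict when I(V1;V2|U) attains its bound; the exception
   Cout1 = Cout2 = 0 forces V1, V2 to be independent given U. *)
Require Import Defs.
From mathcomp Require Import all_boot all_order all_algebra.
From mathcomp Require Import all_classical all_reals all_analysis.
From mathcomp Require Import ring lra zify.

Set Implicit Arguments.
Unset Strict Implicit.
Unset Printing Implicit Defensive.

Import Order.TTheory GRing.Theory Num.Theory.
Import numFieldNormedType.Exports.

Local Open Scope classical_set_scope.
Local Open Scope ring_scope.

(** * Sums and expectations *)

(** The law of (u, v1, v2) is a density [lr] against the law of the codebook, under which v1 and v2
    are independent given u, and [lam <= lr <= Lam] takes the place of joint typicality. Let M be
    the number of index pairs, with M / lam at most 2^(del m). The sum over the true indices is paid
    by the typicality of the sent triple. The sum over the indices of a wrong message costs a second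
    M, and it is paid by the decoder, which repeats the test [lam <= lr]. The total loss 2^(2 del m)
    is absorbed by a margin of 3 del in every rate inequality. The rates of the message parts are
    explicit: a_i is filled up to C_i0, then b_i up to C_i^in, and the rest goes to c_i. A part is
    nontrivial only if the earlier ones are full, so the number of wrong messages of each pattern is
    governed by exactly one inequality of the region. *)

Notation Sum f := (esum [set: _] f).

Section Sums.
Context (R : realType).
Implicit Types S T : choiceType.
Local Open Scope ereal_scope.

Lemma Sum_ge0 T (f : T -> \bar R) : (forall t, 0 <= f t) -> 0 <= Sum f.
Proof. by move=> h; apply: esum_ge0. Qed.

Lemma le_Sum T (f g : T -> \bar R) : (forall t, f t <= g t) -> Sum f <= Sum g.
Proof. by move=> h; apply: le_esum. Qed.

Lemma eq_Sum T (f g : T -> \bar R) : (forall t, f t = g t) -> Sum f = Sum g.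
Proof. by move=> h; apply: eq_esum. Qed.

Lemma Sum_pair S T (F : S * T -> \bar R) : (forall s, 0 <= F s) ->
  Sum F = Sum (fun s => Sum (fun t => F (s, t))).
Proof.
move=> h; rewrite esum_esum//; congr esum; first by apply/seteqP; split.
by apply/funext => -[].
Qed.

Lemma Sum_reindex S T (e : S -> T) (F : T -> \bar R) : bijective e ->
  Sum F = Sum (F \o e).
Proof.
move=> be; apply: (reindex_esum [set: S] [set: T] e).
by rewrite setTT_bijective.
Qed.

Lemma Sum_swap S T (F : S -> T -> \bar R) : (forall s t, 0 <= F s t) ->
  Sum (fun s => Sum (F s)) = Sum (fun t => Sum (F ^~ t)).
Proof.
move=> h; rewrite -(Sum_pair (F := fun p => F p.1 p.2))//.
rewrite -(Sum_pair (F := fun p => F p.2 p.1))//.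
rewrite (@Sum_reindex (T * S)%type _ (fun p => (p.2, p.1)))//.
by exists (fun p => (p.2, p.1)) => -[].
Qed.

(** One inequality passes to finite subsums; for [0 < c < +oo] the converse is the same inequality
    at [c^-1]. At [c = +oo] a single nonzero term makes both sides infinite. *)
Lemma SumZ T (c : \bar R) (f : T -> \bar R) : 0 <= c -> (forall t, 0 <= f t) ->
  Sum (fun t => c * f t) = c * Sum f.
Proof.
move=> c0 f0.
have le c' (g : T -> \bar R) : 0 <= c' -> (forall t, 0 <= g t) ->
    Sum (fun t => c' * g t) <= c' * Sum g.
  move=> c'0 g0; apply: ge_ereal_sup => _ [X [finX _] <-].
  rewrite -ge0_mule_fsumr//; apply: lee_wpmul2l => //.
  by apply: ereal_sup_ubound; exists X.
apply/eqP; rewrite eq_le le//=.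
case: c c0 => [c||]// c0; last first.
  have [h|] := pselect (forall t, f t = 0).
    rewrite (eq_Sum (g := fun=> 0)); last by move=> t; rewrite h.
    by rewrite esum1// mule0 Sum_ge0// => t; rewrite h mule0.
  move=> /existsNP[t /eqP ft0].
  rewrite (@le_trans _ _ (+oo * f t))//.
    rewrite [leRHS]gt0_mulye ?leey//.
    by rewrite lt_def ft0 f0.
  have : Sum (fun t0 => if t0 \in [set t] then +oo * f t0 else 0)
      <= Sum (fun t => +oo * f t).
    by apply: le_Sum => s; case: ifP => // _; rewrite mule_ge0.
  by rewrite -esum_mkcond esum_set1// mule_ge0.
rewrite lee_fin le_eqVlt in c0; case/orP: c0 => [/eqP <-|c0].
  by rewrite mul0e Sum_ge0// => t; rewrite mul0e.
rewrite -lee_pdivlMl//=.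
apply: le_trans (le (c^-1)%:E (fun t => c%:E * f t) _ _) => //.
- apply: le_Sum => t; rewrite muleA -EFinM mulVf ?mul1e//.
  by rewrite gt_eqF.
- by rewrite lee_fin invr_ge0 ltW.
- by move=> t; rewrite mule_ge0// lee_fin ltW.
Qed.

Lemma SumD T (f g : T -> \bar R) : (forall t, 0 <= f t) -> (forall t, 0 <= g t) ->
  Sum (fun t => f t + g t) = Sum f + Sum g.
Proof. by move=> f0 g0; apply: esumD. Qed.

Lemma Sum_bool (f : bool -> \bar R) : (forall t, 0 <= f t) ->
  Sum f = f true + f false.
Proof.
move=> f0; rewrite (esumID [set true])// !setTI.
rewrite (_ : ~` [set true] = [set false]); first by rewrite !esum_set1.
by apply/seteqP; split => -[] //= /(_ erefl).
Qed.

End Sums.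

Record massfn (R : realType) (T : choiceType) := MassFn {
  mass_fun :> T -> R;
  massP : is_pmf mass_fun }.

(* A positive linear functional of total mass one that commutes with arbitrary
   nonnegative sums: an expectation over an unspecified probability space.
   Expectations of nested random choices are built with [bindx], so that no
   joint law on codebooks is ever needed. *)
Record expect (R : realType) (O : Type) := Expect {
  ex_fun :> (O -> \bar R) -> \bar R;
  ex_cst : forall c : \bar R, (0 <= c)%E -> ex_fun (fun=> c) = c;
  ex_le : forall F G : O -> \bar R, (forall o, 0 <= F o)%E ->
    (forall o, F o <= G o)%E -> (ex_fun F <= ex_fun G)%E;
  exZ : forall (c : \bar R) (F : O -> \bar R), (0 <= c)%E ->
    (forall o, 0 <= F o)%E -> ex_fun (fun o => c * F o)%E = (c * ex_fun F)%E;
  ex_Sum : forall (J : choiceType) (F : J -> O -> \bar R),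
    (forall j o, 0 <= F j o)%E ->
    ex_fun (fun o => Sum (F ^~ o)) = Sum (fun j => ex_fun (F j)) }.

Section Expect.
Context (R : realType).
Implicit Types (S T : choiceType) (O : Type).
Local Open Scope ereal_scope.

Lemma mass_ge0 T (p : massfn R T) t : (0 <= p t)%R.
Proof. by case: (massP p) => + _; apply. Qed.

Lemma mass_ge0e T (p : massfn R T) t : 0 <= (p t)%:E.
Proof. by rewrite lee_fin mass_ge0. Qed.

Lemma mass_sum1 T (p : massfn R T) : Sum (fun t => (p t)%:E) = 1.
Proof. by case: (massP p). Qed.
Hint Resolve mass_ge0 mass_ge0e : core.

Program Definition EE_def T (p : massfn R T) : expect R T :=
  @Expect R T (fun F => Sum (fun t => (p t)%:E * F t)) _ _ _ _.
Next Obligation.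
move=> T p c c0 /=; under eq_Sum => t do rewrite muleC.
by rewrite SumZ// mass_sum1 mule1.
Qed.
Next Obligation. by move=> T p F G F0 FG; apply: le_Sum => t; rewrite lee_wpmul2l. Qed.
Next Obligation.
move=> T p c F c0 F0 /=; under eq_Sum => t do rewrite muleCA.
by rewrite SumZ// => t; rewrite mule_ge0.
Qed.
Next Obligation.
move=> T p J F F0 /=.
under eq_Sum => t do rewrite -SumZ//.
by rewrite Sum_swap// => s t; rewrite mule_ge0.
Qed.

Fact EE_key : {E : forall T, massfn R T -> expect R T | E = EE_def}.
Proof. by exists EE_def. Qed.

(* Sealed, so that [/=] leaves expectations folded. *)
Definition EE T (p : massfn R T) : expect R T := sval EE_key T p.

Lemma EEE T (p : massfn R T) F : EE p F = Sum (fun t => (p t)%:E * F t).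
Proof. by rewrite /EE (svalP EE_key). Qed.

Program Definition retx O (o : O) : expect R O := @Expect R O (fun F => F o) _ _ _ _.
Solve All Obligations with by [].

Lemma ex_ge0 O (E : expect R O) F : (forall o, 0 <= F o) -> 0 <= E F.
Proof. by move=> F0; rewrite -(ex_cst E (lexx 0)); apply: ex_le. Qed.

Program Definition bindx O O' (E : expect R O) (K : O -> expect R O') :
  expect R O' := @Expect R O' (fun F => E (fun o => K o F)) _ _ _ _.
Next Obligation.
move=> O O' E K c c0.
rewrite /= -[RHS](ex_cst E c0); congr (E _); apply/funext => o; exact: ex_cst.
Qed.
Next Obligation.
move=> O O' E K F G F0 FG; apply: ex_le => o; first exact: ex_ge0.
exact: ex_le.
Qed.
Next Obligation.
move=> O O' E K c F c0 F0; rewrite -exZ//; last by move=> o; apply: ex_ge0.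
by congr (E _); apply/funext => o; rewrite exZ.
Qed.
Next Obligation.
move=> O O' E K J F F0; rewrite -ex_Sum; last by move=> *; apply: ex_ge0.
by congr (E _); apply/funext => o; rewrite ex_Sum.
Qed.

Lemma bindxE O O' (E : expect R O) (K : O -> expect R O') F :
  bindx E K F = E (fun o => K o F).
Proof. by []. Qed.

Section Theory.
Context O (E : expect R O).
Implicit Types F G : O -> \bar R.

Lemma eq_ex F G : (forall o, F o = G o) -> E F = E G.
Proof. by move=> FG; congr (E _); apply/funext. Qed.

Lemma exZr F (c : \bar R) : 0 <= c -> (forall o, 0 <= F o) ->
  E (fun o => F o * c) = E F * c.
Proof. by move=> c0 F0; rewrite muleC -exZ//; apply: eq_ex => o; rewrite muleC. Qed.

(** Additivity is the instance of [ex_Sum] with index type [bool], which is why it is not a field of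
    [expect]. *)
Lemma exD F G : (forall o, 0 <= F o) -> (forall o, 0 <= G o) ->
  E (fun o => F o + G o) = E F + E G.
Proof.
move=> F0 G0.
have h b o : 0 <= (if b then F o else G o) by case: b.
have := ex_Sum E h.
rewrite Sum_bool/=; last by case=> //; apply: ex_ge0.
by move=> <-; apply: eq_ex => o; rewrite Sum_bool//= => -[].
Qed.

Lemma ex_sum (I : Type) (s : seq I) (P : pred I) (F : I -> O -> \bar R) :
  (forall i o, 0 <= F i o) ->
  E (fun o => \sum_(i <- s | P i) F i o) = \sum_(i <- s | P i) E (F i).
Proof.
move=> F0; elim: s => [|i s ih].
  rewrite big_nil -[RHS](ex_cst E)//; apply: eq_ex => o; exact: big_nil.
rewrite big_cons -ih.
case: ifP => Pi; last first.
  by apply: eq_ex => o; rewrite big_cons Pi.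
rewrite -exD//; last by move=> o; apply: sume_ge0.
by apply: eq_ex => o; rewrite big_cons Pi.
Qed.

Lemma ex_le_cst F (c : \bar R) : (forall o, 0 <= F o) -> (forall o, F o <= c) ->
  0 <= c -> E F <= c.
Proof. by move=> F0 Fc c0; rewrite -[leRHS](ex_cst E c0); apply: ex_le. Qed.

Lemma ex_le1 F : (forall o, 0 <= F o) -> (forall o, F o <= 1) -> E F <= 1.
Proof. by move=> F0 F1; apply: ex_le_cst. Qed.

(** The probabilistic method: it turns a bound on the mean over codebooks into a single codebook. *)
Lemma ex_witness F (c : \bar R) : 0 <= c -> E F < c -> exists o, F o < c.
Proof.
move=> c0 h; apply/not_existsP => H; move: h; apply/negP; rewrite -leNgt.
rewrite -[leLHS](ex_cst E c0); apply: ex_le => // o.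
by rewrite leNgt; apply/negP/H.
Qed.

(** Fubini between an arbitrary expectation and a discrete one: the latter is a [Sum], which
    [ex_Sum] exchanges. *)
Lemma ex_swap T (q : massfn R T) (F : O -> T -> \bar R) :
  (forall o t, 0 <= F o t) ->
  E (fun o => EE q (F o)) = EE q (fun t => E (F ^~ t)).
Proof.
move=> F0; rewrite EEE; under eq_ex => o do rewrite EEE.
rewrite (ex_Sum E (F := fun t o => (q t)%:E * F o t)).
  by apply: eq_Sum => t; rewrite exZ.
by move=> *; rewrite mule_ge0.
Qed.

End Theory.

(* [copyx d s q] is a fresh sample of [q] if [d] holds, and [s] otherwise. *)
Definition copyx T (d : bool) (s : T) (q : massfn R T) : expect R T :=
  if d then EE q else retx s.

End Expect.

#[global] Hint Resolve mass_ge0 mass_ge0e : core.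

(** * Random functions with independent values *)

Section RandomFunction.
Context (R : realType) (T : choiceType).
Local Open Scope ereal_scope.

Lemma mass_inhabited (p : massfn R T) : exists _ : T, True.
Proof.
apply: contrapT => /forallNP h; have := mass_sum1 p.
rewrite esum1 => [/eqP|t _]; last by have := h t.
by rewrite eq_sym onee_eq0.
Qed.

Definition mass_pt (p : massfn R T) : T := projT1 (cid (mass_inhabited p)).

Lemma ex_copyx_swap O (E : expect R O) d s (q : massfn R T) (F : O -> T -> \bar R) :
  (forall o t, 0 <= F o t) ->
  E (fun o => copyx d s q (F o)) = copyx d s q (fun t => E (F ^~ t)).
Proof. by move=> F0; case: d => //=; rewrite [LHS]ex_swap. Qed.

Fixpoint rfun_seq (I : eqType) (p : I -> massfn R T) (s : seq I) (g : I -> T) :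
    expect R (I -> T) :=
  if s is i :: s' then
    bindx (EE (p i)) (fun t => rfun_seq p s' [eta g with i |-> t])
  else retx R g.

(** Draws at other indices integrate to 1, and [uniq s] excludes that a draw is overwritten later.
    The membership tests keep the induction going once one of the two indices has been drawn. *)
Lemma rfun_seq2 (I : eqType) (p : I -> massfn R T) s g (i j : I)
    (G : T -> T -> \bar R) : uniq s -> i != j -> (forall a b, 0 <= G a b) ->
  rfun_seq p s g (fun f => G (f i) (f j)) =
  copyx (i \in s) (g i) (p i) (fun a => copyx (j \in s) (g j) (p j) (G a)).
Proof.
move=> + ij G0; elim: s g => [|k s ih] g //= /andP[ks us].
under eq_ex => t do rewrite ih//=.
rewrite !inE; have [ik|ik] := eqVneq i k.
  have jk : j == k = false by apply/negbTE; rewrite -ik eq_sym.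
  by rewrite jk/= -ik in ks *; rewrite (negbTE ks).
have [jk|jk] := eqVneq j k; last first.
  by apply: (ex_cst (EE (p k))); rewrite ex_ge0// => a; rewrite ex_ge0.
rewrite jk/= (negbTE ks).
exact: (@ex_copyx_swap _ (EE (p k)) _ _ _ (fun t a => G a t)).
Qed.

Lemma rfun_seq1 (I : eqType) (p : I -> massfn R T) s g (i : I)
    (G : T -> \bar R) : uniq s -> (forall a, 0 <= G a) ->
  rfun_seq p s g (fun f => G (f i)) = copyx (i \in s) (g i) (p i) G.
Proof.
move=> + G0; elim: s g => [|k s ih] g //= /andP[ks us].
under eq_ex => t do rewrite ih//=.
rewrite !inE; have [ik|ik] := eqVneq i k; last first.
  by apply: (ex_cst (EE (p k))); rewrite ex_ge0.
by rewrite -ik in ks *; rewrite (negbTE ks).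
Qed.

(** [mass_pt] is only a starting value: every index occurs in [enum I] and is redrawn. *)
Definition rfun (I : finType) (p : I -> massfn R T) : expect R (I -> T) :=
  rfun_seq p (enum I) (fun i => mass_pt (p i)).

Lemma rfun1 (I : finType) (p : I -> massfn R T) (i : I) (G : T -> \bar R) :
  (forall a, 0 <= G a) -> rfun p (fun f => G (f i)) = EE (p i) G.
Proof. by move=> G0; rewrite /rfun rfun_seq1 ?enum_uniq// mem_enum. Qed.

(** One formula for equal and for distinct indices: two codewords may share some of the five levels
    of a codebook and differ at others. *)
Lemma rfun2 (I : finType) (p : I -> massfn R T) (i j : I) (G : T -> T -> \bar R) :
  (forall a b, 0 <= G a b) ->
  rfun p (fun f => G (f i) (f j)) =
  EE (p i) (fun a => copyx (i != j) a (p j) (G a)).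
Proof.
move=> G0; have [<-|ij] := eqVneq i j; first exact: (@rfun1 I p i (fun a => G a a)).
by rewrite /rfun rfun_seq2 ?enum_uniq// !mem_enum.
Qed.

End RandomFunction.

Arguments rfun1 {R T I} p i G.
Arguments rfun2 {R T I} p i j G.
Arguments ex_copyx_swap {R T O} E d s q F.

Notation "\eprod_ ( i < n ) F" := (\big[mule/1%E]_(i < n) F%E)
  (at level 36, F at level 36, i, n at level 50,
   format "\eprod_ ( i  <  n )  F").

(** * Product laws on tuples *)

Section Tuples.
Context (R : realType).
Local Open Scope ereal_scope.

Lemma eprod_ge0 n (g : 'I_n -> \bar R) : (forall i, 0 <= g i) ->
  0 <= \eprod_(i < n) g i.
Proof. by move=> g0; elim/big_ind: _ => // *; rewrite mule_ge0. Qed.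

Lemma eprod_le1 n (g : 'I_n -> \bar R) : (forall i, 0 <= g i <= 1) ->
  \eprod_(i < n) g i <= 1.
Proof.
move=> g0; have : 0 <= \eprod_(i < n) g i <= 1; last by case/andP.
elim/big_ind: _ => //= [|x y /andP[x0 x1] /andP[y0 y1]]; first by rewrite lexx lee01.
by rewrite mule_ge0//= -[leRHS]mule1 lee_pmul.
Qed.

Lemma EFin_prod n (g : 'I_n -> R) :
  (\prod_(i < n) g i)%R%:E = \eprod_(i < n) (g i)%:E.
Proof. by elim/big_rec2: _ => // i x y _ <-; rewrite EFinM. Qed.

Lemma Sum_tuple (T : choiceType) n (g : 'I_n -> T -> \bar R) :
  (forall i t, 0 <= g i t) ->
  Sum (fun x : n.-tuple T => \eprod_(i < n) g i (tnth x i)) =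
  \eprod_(i < n) Sum (g i).
Proof.
move=> g0; elim: n g g0 => [|n ih] g g0.
  rewrite big_ord0 (_ : setT = [set [tuple]]); last first.
    by apply/seteqP; split => // x _; rewrite [x]tuple0.
  by rewrite esum_set1 ?big_ord0.
rewrite big_ord_recl -ih//.
rewrite (@Sum_reindex _ (T * n.-tuple T)%type _ (fun p => [tuple of p.1 :: p.2])); last first.
  exists (fun x => (thead x, [tuple of behead x])) => [[a x]|x].
    rewrite theadE /=; congr pair; exact: val_inj.
  by rewrite -tuple_eta.
have h0 x : 0 <= \eprod_(i < n) g (lift ord0 i) (tnth x i) by rewrite eprod_ge0.
rewrite Sum_pair; last by move=> s /=; rewrite eprod_ge0.
rewrite muleC -SumZ//; last by rewrite Sum_ge0.
apply: eq_Sum => t; rewrite muleC -SumZ//; apply: eq_Sum => x /=.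
rewrite big_ord_recl tnth0; congr (_ * _); apply: eq_bigr => i _.
by rewrite tnthS.
Qed.

Lemma prod_mass_proof (T : choiceType) n (p : 'I_n -> massfn R T) :
  is_pmf (fun x : n.-tuple T => \prod_(i < n) p i (tnth x i))%R.
Proof.
split=> [x|]; first by apply: prodr_ge0 => i _; exact: mass_ge0.
under eq_esum => x _ do rewrite EFin_prod.
rewrite (Sum_tuple (g := fun i t => (p i t)%:E))// big1// => i _; exact: mass_sum1.
Qed.

Definition prod_mass (T : choiceType) n (p : 'I_n -> massfn R T) : massfn R (n.-tuple T) :=
  MassFn (prod_mass_proof p).

Lemma ex_prod (T : choiceType) n (p : 'I_n -> massfn R T) (g : 'I_n -> T -> \bar R) :
  (forall i t, 0 <= g i t) ->
  EE (prod_mass p) (fun x => \eprod_(i < n) g i (tnth x i)) =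
  \eprod_(i < n) EE (p i) (g i).
Proof.
rewrite EEE => g0; under [RHS]eq_bigr => i _ do rewrite EEE.
under eq_Sum => x do rewrite EFin_prod -big_split/=.
by rewrite (Sum_tuple (g := fun i t => (p i t)%:E * g i t))// => *; rewrite mule_ge0.
Qed.

End Tuples.

(** * Mutual covering *)

Section Covering.
Context (R : realType) (V1 V2 : choiceType) (p1 : massfn R V1) (p2 : massfn R V2).
Variables (h : V1 -> V2 -> R) (A : R).
Hypotheses (h0 : forall a b, 0 <= h a b) (hA : forall a b, h a b <= A) (A1 : 1 <= A).
Local Open Scope ereal_scope.
Hypothesis h1 : forall b, EE p1 (fun a => (h a b)%:E) <= 1.
Hypothesis h2 : forall a, EE p2 (fun b => (h a b)%:E) <= 1.

Let hh0 a b a' b' : 0 <= (h a b * h a' b')%:E.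
Proof. by rewrite lee_fin mulr_ge0. Qed.

Let h0e a b : 0 <= (h a b)%:E.
Proof. by rewrite lee_fin. Qed.

(** One fresh coordinate is enough: given the shared letter, each factor still has mean at most 1 by
    [h1] or [h2], so pairs with one common codeword do not spoil the second moment. Only if both
    coordinates are shared is [h ^ 2 <= A h] used. *)
Lemma second_moment_pair (d1 d2 : bool) :
  EE p1 (fun a => copyx d1 a p1 (fun a' => EE p2 (fun b => copyx d2 b p2 (fun b' =>
    (h a b * h a' b')%:E)))) <= if d1 || d2 then 1 else A%:E.
Proof.
have H a a' : EE p2 (fun b => EE p2 (fun b' => (h a b * h a' b')%:E)) <= 1.
  apply: le_trans (h2 a); apply: ex_le => b /=; first by apply: ex_ge0.
  under eq_ex do rewrite EFinM.
  by rewrite exZ// -[leRHS]mule1 lee_wpmul2l.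
have H' b : EE p1 (fun a => EE p1 (fun a' => (h a b * h a' b)%:E)) <= 1.
  apply: le_trans (h1 b); apply: ex_le => a /=; first by apply: ex_ge0.
  under eq_ex do rewrite EFinM.
  by rewrite exZ// -[leRHS]mule1 lee_wpmul2l.
case: d2 => [|]; rewrite ?orbT ?orbF.
  by apply: ex_le1 => a; [|apply: ex_le1 => // a'] => *; repeat apply: ex_ge0 => *.
rewrite /copyx; case: d1 => /=.
  under eq_ex => a do rewrite ex_swap//.
  rewrite ex_swap => [|a b]; last by apply: ex_ge0.
  by apply: ex_le1 => // b; repeat apply: ex_ge0 => *.
apply: ex_le_cst => [a|a|]; first by apply: ex_ge0.
  apply: (@le_trans _ _ (EE p2 (fun b => A%:E * (h a b)%:E))).
    by apply: ex_le => // b; rewrite lee_fin ler_wpM2r.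
  rewrite exZ//; last by rewrite lee_fin (le_trans ler01).
  by rewrite -[leRHS]mule1 lee_wpmul2l// lee_fin (le_trans ler01).
by rewrite lee_fin (le_trans ler01).
Qed.

Variables (I1 I2 Z1 Z2 : finType) (P1 : I1 -> massfn R V1) (P2 : I2 -> massfn R V2).
Variables (k1 : Z1 -> I1) (k2 : Z2 -> I2).
Hypotheses (k1P : forall z, P1 (k1 z) = p1) (k2P : forall z, P2 (k2 z) = p2).
Hypotheses (k1i : injective k1) (k2i : injective k2).

Let Z := (Z1 * Z2)%type.
Let hz (f1 : I1 -> V1) (f2 : I2 -> V2) (z : Z) : R := h (f1 (k1 z.1)) (f2 (k2 z.2)).

Let hz0 f1 f2 z : (0 <= hz f1 f2 z)%R. Proof. exact: h0. Qed.

Lemma mean_codebook z :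
  rfun P1 (fun f1 => rfun P2 (fun f2 => (hz f1 f2 z)%:E)) =
  EE p1 (fun a => EE p2 (fun b => (h a b)%:E)).
Proof.
under eq_ex => f1 do rewrite (rfun1 _ _ (fun b => (h (f1 (k1 z.1)) b)%:E)) ?k2P//.
rewrite (rfun1 P1 (k1 z.1) (fun a => EE p2 (fun b => (h a b)%:E))) ?k1P//.
by move=> a; apply: ex_ge0 => b; rewrite lee_fin.
Qed.

Lemma second_moment_codebook z z' :
  rfun P1 (fun f1 => rfun P2 (fun f2 => (hz f1 f2 z * hz f1 f2 z')%:E))
  <= if z == z' then A%:E else 1.
Proof.
under eq_ex => f1.
  rewrite (rfun2 _ _ _ (fun b b' => (h (f1 (k1 z.1)) b * h (f1 (k1 z'.1)) b')%:E))//.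
  over.
rewrite (rfun2 P1 (k1 z.1) (k1 z'.1) (fun a a' => EE (P2 (k2 z.2))
   (fun b => copyx (k2 z.2 != k2 z'.2) b (P2 (k2 z'.2)) (fun b' => (h a b * h a' b')%:E)))).
  rewrite !k1P !k2P; apply: le_trans (second_moment_pair _ _) _.
  rewrite (inj_eq k1i) (inj_eq k2i) -negb_and.
  rewrite (_ : z == z' = (z.1 == z'.1) && (z.2 == z'.2)); last by case: z z' => ? ? [].
  by case: ifP => [/negbTE ->|/negbFE ->].
by move=> a a'; repeat apply: ex_ge0 => *.
Qed.

Let M : R := #|{: Z}|%:R.
Hypothesis M0 : (0 < M)%R.

(* Second moment method: if no pair is hit the normalised count N vanishes, so
   the indicator of that event is at most (N - 1)^2 = N^2 - 2 N + 1. *)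
Lemma mutual_covering :
  rfun P1 (fun f1 => rfun P2 (fun f2 => (\1_[set f | forall z, hz f.1 f.2 z = 0%R] (f1, f2))%:E))
   + 2%:E * EE p1 (fun a => EE p2 (fun b => (h a b)%:E))
  <= ((A - 1) / M + 2)%:E.
Proof.
pose N f1 f2 : R := (\sum_z M^-1 * hz f1 f2 z)%R.
have M'0 : (0 <= M^-1)%R by rewrite invr_ge0 ltW.
have Nz0 f1 f2 z : (0 <= M^-1 * hz f1 f2 z)%R by rewrite mulr_ge0.
have N0 f1 f2 : (0 <= N f1 f2)%R by rewrite sumr_ge0.
have MV : (\sum_(z : Z) M^-1 = 1)%R.
  by rewrite sumr_const -(mulr_natl M^-1) mulfV// gt_eqF.
pose E : expect R _ := bindx (rfun P1) (fun f1 => bindx (rfun P2) (fun f2 => retx R (f1, f2))).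
pose ind (f : (I1 -> V1) * (I2 -> V2)) : \bar R := (\1_[set f | forall z, hz f.1 f.2 z = 0%R] f)%:E.
have ind0 f : 0 <= ind f by rewrite lee_fin indicE.
have hze0 f z : 0 <= (hz f.1 f.2 z)%:E by rewrite lee_fin.
set m := EE p1 _.
have m0 : 0 <= m by apply: ex_ge0 => a; apply: ex_ge0.
rewrite [X in X + _ <= _](_ : _ = E ind)//.
have EN : E (fun f => (N f.1 f.2)%:E) = m.
  under eq_ex do rewrite -sumEFin.
  rewrite ex_sum => [|z f]; last by rewrite lee_fin.
  rewrite -[RHS]mul1e -MV -sumEFin ge0_sume_distrl//.
  apply: eq_bigr => z _; under eq_ex do rewrite EFinM.
  by rewrite exZ// /m -(mean_codebook z).
(* The M diagonal terms are at most A and the M (M - 1) others at most 1, which after division by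
   M^2 gives (A - 1) / M + 1. *)
have EN2 : E (fun f => (N f.1 f.2 ^+ 2)%:E) <= ((A - 1) / M + 1)%:E.
  have NE f : ((N f.1 f.2) ^+ 2 = 
      \sum_z \sum_z' M^-1 * M^-1 * (hz f.1 f.2 z * hz f.1 f.2 z'))%R.
    rewrite expr2 /N mulr_suml; apply: eq_bigr => z _; rewrite mulr_sumr.
    by apply: eq_bigr => z' _; rewrite mulrACA.
  have t0 f z z' : (0 <= M^-1 * M^-1 * (hz f.1 f.2 z * hz f.1 f.2 z'))%R.
    by rewrite !mulr_ge0.
  under eq_ex do rewrite NE -sumEFin.
  rewrite ex_sum => [|z f]; last by rewrite lee_fin sumr_ge0.
  apply: (@le_trans _ _ (\sum_(z : Z) \sum_(z' : Z) (M^-1 * M^-1 * (if z == z' then A else 1))%:E)).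
    apply: lee_sum => z _; under eq_ex do rewrite -sumEFin.
    rewrite ex_sum => [|z' f]; last by rewrite lee_fin.
    apply: lee_sum => z' _; under eq_ex do rewrite EFinM.
    rewrite exZ; [|by rewrite lee_fin mulr_ge0|by move=> f; rewrite lee_fin mulr_ge0].
    rewrite [leRHS]EFinM; apply: lee_wpmul2l; first by rewrite lee_fin mulr_ge0.
    by apply: le_trans (second_moment_codebook z z') _; case: ifP.
  under eq_bigr do rewrite sumEFin.
  rewrite sumEFin lee_fin le_eqVlt; apply/orP; left; apply/eqP.
  have -> : (\sum_(z : Z) \sum_(z' : Z) M^-1 * M^-1 * (if z == z' then A else 1)
      = \sum_(z : Z) (M^-1 * M^-1 * (A - 1) + M^-1))%R.
    apply: eq_bigr => z _; rewrite (bigD1 z)//= eqxx.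
    rewrite (eq_bigr (fun=> M^-1 * M^-1)%R); last first.
      by move=> z' /negbTE zz'; rewrite eq_sym zz' mulr1.
    have : (\sum_(z' : Z) M^-1 * M^-1 = M^-1)%R by rewrite -mulr_suml MV mul1r.
    by rewrite (bigD1 z)//=; set X := (\sum_(_ | _) _)%R => /(canRL (addKr _)) ->; ring.
  rewrite big_split/= MV -!mulr_suml MV; ring.
have -> : 2%:E * m = E (fun f => 2%:E * (N f.1 f.2)%:E).
  by rewrite exZ ?EN// => f; rewrite lee_fin.
rewrite -exD// => [|f]; last by rewrite mule_ge0 ?lee_fin.
apply: (@le_trans _ _ (E (fun f => (N f.1 f.2 ^+ 2)%:E + 1))); last first.
  rewrite exD ?ex_cst// => [|f]; last by rewrite lee_fin sqr_ge0.
  rewrite (_ : (_ + 2)%:E = ((A - 1) / M + 1)%:E + 1%:E); last first.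
    by rewrite -EFinD; congr EFin; ring.
  by rewrite leeD2r.
apply: ex_le => f; first by rewrite adde_ge0// mule_ge0 ?lee_fin.
rewrite /ind -EFinM -!EFinD lee_fin indicE.
have [/set_mem h00|_] := boolP (f \in _).
  have -> : N f.1 f.2 = 0%R by apply: big1 => z _; rewrite h00 mulr0.
  by rewrite mulr0 addr0 expr0n/= add0r.
rewrite -subr_ge0; set x := N _ _.
have -> : (x ^+ 2 + 1 - (false%:R + 2 * x) = (x - 1) ^+ 2)%R by rewrite /=; ring.
exact: sqr_ge0.
Qed.

End Covering.

(** * Random superposition codes *)

Ltac nneg := intros; repeat (first [by auto | apply: ex_ge0; intros]).

Section Packing.
Context (R : realType) (U V1 V2 X1 X2 Y : choiceType).
Variables (pU : massfn R U) (p1 : U -> massfn R V1) (p2 : U -> massfn R V2).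
Variables (q1 : U -> V1 -> massfn R X1) (q2 : U -> V2 -> massfn R X2).
Variable W : X1 -> X2 -> massfn R Y.
Local Open Scope ereal_scope.

Definition ind (b : bool) : \bar R := (b%:R)%:E.

Lemma ind_ge0 b : 0 <= ind b. Proof. by rewrite lee_fin. Qed.
Hint Resolve ind_ge0 : core.

(** Mean over a competing codeword given the sent one: a flag tells whether the letter is drawn
    anew, from the kernel at the competitor's own earlier letters, or shared with the sent
    codeword. *)
Definition fake (du d1 d2 e1 e2 : bool) (u : U) (v1 : V1) (v2 : V2) (x1 : X1) (x2 : X2)
    (G : U -> V1 -> V2 -> X1 -> X2 -> \bar R) : \bar R :=
  copyx du u pU (fun u' => copyx d1 v1 (p1 u') (fun v1' => copyx d2 v2 (p2 u') (fun v2' =>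
  copyx e1 x1 (q1 u' v1') (fun x1' => copyx e2 x2 (q2 u' v2') (G u' v1' v2' x1'))))).

(** The codebook draws both codewords level by level, whereas the packing bounds want the sent
    codeword and the output fixed before the competitor is drawn. The two orders agree by repeated
    Fubini, since each kernel looks only at earlier letters of its own codeword. *)
Lemma interleaved_chains du d1 d2 e1 e2
    (S : U -> V1 -> V2 -> \bar R) (G : U -> V1 -> V2 -> X1 -> X2 -> Y -> \bar R) :
  (forall u v1 v2, 0 <= S u v1 v2) -> (forall u v1 v2 x1 x2 y, 0 <= G u v1 v2 x1 x2 y) ->
  EE pU (fun u => copyx du u pU (fun u' =>
  EE (p1 u) (fun v1 => copyx d1 v1 (p1 u') (fun v1' =>
  EE (p2 u) (fun v2 => copyx d2 v2 (p2 u') (fun v2' =>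
  EE (q1 u v1) (fun x1 => copyx e1 x1 (q1 u' v1') (fun x1' =>
  EE (q2 u v2) (fun x2 => copyx e2 x2 (q2 u' v2') (fun x2' =>
    S u v1 v2 * EE (W x1 x2) (G u' v1' v2' x1' x2')))))))))))
  = EE pU (fun u => EE (p1 u) (fun v1 => EE (p2 u) (fun v2 => S u v1 v2 *
  EE (q1 u v1) (fun x1 => EE (q2 u v2) (fun x2 => EE (W x1 x2) (fun y =>
    fake du d1 d2 e1 e2 u v1 v2 x1 x2 (fun u' v1' v2' x1' x2' => G u' v1' v2' x1' x2' y))))))).
Proof.
move=> S0 G0.
have SG0 u v1 v2 (q : massfn R Y) u' v1' v2' x1' x2' :
    0 <= S u v1 v2 * EE q (G u' v1' v2' x1' x2').
  by rewrite mule_ge0// ex_ge0.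
apply: eq_ex => u.
pose K1 u' v1 v2 x1 x2 := fun v1' v2' =>
  copyx e1 x1 (q1 u' v1') (fun x1' => copyx e2 x2 (q2 u' v2') (fun x2' =>
    S u v1 v2 * EE (W x1 x2) (G u' v1' v2' x1' x2'))).
have K10 u' v1 v2 x1 x2 v1' v2' : 0 <= K1 u' v1 v2 x1 x2 v1' v2' by rewrite /K1; nneg.
pose K2 u' v1 v2 x1 x2 := fun v1' => copyx d2 v2 (p2 u') (K1 u' v1 v2 x1 x2 v1').
have K20 u' v1 v2 x1 x2 v1' : 0 <= K2 u' v1 v2 x1 x2 v1' by rewrite /K2; nneg.
pose K3 u' v1 v2 x1 x2 := copyx d1 v1 (p1 u') (K2 u' v1 v2 x1 x2).
have K30 u' v1 v2 x1 x2 : 0 <= K3 u' v1 v2 x1 x2 by rewrite /K3; nneg.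
transitivity (copyx du u pU (fun u' => EE (p1 u) (fun v1 => EE (p2 u) (fun v2 =>
  EE (q1 u v1) (fun x1 => EE (q2 u v2) (fun x2 => K3 u' v1 v2 x1 x2)))))).
  apply: eq_ex => u'; apply: eq_ex => v1.
  transitivity (copyx d1 v1 (p1 u') (fun v1' => EE (p2 u) (fun v2 => EE (q1 u v1) (fun x1 =>
    EE (q2 u v2) (fun x2 => K2 u' v1 v2 x1 x2 v1'))))).
    apply: eq_ex => v1'; apply: eq_ex => v2.
    transitivity (copyx d2 v2 (p2 u') (fun v2' => EE (q1 u v1) (fun x1 =>
      EE (q2 u v2) (fun x2 => K1 u' v1 v2 x1 x2 v1' v2')))).
      by apply: eq_ex => v2'; apply: eq_ex => x1; rewrite ex_swap//; nneg.
    by rewrite ex_swap; [apply: eq_ex => x1; rewrite ex_swap|nneg].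
  rewrite ex_swap; [apply: eq_ex => v2|nneg].
  by rewrite ex_swap; [apply: eq_ex => x1; rewrite ex_swap|nneg].
rewrite ex_swap; [apply: eq_ex => v1|nneg].
rewrite ex_swap; [apply: eq_ex => v2|nneg].
rewrite -exZ; [|by []|by rewrite /fake; nneg].
rewrite ex_swap; [apply: eq_ex => x1|nneg].
rewrite -exZ; [|by []|by rewrite /fake; nneg].
rewrite ex_swap; [apply: eq_ex => x2|nneg].
rewrite /K3 /K2 /K1 /fake.
rewrite -ex_swap; last by nneg.
rewrite -exZ//; last by nneg.
apply: eq_ex => u'; rewrite -ex_swap; last by nneg.
rewrite -exZ//; last by nneg.
apply: eq_ex => v1'; rewrite -ex_swap; last by nneg.
rewrite -exZ//; last by nneg.
apply: eq_ex => v2'; rewrite -ex_swap; last by nneg.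
rewrite -exZ//; last by nneg.
apply: eq_ex => x1'; rewrite -ex_swap; last by nneg.
by rewrite -exZ//; nneg.
Qed.

Variables (A1 A2 B1 B2 C1 C2 Z1 Z2 : finType).
Let A := (A1 * A2)%type.
Let I1 := (A * B1 * Z1)%type.
Let I2 := (A * B2 * Z2)%type.
Let J1 := (I1 * C1)%type.
Let J2 := (I2 * C2)%type.

Record codebook := Codebook {
  cu : A -> U; cv1 : I1 -> V1; cv2 : I2 -> V2; cx1 : J1 -> X1; cx2 : J2 -> X2 }.

Definition random_codebook : expect R codebook :=
  bindx (rfun (fun _ : A => pU)) (fun u =>
  bindx (rfun (fun i : I1 => p1 (u i.1.1))) (fun v1 =>
  bindx (rfun (fun i : I2 => p2 (u i.1.1))) (fun v2 =>
  bindx (rfun (fun j : J1 => q1 (u j.1.1.1) (v1 j.1))) (fun x1 =>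
  bindx (rfun (fun j : J2 => q2 (u j.1.1.1) (v2 j.1))) (fun x2 =>
  retx R (Codebook u v1 v2 x1 x2)))))).

(* A message pair is [(a, b1, b2, c1, c2)]: [a] is known to both encoders
   through the facilitator, [b_i] is known to encoder [i] and the facilitator,
   and [c_i] to encoder [i] only. *)
Definition msg := (A * B1 * B2 * C1 * C2)%type.
Implicit Types (w : msg) (z : Z1 * Z2) (cb : codebook).

Let ma w : A := w.1.1.1.1.
Let mb1 w : B1 := w.1.1.1.2.
Let mb2 w : B2 := w.1.1.2.
Let mc1 w : C1 := w.1.2.
Let mc2 w : C2 := w.2.

Definition i1 w z : I1 := (ma w, mb1 w, z.1).
Definition i2 w z : I2 := (ma w, mb2 w, z.2).
Definition j1 w z : J1 := (i1 w z, mc1 w).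
Definition j2 w z : J2 := (i2 w z, mc2 w).

(** The union bound compares two codewords at a time, so this is all that false alarms require of
    the codebook: the joint law of the letters at two fixed index pairs. *)
Lemma codebook_marginal2 w z w' z'
    (G : U -> U -> V1 -> V1 -> V2 -> V2 -> X1 -> X1 -> X2 -> X2 -> \bar R) :
  (forall u u' v1 v1' v2 v2' x1 x1' x2 x2', 0 <= G u u' v1 v1' v2 v2' x1 x1' x2 x2') ->
  random_codebook (fun cb => G (cu cb (ma w)) (cu cb (ma w')) (cv1 cb (i1 w z)) (cv1 cb (i1 w' z'))
    (cv2 cb (i2 w z)) (cv2 cb (i2 w' z')) (cx1 cb (j1 w z)) (cx1 cb (j1 w' z'))
    (cx2 cb (j2 w z)) (cx2 cb (j2 w' z')))
  = EE pU (fun u => copyx (ma w != ma w') u pU (fun u' =>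
  EE (p1 u) (fun v1 => copyx (i1 w z != i1 w' z') v1 (p1 u') (fun v1' =>
  EE (p2 u) (fun v2 => copyx (i2 w z != i2 w' z') v2 (p2 u') (fun v2' =>
  EE (q1 u v1) (fun x1 => copyx (j1 w z != j1 w' z') x1 (q1 u' v1') (fun x1' =>
  EE (q2 u v2) (fun x2 => copyx (j2 w z != j2 w' z') x2 (q2 u' v2') (fun x2' =>
    G u u' v1 v1' v2 v2' x1 x1' x2 x2')))))))))).
Proof.
move=> G0; rewrite /random_codebook.
pose G1 u u' v1 v1' v2 v2' x1 x1' :=
  EE (q2 u v2) (fun x2 => copyx (j2 w z != j2 w' z') x2 (q2 u' v2') (fun x2' =>
    G u u' v1 v1' v2 v2' x1 x1' x2 x2')).
have G10 u u' v1 v1' v2 v2' x1 x1' : 0 <= G1 u u' v1 v1' v2 v2' x1 x1' by rewrite /G1; nneg.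
pose G2 u u' v1 v1' v2 v2' :=
  EE (q1 u v1) (fun x1 => copyx (j1 w z != j1 w' z') x1 (q1 u' v1') (fun x1' =>
    G1 u u' v1 v1' v2 v2' x1 x1')).
have G20 u u' v1 v1' v2 v2' : 0 <= G2 u u' v1 v1' v2 v2' by rewrite /G2; nneg.
pose G3 u u' v1 v1' :=
  EE (p2 u) (fun v2 => copyx (i2 w z != i2 w' z') v2 (p2 u') (fun v2' =>
    G2 u u' v1 v1' v2 v2')).
have G30 u u' v1 v1' : 0 <= G3 u u' v1 v1' by rewrite /G3; nneg.
pose G4 u u' :=
  EE (p1 u) (fun v1 => copyx (i1 w z != i1 w' z') v1 (p1 u') (fun v1' =>
    G3 u u' v1 v1')).
have G40 u u' : 0 <= G4 u u' by rewrite /G4; nneg.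
transitivity (rfun (fun _ : A => pU) (fun u => G4 (u (ma w)) (u (ma w')))); last first.
  by rewrite rfun2.
rewrite bindxE; apply: eq_ex => u; rewrite /G4.
transitivity (rfun (fun i : I1 => p1 (u i.1.1)) (fun v1 =>
    G3 (u (ma w)) (u (ma w')) (v1 (i1 w z)) (v1 (i1 w' z')))); last first.
  by rewrite rfun2.
rewrite bindxE; apply: eq_ex => v1; rewrite /G3.
transitivity (rfun (fun i : I2 => p2 (u i.1.1)) (fun v2 =>
    G2 (u (ma w)) (u (ma w')) (v1 (i1 w z)) (v1 (i1 w' z')) (v2 (i2 w z)) (v2 (i2 w' z'))));
  last first.
  by rewrite rfun2.
rewrite bindxE; apply: eq_ex => v2; rewrite /G2.
transitivity (rfun (fun j : J1 => q1 (u j.1.1.1) (v1 j.1)) (fun x1 =>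
    G1 (u (ma w)) (u (ma w')) (v1 (i1 w z)) (v1 (i1 w' z')) (v2 (i2 w z)) (v2 (i2 w' z'))
     (x1 (j1 w z)) (x1 (j1 w' z')))); last first.
  by rewrite rfun2.
rewrite bindxE; apply: eq_ex => x1; rewrite /G1.
rewrite bindxE.
exact: (rfun2 (fun j : J2 => q2 (u j.1.1.1) (v2 j.1)) (j2 w z) (j2 w' z') (fun x2 x2' =>
  G (u (ma w)) (u (ma w')) (v1 (i1 w z)) (v1 (i1 w' z')) (v2 (i2 w z)) (v2 (i2 w' z'))
     (x1 (j1 w z)) (x1 (j1 w' z')) x2 x2') _).
Qed.

Variable (D : U -> V1 -> V2 -> X1 -> X2 -> Y -> bool).
Variables (b0 b12 b1c b1o b2c b2o bcc bc1 bc2 : R).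
Hypotheses (b0_ge0 : (0 <= b0)%R) (b12_ge0 : (0 <= b12)%R) (b1c_ge0 : (0 <= b1c)%R)
  (b1o_ge0 : (0 <= b1o)%R) (b2c_ge0 : (0 <= b2c)%R) (b2o_ge0 : (0 <= b2o)%R)
  (bcc_ge0 : (0 <= bcc)%R) (bc1_ge0 : (0 <= bc1)%R) (bc2_ge0 : (0 <= bc2)%R).
Let iD u v1 v2 x1 x2 y := ind (D u v1 v2 x1 x2 y).
Hypothesis D0 : forall y, EE pU (fun u => EE (p1 u) (fun v1 => EE (p2 u) (fun v2 =>
  EE (q1 u v1) (fun x1 => EE (q2 u v2) (fun x2 => iD u v1 v2 x1 x2 y))))) <= b0%:E.
Hypothesis D12 : forall u y, EE (p1 u) (fun v1 => EE (p2 u) (fun v2 =>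
  EE (q1 u v1) (fun x1 => EE (q2 u v2) (fun x2 => iD u v1 v2 x1 x2 y)))) <= b12%:E.
Hypothesis D1c : forall u v2 y, EE (p1 u) (fun v1 =>
  EE (q1 u v1) (fun x1 => EE (q2 u v2) (fun x2 => iD u v1 v2 x1 x2 y))) <= b1c%:E.
Hypothesis D1o : forall u v2 x2 y, EE (p1 u) (fun v1 =>
  EE (q1 u v1) (fun x1 => iD u v1 v2 x1 x2 y)) <= b1o%:E.
Hypothesis D2c : forall u v1 y, EE (p2 u) (fun v2 =>
  EE (q1 u v1) (fun x1 => EE (q2 u v2) (fun x2 => iD u v1 v2 x1 x2 y))) <= b2c%:E.
Hypothesis D2o : forall u v1 x1 y, EE (p2 u) (fun v2 =>
  EE (q2 u v2) (fun x2 => iD u v1 v2 x1 x2 y)) <= b2o%:E.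
Hypothesis Dcc : forall u v1 v2 y,
  EE (q1 u v1) (fun x1 => EE (q2 u v2) (fun x2 => iD u v1 v2 x1 x2 y)) <= bcc%:E.
Hypothesis Dc1 : forall u v1 v2 x2 y, EE (q1 u v1) (fun x1 => iD u v1 v2 x1 x2 y) <= bc1%:E.
Hypothesis Dc2 : forall u v1 v2 x1 y, EE (q2 u v2) (fun x2 => iD u v1 v2 x1 x2 y) <= bc2%:E.

(** A wrong [a] makes all letters fresh, and a wrong b_i makes v_i and x_i fresh whatever c_i is; so
    c_i is tested only where b_i agrees. As the messages differ, the last branch is a wrong c_2
    alone. *)
Definition confusion w w' : R :=
  if ma w != ma w' then b0 else
  if mb1 w != mb1 w' then
    if mb2 w != mb2 w' then b12 else if mc2 w != mc2 w' then b1c else b1o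
  else if mb2 w != mb2 w' then if mc1 w != mc1 w' then b2c else b2o
  else if mc1 w != mc1 w' then if mc2 w != mc2 w' then bcc else bc1
  else bc2.

Lemma confusion_ge0 w w' : (0 <= confusion w w')%R.
Proof. by rewrite /confusion; do !case: ifP => _. Qed.

(* The facilitator's indices depend on [(a, b1, b2)] only. *)
Definition compatible w w' z z' : bool := (w.1.1 == w'.1.1) ==> (z == z').

(** A different index z_i may refresh v_i and x_i although b_i is right. The bound of the pattern
    holds for every value of these letters, so averaging over them is harmless. If (a, b1, b2) is
    right, [compatible] forces equal indices and only the x letters can be fresh. *)
Lemma fake_le w w' z z' u v1 v2 x1 x2 y : w != w' -> compatible w w' z z' ->
  fake (ma w != ma w') (i1 w z != i1 w' z') (i2 w z != i2 w' z')
     (j1 w z != j1 w' z') (j2 w z != j2 w' z') u v1 v2 x1 x2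
     (fun u v1 v2 x1 x2 => iD u v1 v2 x1 x2 y) <= (confusion w w')%:E.
Proof.
case: w => -[[[a mb1_] mb2_] mc1_] mc2_; case: w' => -[[[a' mb1'] mb2'] mc1'] mc2'.
case: z => z1 z2; case: z' => z1' z2'.
rewrite /compatible /confusion /j1 /j2 /i1 /i2 /ma /mb1 /mb2 /mc1 /mc2 !xpair_eqE /=.
have iD0 u0 v10 v20 x10 x20 : 0 <= iD u0 v10 v20 x10 x20 y by exact: ind_ge0.
rewrite /fake.
have [_|_] := eqVneq a a' => /=; last by move=> _ _; exact: D0.
have [_|_] := eqVneq mb1_ mb1' => /=; have [_|_] := eqVneq mb2_ mb2' => /=; last first.
- by move=> _ _; rewrite /copyx; exact: D12.
- move=> _ _; have [_|_] := eqVneq mc2_ mc2' => /=; have [_|_] := eqVneq z2 z2' => /=;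
    rewrite /copyx /=.
  + exact: D1o.
  + rewrite ex_swap; last by nneg.
    apply: ex_le_cst => [v2'|v2'|]; [by nneg| |by rewrite lee_fin].
    under eq_ex => v1' do rewrite ex_swap//.
    rewrite ex_swap; last by nneg.
    by apply: ex_le_cst => [x2'|x2'|]; [nneg|exact: D1o|rewrite lee_fin].
  + exact: D1c.
  + rewrite ex_swap; last by nneg.
    by apply: ex_le_cst => [v2'|v2'|]; [nneg|exact: D1c|rewrite lee_fin].
- move=> _ _; have [_|_] := eqVneq mc1_ mc1' => /=; have [_|_] := eqVneq z1 z1' => /=;
    rewrite /copyx /=.
  + exact: D2o.
  + apply: ex_le_cst => [v1'|v1'|]; [by nneg| |by rewrite lee_fin].
    rewrite ex_swap; last by nneg.
    by apply: ex_le_cst => [x1'|x1'|]; [nneg|exact: D2o|rewrite lee_fin].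
  + exact: D2c.
  + by apply: ex_le_cst => [v1'|v1'|]; [nneg|exact: D2c|rewrite lee_fin].
- move=> + /andP[/eqP<- /eqP<-]; rewrite !eqxx /=.
  case: (mc1_ =P mc1') => _; case: (mc2_ =P mc2') => _ /=.
  + by [].
  + by move=> _; exact: Dc2.
  + by move=> _; exact: Dc1.
  + by move=> _; exact: Dcc.
Qed.

Variables (T : U -> V1 -> V2 -> bool) (w0 : msg) (z0 : Z1 * Z2) (tau miss : R).
Hypotheses (tau_ge0 : (0 <= tau)%R) (miss_ge0 : (0 <= miss)%R).
Hypothesis T_le : EE pU (fun u => EE (p1 u) (fun v1 => EE (p2 u) (fun v2 =>
  ind (T u v1 v2)))) <= tau%:E.
Hypothesis T_miss : forall u v1 v2, T u v1 v2 ->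
  EE (q1 u v1) (fun x1 => EE (q2 u v2) (fun x2 => EE (W x1 x2) (fun y =>
    ind (~~ D u v1 v2 x1 x2 y)))) <= miss%:E.

Definition Tat (u : A -> U) (v1 : I1 -> V1) (v2 : I2 -> V2) w z : bool :=
  T (u (ma w)) (v1 (i1 w z)) (v2 (i2 w z)).

Definition sel (u : A -> U) (v1 : I1 -> V1) (v2 : I2 -> V2) w : Z1 * Z2 :=
  odflt z0 [pick z | Tat u v1 v2 w z].

Definition covered (u : A -> U) (v1 : I1 -> V1) (v2 : I2 -> V2) w : bool :=
  [exists z, Tat u v1 v2 w z].

Lemma covered_sel u v1 v2 w : covered u v1 v2 w -> Tat u v1 v2 w (sel u v1 v2 w).
Proof.
move=> /existsP[z hz]; rewrite /sel; case: pickP => //= h.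
by have := h z; rewrite hz.
Qed.

Lemma sel_eq u v1 v2 w w' : w.1.1 = w'.1.1 -> sel u v1 v2 w = sel u v1 v2 w'.
Proof. by move=> h; rewrite /sel /Tat /i1 /i2 /ma /mb1 /mb2 h. Qed.

Definition csel cb w := sel (cu cb) (cv1 cb) (cv2 cb) w.

Definition Dat cb w z y : bool :=
  D (cu cb (ma w)) (cv1 cb (i1 w z)) (cv2 cb (i2 w z)) (cx1 cb (j1 w z)) (cx2 cb (j2 w z)) y.

(** The decoder knows the codebook and recomputes the facilitator's choice for each candidate, so it
    searches over messages and not over indices. *)
Definition decode cb y : msg := odflt w0 [pick w | Dat cb w (csel cb w) y].

Definition err cb w : \bar R :=
  EE (W (cx1 cb (j1 w (csel cb w))) (cx2 cb (j2 w (csel cb w)))) (fun y => ind (decode cb y != w)).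

Definition miss_at cb w : \bar R :=
  ind (covered (cu cb) (cv1 cb) (cv2 cb) w) *
  EE (W (cx1 cb (j1 w (csel cb w))) (cx2 cb (j2 w (csel cb w))))
    (fun y => ind (~~ Dat cb w (csel cb w) y)).

Definition fake_at cb w w' z z' : \bar R :=
  ind (Tat (cu cb) (cv1 cb) (cv2 cb) w z) *
  EE (W (cx1 cb (j1 w z)) (cx2 cb (j2 w z))) (fun y => ind (Dat cb w' z' y)).

Lemma fake_at_ge0 cb w w' z z' : 0 <= fake_at cb w w' z z'.
Proof. by rewrite mule_ge0//; nneg. Qed.
Hint Resolve fake_at_ge0 : core.

Lemma miss_at_ge0 cb w : 0 <= miss_at cb w.
Proof. by rewrite mule_ge0//; nneg. Qed.

(* The union bound runs over the true facilitator indices [z] as well: the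
   selected pair depends on the whole codebook, while a fixed pair does not. *)
Lemma err_le cb w :
  err cb w <= ind (~~ covered (cu cb) (cv1 cb) (cv2 cb) w) + miss_at cb w +
    \sum_(w' | w' != w) \sum_z \sum_(z' | compatible w w' z z') fake_at cb w w' z z'.
Proof.
have S0 : 0 <= \sum_(w' | w' != w) \sum_z \sum_(z' | compatible w w' z z') fake_at cb w w' z z'.
  by do 3 apply: sume_ge0 => ? _.
have [cov|ncov] := boolP (covered (cu cb) (cv1 cb) (cv2 cb) w); last first.
  apply: (@le_trans _ _ 1); last first.
    by rewrite -[leLHS]adde0 -[in leLHS](adde0 1) !leeD// miss_at_ge0.
  by apply: ex_le1 => // y; rewrite lee_fin lern1 leq_b1.
have Ts := covered_sel cov; rewrite {1}/ind /= add0e.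
set s := csel cb w.
apply: (@le_trans _ _ (EE (W (cx1 cb (j1 w s)) (cx2 cb (j2 w s))) (fun y =>
    ind (~~ Dat cb w s y) + \sum_(w' | w' != w) ind (Dat cb w' (csel cb w') y)))).
  apply: ex_le => // y.
  have [Dw|] := boolP (Dat cb w s y); last first.
    move=> _; apply: (@le_trans _ _ 1); first by rewrite lee_fin lern1 leq_b1.
    by rewrite leeDl// sume_ge0.
  rewrite {2}/ind /= add0e.
  have [_|dw] := eqVneq (decode cb y) w; first by rewrite sume_ge0.
  rewrite (bigD1 (decode cb y))//= -[leLHS]adde0 leeD ?sume_ge0//.
  rewrite lee_fin /= ler1n lt0b.
  by rewrite /decode; case: pickP => //= /(_ w); rewrite Dw.
rewrite exD => [||y]; [|by []|by rewrite sume_ge0].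
rewrite ex_sum//; apply: leeD; first by rewrite /miss_at cov mul1e.
apply: lee_sum => w' _.
apply: (@le_trans _ _ (fake_at cb w w' s (csel cb w'))).
  by rewrite /fake_at Ts mul1e.
(* Only the term at the actual indices is kept. It does occur in the sum: by [sel_eq], messages with
   the same (a, b1, b2) select the same pair. *)
rewrite (bigD1 s)//= (bigD1 (csel cb w'))/=; last first.
  by rewrite /compatible; apply/implyP => /eqP /sel_eq h; apply/eqP/h.
by rewrite -addeA leeDl// adde_ge0//; do ?apply: sume_ge0 => ? _.
Qed.

(** [fake_le] is uniform in the sent letters and the output, so [confusion] factors out and the mean
    of the indicator of [T] that remains is bounded by [tau]. *)
Lemma ex_fake_at w w' z z' : w != w' -> compatible w w' z z' ->
  random_codebook (fun cb => fake_at cb w w' z z') <= (tau * confusion w w')%:E.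
Proof.
move=> ww' zz'.
pose G u (u' : U) v1 (v1' : V1) v2 (v2' : V2) x1 (x1' : X1) x2 (x2' : X2) :=
  ind (T u v1 v2) * EE (W x1 x2) (iD u' v1' v2' x1' x2').
rewrite [leLHS](codebook_marginal2 w z w' z' (G := G)); last first.
  by move=> *; rewrite mule_ge0//; nneg; exact: ind_ge0.
rewrite (interleaved_chains _ _ _ _ _ (S := fun u v1 v2 => ind (T u v1 v2)) (G := iD))//;
  last by move=> *; exact: ind_ge0.
rewrite EFinM; apply: le_trans (lee_wpmul2r _ T_le); last by rewrite lee_fin confusion_ge0.
have F0 u v1 v2 x1 x2 y : 0 <= fake (ma w != ma w') (i1 w z != i1 w' z')
    (i2 w z != i2 w' z') (j1 w z != j1 w' z') (j2 w z != j2 w' z') u v1 v2 x1 x2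
    (fun u v1 v2 x1 x2 => iD u v1 v2 x1 x2 y).
  by rewrite /fake; nneg; exact: ind_ge0.
have c0 : 0 <= (confusion w w')%:E by rewrite lee_fin confusion_ge0.
rewrite -exZr//; last by nneg.
have g0 u v1 v2 : 0 <= ind (T u v1 v2) * EE (q1 u v1) (fun x1 => EE (q2 u v2) (fun x2 => EE (W x1 x2) (fun y =>
   fake (ma w != ma w') (i1 w z != i1 w' z')
    (i2 w z != i2 w' z') (j1 w z != j1 w' z') (j2 w z != j2 w' z') u v1 v2 x1 x2
    (fun u v1 v2 x1 x2 => iD u v1 v2 x1 x2 y)))).
  by rewrite mule_ge0//; nneg.
apply: ex_le => u; first by nneg.
rewrite -exZr//; last by nneg.
apply: ex_le => v1; first by nneg.
rewrite -exZr//.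
apply: ex_le => v2; first by nneg.
apply: lee_wpmul2l => //.
apply: ex_le_cst => // x1; first by nneg.
apply: ex_le_cst => // x2; first by nneg.
by apply: ex_le_cst => // y; apply: fake_le.
Qed.

(** The selection looks at the u and v codewords only. Once these are fixed, the x codewords at the
    selected indices still have their conditional laws, and [T_miss] applies. *)
Lemma ex_miss_at w : random_codebook (fun cb => miss_at cb w) <= miss%:E.
Proof.
rewrite /random_codebook !bindxE.
have m0 : 0 <= miss%:E by rewrite lee_fin.
apply: ex_le_cst => // [u|u]; first by nneg; exact: miss_at_ge0.
rewrite bindxE; apply: ex_le_cst => // [v1|v1]; first by nneg; exact: miss_at_ge0.
rewrite bindxE; apply: ex_le_cst => // [v2|v2]; first by nneg; exact: miss_at_ge0.
rewrite bindxE /miss_at /csel /Dat /=.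
set s := sel _ _ _ _.
pose H x1 x2 := ind (covered u v1 v2 w) * EE (W x1 x2) (fun y =>
  ind (~~ D (u (ma w)) (v1 (i1 w s)) (v2 (i2 w s)) x1 x2 y)).
have H0 x1 x2 : 0 <= H x1 x2 by rewrite mule_ge0//; nneg.
under eq_ex => x1.
  rewrite (rfun1 _ (j2 w s) (H (x1 (j1 w s))))//.
  over.
rewrite (rfun1 (fun j : J1 => q1 (u j.1.1.1) (v1 j.1)) (j1 w s) (fun x1 =>
  EE (q2 (u (ma w)) (v2 (i2 w s))) (H x1))); last by nneg.
rewrite /H; have [cov|_] := boolP (covered u v1 v2 w); last first.
  rewrite (_ : (fun _ => _) = cst 0); first by rewrite ex_cst.
  by apply/funext => x1; rewrite -[RHS](ex_cst (EE (q2 (u (ma w)) (v2 (i2 w s)))) (lexx 0));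
     apply: eq_ex => x2; rewrite mul0e.
under eq_ex => x1 do under eq_ex => x2 do rewrite mul1e.
exact: T_miss (covered_sel cov).
Qed.

Variables (kappa sigma eta : R).
Hypothesis cov_le : forall w, random_codebook (fun cb =>
  ind (~~ covered (cu cb) (cv1 cb) (cv2 cb) w)) <= kappa%:E.
Hypothesis confusion_le : forall w, (\sum_(w' | w' != w) \sum_(z : Z1 * Z2)
  \sum_(z' : Z1 * Z2 | compatible w w' z z') tau * confusion w w' <= sigma)%R.
Hypothesis eta_gt : (kappa + miss + sigma < eta)%R.

Lemma good_codebook :
  exists cb, \sum_w ((#|{: msg}|%:R)^-1)%:E * err cb w < eta%:E.
Proof.
have err0 cb w : 0 <= err cb w by rewrite /err; nneg.
have M0 : (0 < #|{: msg}|%:R :> R)%R by rewrite ltr0n; apply/card_gt0P; exists w0.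
have M'0 : (0 <= (#|{: msg}|%:R)^-1 :> R)%R by rewrite invr_ge0 ltW.
have Eerr w : random_codebook (fun cb => err cb w) <= (kappa + miss + sigma)%:E.
  have S0 cb : 0 <= \sum_(w' | w' != w) \sum_z \sum_(z' | compatible w w' z z') fake_at cb w w' z z'.
    by do 3 apply: sume_ge0 => ? _.
  apply: le_trans (ex_le _ (fun cb => err0 cb w) (fun cb => err_le cb w)) _.
  rewrite exD => [|cb|//]; last by rewrite adde_ge0 ?miss_at_ge0.
  rewrite exD => [|//|cb]; last exact: miss_at_ge0.
  rewrite !EFinD leeD ?leeD ?ex_miss_at//.
  rewrite ex_sum; last by move=> w' cb; do 2 apply: sume_ge0 => ? _.
  apply: (@le_trans _ _ (\sum_(w' | w' != w) \sum_(z : Z1 * Z2)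
    \sum_(z' : Z1 * Z2 | compatible w w' z z') (tau * confusion w w')%:E)); last first.
    under eq_bigr do under eq_bigr do rewrite sumEFin.
    under eq_bigr do rewrite sumEFin.
    by rewrite sumEFin lee_fin.
  apply: lee_sum => w' ww'; rewrite ex_sum; last by move=> z cb; apply: sume_ge0 => ? _.
  apply: lee_sum => z _; rewrite ex_sum//.
  by apply: lee_sum => z' zz'; apply: ex_fake_at => //; rewrite eq_sym.
have eta0 : (0 <= kappa + miss + sigma)%R.
  by rewrite -lee_fin; apply: le_trans (Eerr w0); apply: ex_ge0.
apply: (@ex_witness _ _ random_codebook); first by rewrite lee_fin ltW// (le_lt_trans eta0).
rewrite ex_sum; last by move=> w cb; rewrite mule_ge0.
apply: (@le_lt_trans _ _ (\sum_(w : msg) ((#|{: msg}|%:R)^-1)%:E * (kappa + miss + sigma)%:E)).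
  apply: lee_sum => w _; rewrite exZ ?lee_fin//.
  by apply: lee_wpmul2l; rewrite ?lee_fin.
under eq_bigr do rewrite -EFinM.
rewrite sumEFin -mulr_suml sumr_const -(mulr_natl (_^-1)%R) mulfV ?mul1r ?lte_fin//.
by rewrite gt_eqF.
Qed.

End Packing.

(** * Counting wrong messages by pattern *)

Section Counting.
Context (R : realType).

Lemma sum_pair_mul (S T : finType) (f : S -> R) (g : T -> R) :
  \sum_(p : S * T) f p.1 * g p.2 = (\sum_s f s) * (\sum_t g t).
Proof. by rewrite big_distrlr/= pair_bigA. Qed.

Lemma sum_eq (S : finType) (s0 : S) : \sum_s (s0 == s)%:R = 1 :> R.
Proof.
rewrite (bigD1 s0)//= eqxx big1 ?addr0// => s /negbTE; by rewrite eq_sym => ->.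
Qed.

Lemma sum_neq (S : finType) (s0 : S) : \sum_s (s0 != s)%:R = #|S|%:R - 1 :> R.
Proof.
transitivity (\sum_s (1 - (s0 == s)%:R) : R); last by rewrite sumrB sum_eq sumr_const.
by apply: eq_bigr => s _; case: eqP => _ /=; rewrite ?subrr ?subr0.
Qed.

Lemma sum_refl (S : finType) : \sum_(s : S) (s == s)%:R = #|S|%:R :> R.
Proof. by under eq_bigr do rewrite eqxx; rewrite sumr_const. Qed.

End Counting.

Section Confusion.
Context (R : realType) (U V1 V2 X1 X2 Y : choiceType).
Variables (pU : massfn R U) (p1 : U -> massfn R V1) (p2 : U -> massfn R V2).
Variables (q1 : U -> V1 -> massfn R X1) (q2 : U -> V2 -> massfn R X2).
Variable W : X1 -> X2 -> massfn R Y.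
Variables (A1 A2 B1 B2 C1 C2 Z1 Z2 : finType).
Let msg := msg A1 A2 B1 B2 C1 C2.

Variables (b0 b12 b1c b1o b2c b2o bcc bc1 bc2 tau : R).
Hypotheses (b0_ge0 : 0 <= b0) (b12_ge0 : 0 <= b12) (b1c_ge0 : 0 <= b1c)
  (b1o_ge0 : 0 <= b1o) (b2c_ge0 : 0 <= b2c) (b2o_ge0 : 0 <= b2o)
  (bcc_ge0 : 0 <= bcc) (bc1_ge0 : 0 <= bc1) (bc2_ge0 : 0 <= bc2) (tau0 : 0 <= tau).
Let conf := @confusion R A1 A2 B1 B2 C1 C2 b0 b12 b1c b1o b2c b2o bcc bc1 bc2.
Let M : R := #|{: Z1 * Z2}|%:R.
Let a : R := #|{: A1 * A2}|%:R.
Let b1 : R := #|B1|%:R.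
Let b2 : R := #|B2|%:R.
Let c1 : R := #|C1|%:R.
Let c2 : R := #|C2|%:R.

(** [tau * M] comes from the true indices. The indices of the wrong message bring a second [M],
    except when (a, b1, b2) is right and they coincide with the true ones. The polynomials in the
    alphabet sizes count the messages of each pattern. *)
Definition confusion_count : R :=
  tau * M * (M * ((a - 1) * b1 * b2 * c1 * c2 * b0 + (b1 - 1) * (b2 - 1) * c1 * c2 * b12
   + (b1 - 1) * c1 * (c2 - 1) * b1c + (b1 - 1) * c1 * b1o
   + (b2 - 1) * (c1 - 1) * c2 * b2c + (b2 - 1) * c2 * b2o)
   + ((c1 - 1) * (c2 - 1) * bcc + (c1 - 1) * bc1 + (c2 - 1) * bc2)).

Lemma sum_msg (f : A1 * A2 -> R) (g1 : B1 -> R) (g2 : B2 -> R) (h1 : C1 -> R) (h2 : C2 -> R) :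
  \sum_(w : msg) f w.1.1.1.1 * g1 w.1.1.1.2 * g2 w.1.1.2 * h1 w.1.2 * h2 w.2 =
  (\sum_s f s) * (\sum_s g1 s) * (\sum_s g2 s) * (\sum_s h1 s) * (\sum_s h2 s).
Proof.
rewrite (sum_pair_mul (fun p => f p.1.1.1 * g1 p.1.1.2 * g2 p.1.2 * h1 p.2) h2).
rewrite (sum_pair_mul (fun p => f p.1.1 * g1 p.1.2 * g2 p.2) h1).
by rewrite (sum_pair_mul (fun p => f p.1 * g1 p.2) g2) sum_pair_mul.
Qed.

Lemma confusion_sum_le (w : msg) :
  \sum_(w' | w' != w) \sum_(z : Z1 * Z2) \sum_(z' : Z1 * Z2 | compatible w w' z z')
    tau * conf w w' <= confusion_count.
Proof.
pose n (S : finType) (s s' : S) : R := (s != s')%:R.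
pose e (S : finType) (s s' : S) : R := (s == s')%:R.
(* [o] is the constant 1 disguised as an indicator, to give all nine summands the product shape that
   [sum_msg] factors. *)
pose o (S : finType) (s : S) : R := (s == s)%:R.
case: w => -[[[wa wb1] wb2] wc1] wc2; set w := (_, wc2).
pose t f g1 g2 h1 h2 := fun w' : msg =>
  f w'.1.1.1.1 * g1 w'.1.1.1.2 * g2 w'.1.1.2 * h1 w'.1.2 * h2 w'.2 : R.
pose S (w' : msg) := tau * M * (M * (
  n _ wa w'.1.1.1.1 * o _ w'.1.1.1.2 * o _ w'.1.1.2 * o _ w'.1.2 * o _ w'.2 * b0
 + e _ wa w'.1.1.1.1 * n _ wb1 w'.1.1.1.2 * n _ wb2 w'.1.1.2 * o _ w'.1.2 * o _ w'.2 * b12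
 + e _ wa w'.1.1.1.1 * n _ wb1 w'.1.1.1.2 * e _ wb2 w'.1.1.2 * o _ w'.1.2 * n _ wc2 w'.2 * b1c
 + e _ wa w'.1.1.1.1 * n _ wb1 w'.1.1.1.2 * e _ wb2 w'.1.1.2 * o _ w'.1.2 * e _ wc2 w'.2 * b1o
 + e _ wa w'.1.1.1.1 * e _ wb1 w'.1.1.1.2 * n _ wb2 w'.1.1.2 * n _ wc1 w'.1.2 * o _ w'.2 * b2c
 + e _ wa w'.1.1.1.1 * e _ wb1 w'.1.1.1.2 * n _ wb2 w'.1.1.2 * e _ wc1 w'.1.2 * o _ w'.2 * b2o)
 + (e _ wa w'.1.1.1.1 * e _ wb1 w'.1.1.1.2 * e _ wb2 w'.1.1.2 * n _ wc1 w'.1.2 * n _ wc2 w'.2 * bcc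
 + e _ wa w'.1.1.1.1 * e _ wb1 w'.1.1.1.2 * e _ wb2 w'.1.1.2 * n _ wc1 w'.1.2 * e _ wc2 w'.2 * bc1
 + e _ wa w'.1.1.1.1 * e _ wb1 w'.1.1.1.2 * e _ wb2 w'.1.1.2 * e _ wc1 w'.1.2 * n _ wc2 w'.2 * bc2)).
have S_ge0 w' : 0 <= S w'.
  by rewrite /S /n /e /o !(mulr_ge0, addr_ge0) ?ler0n.
apply: (@le_trans _ _ (\sum_(w' | w' != w) S w')).
  apply: ler_sum => w' ww'.
  have -> : \sum_(z : Z1 * Z2) \sum_(z' | compatible w w' z z') tau * conf w w'
     = tau * M * conf w w' * (if w.1.1 == w'.1.1 then 1 else M).
    rewrite (eq_bigr (fun=> (if w.1.1 == w'.1.1 then 1 else M) * (tau * conf w w'))).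
      by rewrite sumr_const -mulr_natl /M; ring.
    move=> z _; rewrite sumr_const -mulr_natl; congr (_ * _); rewrite /compatible.
    case: eqP => _ /=; last by congr _%:R; apply: eq_card.
    rewrite -[RHS](mulr1n 1); congr _%:R; rewrite -(card1 z); apply: eq_card => z'.
    by rewrite !inE eq_sym.
  move: ww'; rewrite /w /S /conf /confusion; case: w' => -[[[a' b1'] b2'] c1'] c2' /=.
  rewrite !xpair_eqE /n /e /o (eq_sym a') (eq_sym b1') (eq_sym b2') (eq_sym c1') (eq_sym c2') !eqxx.
  case: (wa =P a') => _; case: (wb1 =P b1') => _; case: (wb2 =P b2') => _;
   case: (wc1 =P c1') => _; case: (wc2 =P c2') => _ //= _;
   rewrite !(mulr1, mul1r, mulr0, mul0r, addr0, add0r) //.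
all: try (rewrite le_eqVlt; apply/orP; left; apply/eqP; ring).
apply: (@le_trans _ _ (\sum_w' S w')).
  by rewrite [leRHS](bigID (fun w' => w' != w))/= lerDl sumr_ge0.
rewrite /S -mulr_sumr !big_split/= -mulr_sumr !big_split/= -!mulr_suml !sum_msg.
rewrite /n /e /o !sum_eq !sum_neq !sum_refl /confusion_count.
rewrite le_eqVlt; apply/orP; left; apply/eqP; rewrite -/a -/b1 -/b2 -/c1 -/c2. ring.
Qed.

End Confusion.

Lemma ex_le_scale (R : realType) O (E : expect R O) (c : \bar R) (F G : O -> \bar R) :
  (0 <= c)%E -> (forall o, 0 <= F o)%E -> (forall o, 0 <= G o)%E ->
  (forall o, F o <= c * G o)%E -> (E F <= c * E G)%E.
Proof. by move=> c0 F0 G0 FG; rewrite -exZ//; apply: ex_le. Qed.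

(** * Typical triples and covering *)

Section Typicality.
Context (R : realType) (U V1 V2 X1 X2 Y : choiceType).
Variables (pU : massfn R U) (p1 : U -> massfn R V1) (p2 : U -> massfn R V2).
Variables (q1 : U -> V1 -> massfn R X1) (q2 : U -> V2 -> massfn R X2).
Variable W : X1 -> X2 -> massfn R Y.
Variable lr : U -> V1 -> V2 -> R.
Hypothesis lr_ge0 : forall u v1 v2, 0 <= lr u v1 v2.
Local Open Scope ereal_scope.
Let elr u v1 v2 : \bar R := (lr u v1 v2)%:E.
Let elr0 u v1 v2 : 0 <= elr u v1 v2. Proof. by rewrite lee_fin. Qed.
Hint Resolve elr0 ind_ge0 : core.
Hypothesis lr1 : forall u v2, EE (p1 u) (fun v1 => elr u v1 v2) <= 1.
Hypothesis lr2 : forall u v1, EE (p2 u) (fun v2 => elr u v1 v2) <= 1.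
Hypothesis lr12 : EE pU (fun u => EE (p1 u) (fun v1 => EE (p2 u) (elr u v1))) = 1.

(** Change of measure: v1 and v2 are drawn as in the codebook, independently given u, and [lr]
    restores their joint law. *)
Definition joint (F : U -> V1 -> V2 -> X1 -> X2 -> Y -> \bar R) : \bar R :=
  EE pU (fun u => EE (p1 u) (fun v1 => EE (p2 u) (fun v2 => elr u v1 v2 *
    EE (q1 u v1) (fun x1 => EE (q2 u v2) (fun x2 => EE (W x1 x2) (F u v1 v2 x1 x2)))))).

Variables (lam Lam : R) (Dr : U -> V1 -> V2 -> X1 -> X2 -> Y -> bool).
Hypotheses (lam_gt0 : (0 < lam)%R) (Lam_ge1 : (1 <= Lam)%R).
Variables (d1 d2 miss : R).
Hypothesis miss_gt0 : (0 < miss)%R.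
Hypothesis lr_typ : joint (fun u v1 v2 _ _ _ => ind R (~~ (lam <= lr u v1 v2 <= Lam)%R)) <= d1%:E.
Hypothesis Dr_typ : joint (fun u v1 v2 x1 x2 y => ind R (~~ Dr u v1 v2 x1 x2 y)) <= d2%:E.

Definition bad u v1 v2 : \bar R :=
  EE (q1 u v1) (fun x1 => EE (q2 u v2) (fun x2 => EE (W x1 x2) (fun y =>
    ind R (~~ Dr u v1 v2 x1 x2 y)))).

Let bad0 u v1 v2 : 0 <= bad u v1 v2. Proof. by rewrite /bad; nneg. Qed.
Hint Resolve bad0 : core.

(** The second clause does the work of a Markov lemma: the facilitator accepts a triple only if the
    inputs and the output are then likely to pass the decoder's test. *)
Definition typ u v1 v2 : bool := (lam <= lr u v1 v2 <= Lam)%R && (bad u v1 v2 <= miss%:E).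
(** The decoder repeats the test [lam <= lr]. A competing triple with independently drawn v1 and v2
    passes it at the price of a factor [lam^-1], which offsets the sum over its indices. *)
Definition dect u v1 v2 x1 x2 y : bool := (lam <= lr u v1 v2)%R && Dr u v1 v2 x1 x2 y.

(** On [typ] the density is at least [lam], while its mean is 1. *)
Lemma typ_le : EE pU (fun u => EE (p1 u) (fun v1 => EE (p2 u) (fun v2 =>
  ind R (typ u v1 v2)))) <= (lam^-1)%:E.
Proof.
rewrite -[leRHS]mule1 -lr12.
have c0 : 0 <= (lam^-1)%:E by rewrite lee_fin invr_ge0 ltW.
apply: ex_le_scale => // [||u]; [by nneg..|].
apply: ex_le_scale => // [||v1]; [by nneg..|].
apply: ex_le_scale => // v2.
rewrite -EFinM lee_fin /typ ler_pdivlMl//.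
by have [/andP[/andP[]]|_] := boolP (_ && _); rewrite ?mulr1 ?mulr0.
Qed.

Lemma typ_miss u v1 v2 : typ u v1 v2 ->
  EE (q1 u v1) (fun x1 => EE (q2 u v2) (fun x2 => EE (W x1 x2) (fun y =>
    ind R (~~ dect u v1 v2 x1 x2 y)))) <= miss%:E.
Proof.
move=> /andP[/andP[h _] hb]; apply: le_trans hb; rewrite /bad /dect h /=.
exact: lexx.
Qed.

(** An atypical density costs [d1]; the failure of the second clause costs [d2 / miss], by Markov's
    inequality for [bad], whose mean under the true law is at most [d2]. *)
Lemma not_typ_le : EE pU (fun u => EE (p1 u) (fun v1 => EE (p2 u) (fun v2 =>
  elr u v1 v2 * ind R (~~ typ u v1 v2)))) <= (d1 + d2 / miss)%:E.
Proof.
pose i1 u v1 v2 := elr u v1 v2 * ind R (~~ (lam <= lr u v1 v2 <= Lam)%R).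
pose i2 u v1 v2 := (miss^-1)%:E * (elr u v1 v2 * bad u v1 v2).
have m0 : 0 <= (miss^-1)%:E by rewrite lee_fin invr_ge0 ltW.
have i10 u v1 v2 : 0 <= i1 u v1 v2 by rewrite mule_ge0.
have i20 u v1 v2 : 0 <= i2 u v1 v2 by rewrite !mule_ge0.
apply: (@le_trans _ _ (EE pU (fun u => EE (p1 u) (fun v1 => EE (p2 u) (fun v2 =>
   i1 u v1 v2 + i2 u v1 v2))))).
  apply: ex_le => u; first by nneg; rewrite mule_ge0.
  apply: ex_le => v1; first by nneg; rewrite mule_ge0.
  apply: ex_le => v2; first by rewrite mule_ge0.
  rewrite /i1 /i2 muleCA -ge0_muleDr; [|exact: ind_ge0|by rewrite mule_ge0].
  apply: lee_wpmul2l => //; rewrite /typ negb_and.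
  have [_|_] := boolP (lam <= _ <= _)%R; rewrite /= /ind.
    rewrite add0e -ltNge; have [h|h] := boolP (_ < _); last by rewrite mule_ge0.
    by rewrite -(@lee_pdivrMl _ _ _ _) ?invr_gt0// invrK mule1 ltW.
  by rewrite leeDl// mule_ge0.
rewrite EFinD; apply: (@le_trans _ _ (EE pU (fun u => EE (p1 u) (fun v1 => EE (p2 u) (i1 u v1)))
  + EE pU (fun u => EE (p1 u) (fun v1 => EE (p2 u) (i2 u v1))))).
  rewrite -exD; [|by nneg..].
  apply: ex_le => u; first by nneg; rewrite adde_ge0.
  rewrite -exD; [|by nneg..].
  apply: ex_le => v1; first by nneg; rewrite adde_ge0.
  by rewrite exD.
apply: leeD.
  apply: le_trans lr_typ; rewrite /joint.
  apply: ex_le => u; first by nneg.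
  apply: ex_le => v1; first by nneg.
  apply: ex_le => v2; first by nneg.
  apply: lee_wpmul2l => //.
  under eq_ex => x1 do under eq_ex => x2 do rewrite ex_cst//.
  by under eq_ex => x1 do rewrite ex_cst//; rewrite ex_cst.
rewrite mulrC EFinM; apply: le_trans (lee_wpmul2l m0 Dr_typ); rewrite /joint.
apply: ex_le_scale => // [||u]; [by nneg; rewrite ?mule_ge0//; nneg..|].
apply: ex_le_scale => // [||v1]; [by nneg; rewrite ?mule_ge0//; nneg..|].
by apply: ex_le_scale => // v2; rewrite mule_ge0//; nneg.
Qed.

Variables (A1 A2 B1 B2 C1 C2 Z1 Z2 : finType) (z0 : Z1 * Z2).
Let M : R := #|{: Z1 * Z2}|%:R.

Lemma M_gt0 : (0 < M)%R.
Proof. by rewrite ltr0n; apply/card_gt0P; exists z0. Qed.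

(** This is [mutual_covering] for the density cut down to [typ]. It is bounded by [Lam], and its
    mean falls short of 1 by the mass of the atypical triples, which the second moment method counts
    twice. *)
Lemma covered_le (w : msg A1 A2 B1 B2 C1 C2) :
  random_codebook pU p1 p2 q1 q2 A1 A2 B1 B2 C1 C2 Z1 Z2 (fun cb =>
   ind R (~~ covered typ (cu cb) (cv1 cb) (cv2 cb) w))
  <= ((Lam - 1) / M + 2 * (d1 + d2 / miss))%:E.
Proof.
pose h u v1 v2 : R := (lr u v1 v2 * (typ u v1 v2)%:R)%R.
have h0 u v1 v2 : (0 <= h u v1 v2)%R by rewrite mulr_ge0.
have hlr u v1 v2 : (h u v1 v2 <= lr u v1 v2)%R.
  by rewrite /h; case: typ; rewrite ?mulr1 ?mulr0.
have hL u v1 v2 : (h u v1 v2 <= Lam)%R.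
  rewrite /h /typ; case: andP => [[/andP[_ +] _]|_]; rewrite ?mulr1 ?mulr0//.
  by rewrite (le_trans ler01).
have h1 u v2 : EE (p1 u) (fun v1 => (h u v1 v2)%:E) <= 1.
  by apply: le_trans (lr1 u v2); apply: ex_le => v1; rewrite lee_fin.
have h2 u v1 : EE (p2 u) (fun v2 => (h u v1 v2)%:E) <= 1.
  by apply: le_trans (lr2 u v1); apply: ex_le => v2; rewrite lee_fin.
pose H u := EE (p1 u) (fun v1 => EE (p2 u) (fun v2 => (h u v1 v2)%:E)).
have H0 u : 0 <= H u by rewrite /H; nneg; rewrite lee_fin.
pose a := w.1.1.1.1.
set Ncov := random_codebook _ _ _ _ _ _ _ _ _ _ _ _ _ _.
have Ncov0 : 0 <= Ncov by rewrite /Ncov; nneg.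
have he0 u v1 v2 : 0 <= (h u v1 v2)%:E by rewrite lee_fin.
have ei0 u v1 v2 : 0 <= elr u v1 v2 * ind R (~~ typ u v1 v2).
  by rewrite mule_ge0//; exact: ind_ge0.
have mean : EE pU H + EE pU (fun u => EE (p1 u) (fun v1 => EE (p2 u) (fun v2 =>
    elr u v1 v2 * ind R (~~ typ u v1 v2)))) = 1.
  rewrite -lr12 -exD; [|by nneg..].
  apply: eq_ex => u; rewrite /H -exD; [|by nneg..].
  apply: eq_ex => v1; rewrite -exD; [|by nneg..].
  apply: eq_ex => v2; rewrite /h /elr /ind -EFinM -EFinD -mulrDr; congr (_%:E).
  by case: typ; rewrite /= ?addr0 ?add0r mulr1.
have key : Ncov + 2%:E * EE pU H <= ((Lam - 1) / M + 2)%:E.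
  pose E := rfun (fun _ : A1 * A2 => pU).
  pose G (u : A1 * A2 -> U) := rfun (fun i : A1 * A2 * B1 * Z1 => p1 (u i.1.1)) (fun v1 =>
     rfun (fun i : A1 * A2 * B2 * Z2 => p2 (u i.1.1)) (fun v2 =>
       ind R (~~ covered typ u v1 v2 w))).
  have G0 u : 0 <= G u by rewrite /G; nneg.
  have -> : Ncov = E G.
    rewrite /Ncov /random_codebook bindxE; apply: eq_ex => u.
    rewrite bindxE; apply: eq_ex => v1; rewrite bindxE; apply: eq_ex => v2.
    by rewrite bindxE /= ex_cst ?ex_cst.
  have -> : EE pU H = E (fun u => H (u a)) by rewrite /E (rfun1 _ a H).
  rewrite -exZ//.
  have t0 u : 0 <= 2%:E * H (u a) by rewrite mule_ge0 ?lee_fin.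
  rewrite -exD//; apply: ex_le_cst => [u|u|]; first by rewrite adde_ge0.
    apply: le_trans (mutual_covering (h0 (u a)) (hL (u a)) Lam_ge1 (h1 (u a)) (h2 (u a))
      (P1 := fun i : A1 * A2 * B1 * Z1 => p1 (u i.1.1))
      (P2 := fun i : A1 * A2 * B2 * Z2 => p2 (u i.1.1))
      (k1 := fun z => (a, w.1.1.1.2, z)) (k2 := fun z => (a, w.1.1.2, z)) _ _ _ _ M_gt0) => //.
    - apply: leeD => //; apply: ex_le => v1; first by nneg.
      apply: ex_le => v2; first by nneg.
      rewrite lee_fin indicE ler_nat.
      have [//|nc] := boolP (covered _ _ _ _ _).
      rewrite mem_set//= => -[z1 z2] /=; rewrite /h.
      move/existsPn: nc => /(_ (z1, z2)); rewrite /Tat /= => /negbTE ->.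
      by rewrite mulr0.
    - by move=> z z' [].
    - by move=> z z' [].
  by rewrite lee_fin addr_ge0// divr_ge0 ?subr_ge0// ltW// M_gt0.
(* Adding twice the atypical mass on both sides completes the mean of the density to 1 and avoids a
   subtraction of extended reals. *)
have h2N := lee_wpmul2l (ltW (ltr0Sn R 1 : 0 < 2%:E)) not_typ_le.
have := leeD key h2N; rewrite -addeA -ge0_muleDr//; [|by nneg..].
rewrite mean mule1 -EFinM -EFinD.
have -> : ((Lam - 1) / M + 2 + 2 * (d1 + d2 / miss) =
  (Lam - 1) / M + 2 * (d1 + d2 / miss) + 2)%R by ring.
by rewrite [in X in _ <= X -> _]EFinD leeD2rE.
Qed.

End Typicality.

(* One constructor per inequality of the rate region, i.e. per pattern of wrong
   message parts: common part; both [b_i]; [b_1] with or without [c_2]; [b_2]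
   with or without [c_1]; both [c_i]; [c_1]; [c_2]. *)
Inductive kind := K0 | K12 | K1c | K1o | K2c | K2o | Kcc | Kc1 | Kc2.

Definition kinds := [:: K0; K12; K1c; K1o; K2c; K2o; Kcc; Kc1; Kc2].

(** * One-shot error bound from likelihood ratios *)

Section OneShot.
Context (R : realType) (U V1 V2 X1 X2 Y : choiceType).
Variables (pU : massfn R U) (p1 : U -> massfn R V1) (p2 : U -> massfn R V2).
Variables (q1 : U -> V1 -> massfn R X1) (q2 : U -> V2 -> massfn R X2).
Variable W : X1 -> X2 -> massfn R Y.
Variable lr : U -> V1 -> V2 -> R.
Local Open Scope ereal_scope.

(* [r] is a likelihood ratio of the fresh letters against [y] given the shared
   ones: its mean over fresh letters is at most one. *)
Definition ratio_ok (k : kind) (r : U -> V1 -> V2 -> X1 -> X2 -> Y -> R) : Prop :=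
  match k with
  | K0 => forall y, EE pU (fun u => EE (p1 u) (fun v1 => EE (p2 u) (fun v2 =>
      EE (q1 u v1) (fun x1 => EE (q2 u v2) (fun x2 =>
        (lr u v1 v2 * r u v1 v2 x1 x2 y)%:E))))) <= 1
  | K12 => forall u y, EE (p1 u) (fun v1 => EE (p2 u) (fun v2 =>
      EE (q1 u v1) (fun x1 => EE (q2 u v2) (fun x2 =>
        (lr u v1 v2 * r u v1 v2 x1 x2 y)%:E)))) <= 1
  | K1c => forall u v2 y, EE (p1 u) (fun v1 => EE (q1 u v1) (fun x1 =>
      EE (q2 u v2) (fun x2 => (lr u v1 v2 * r u v1 v2 x1 x2 y)%:E))) <= 1
  | K1o => forall u v2 x2 y, EE (p1 u) (fun v1 => EE (q1 u v1) (fun x1 =>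
      (lr u v1 v2 * r u v1 v2 x1 x2 y)%:E)) <= 1
  | K2c => forall u v1 y, EE (p2 u) (fun v2 => EE (q1 u v1) (fun x1 =>
      EE (q2 u v2) (fun x2 => (lr u v1 v2 * r u v1 v2 x1 x2 y)%:E))) <= 1
  | K2o => forall u v1 x1 y, EE (p2 u) (fun v2 => EE (q2 u v2) (fun x2 =>
      (lr u v1 v2 * r u v1 v2 x1 x2 y)%:E)) <= 1
  | Kcc => forall u v1 v2 y, EE (q1 u v1) (fun x1 => EE (q2 u v2) (fun x2 =>
      (r u v1 v2 x1 x2 y)%:E)) <= 1
  | Kc1 => forall u v1 v2 x2 y, EE (q1 u v1) (fun x1 => (r u v1 v2 x1 x2 y)%:E) <= 1
  | Kc2 => forall u v1 v2 x1 y, EE (q2 u v2) (fun x2 => (r u v1 v2 x1 x2 y)%:E) <= 1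
  end.

Hypothesis lr_ge0 : forall u v1 v2, (0 <= lr u v1 v2)%R.
Variables (r : kind -> U -> V1 -> V2 -> X1 -> X2 -> Y -> R) (lam Lam : R) (theta : kind -> R).
Hypothesis r_ge0 : forall k u v1 v2 x1 x2 y, (0 <= r k u v1 v2 x1 x2 y)%R.
Hypothesis r_ok : forall k, ratio_ok k (r k).
Hypotheses (lam_gt0 : (0 < lam)%R) (Lam_ge1 : (1 <= Lam)%R) (theta_gt0 : forall k, (0 < theta k)%R).

Definition above u v1 v2 x1 x2 y : bool :=
  `[< forall k, (theta k <= r k u v1 v2 x1 x2 y)%R >].

Let D := dect lr lam above.

Let D_le_c k u v1 v2 x1 x2 y :
  ind R (D u v1 v2 x1 x2 y) <= ((theta k)^-1)%:E * (r k u v1 v2 x1 x2 y)%:E.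
Proof.
rewrite -EFinM lee_fin ler_pdivlMl// /D /dect.
by have [/andP[_ /asboolP/(_ k)]|_] := boolP (_ && _); rewrite ?mulr1 ?mulr0.
Qed.

(** If some v_i is fresh, it is the product [lr * r] that has mean at most 1 over the fresh letters,
    so Markov's inequality is applied to it at the level [lam * theta k]. *)
Let D_le_b k u v1 v2 x1 x2 y :
  ind R (D u v1 v2 x1 x2 y) <=
  ((lam * theta k)^-1)%:E * (lr u v1 v2 * r k u v1 v2 x1 x2 y)%:E.
Proof.
rewrite -EFinM lee_fin ler_pdivlMl ?mulr_gt0// /D /dect.
have [/andP[hl /asboolP/(_ k) hr]|_] := boolP (_ && _); rewrite ?mulr1 ?mulr0 ?mulr_ge0//.
by rewrite ler_pM// ltW.
Qed.

Let cb k : R := ((lam * theta k)^-1)%R.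
Let cc k : R := ((theta k)^-1)%R.
Let cb0 k : (0 <= cb k)%R. Proof. by rewrite invr_ge0 mulr_ge0 ?ltW. Qed.
Let cc0 k : (0 <= cc k)%R. Proof. by rewrite invr_ge0 ltW. Qed.
Let lrr0 k u v1 v2 x1 x2 y : 0 <= (lr u v1 v2 * r k u v1 v2 x1 x2 y)%:E.
Proof. by rewrite lee_fin mulr_ge0. Qed.
Let re0 k u v1 v2 x1 x2 y : 0 <= (r k u v1 v2 x1 x2 y)%:E.
Proof. by rewrite lee_fin. Qed.
Let iD0 u v1 v2 x1 x2 y : 0 <= ind R (D u v1 v2 x1 x2 y).
Proof. exact: ind_ge0. Qed.

Variables (A1 A2 B1 B2 C1 C2 Z1 Z2 : finType).
Variables (w0 : msg A1 A2 B1 B2 C1 C2) (z0 : Z1 * Z2).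
Let M : R := #|{: Z1 * Z2}|%:R.
Hypothesis lr1 : forall u v2, EE (p1 u) (fun v1 => (lr u v1 v2)%:E) <= 1.
Hypothesis lr2 : forall u v1, EE (p2 u) (fun v2 => (lr u v1 v2)%:E) <= 1.
Hypothesis lr12 : EE pU (fun u => EE (p1 u) (fun v1 => EE (p2 u) (fun v2 => (lr u v1 v2)%:E))) = 1.
Variables (d1 d2 miss eta : R).
Hypothesis miss_gt0 : (0 < miss)%R.
Hypothesis lr_typ : joint pU p1 p2 q1 q2 W lr
  (fun u v1 v2 _ _ _ => ind R (~~ (lam <= lr u v1 v2 <= Lam)%R)) <= d1%:E.
Hypothesis r_typ : joint pU p1 p2 q1 q2 W lr
  (fun u v1 v2 x1 x2 y => ind R (~~ above u v1 v2 x1 x2 y)) <= d2%:E.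
Hypothesis eta_gt : ((Lam - 1) / M + 2 * (d1 + d2 / miss) + miss +
  confusion_count A1 A2 B1 B2 C1 C2 Z1 Z2 (cb K0) (cb K12) (cb K1c) (cb K1o) (cb K2c)
    (cb K2o) (cc Kcc) (cc Kc1) (cc Kc2) lam^-1 < eta)%R.

Lemma one_shot : exists c : codebook U V1 V2 X1 X2 A1 A2 B1 B2 C1 C2 Z1 Z2,
  \sum_w ((#|{: msg A1 A2 B1 B2 C1 C2}|%:R)^-1)%:E *
    err W D (typ q1 q2 W lr lam Lam above miss) w0 z0 c w < eta%:E.
Proof.
have c0 k : 0 <= (cb k)%:E by rewrite lee_fin.
have c0' k : 0 <= (cc k)%:E by rewrite lee_fin.
apply good_codebook with (pU := pU) (p1 := p1) (p2 := p2) (q1 := q1) (q2 := q2)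
  (b0 := cb K0) (b12 := cb K12) (b1c := cb K1c) (b1o := cb K1o) (b2c := cb K2c) (b2o := cb K2o)
  (bcc := cc Kcc) (bc1 := cc Kc1) (bc2 := cc Kc2) (tau := (lam^-1)%R) (miss := miss)
  (kappa := ((Lam - 1) / M + 2 * (d1 + d2 / miss))%R)
  (sigma := confusion_count A1 A2 B1 B2 C1 C2 Z1 Z2 (cb K0) (cb K12) (cb K1c) (cb K1o) (cb K2c)
    (cb K2o) (cc Kcc) (cc Kc1) (cc Kc2) lam^-1) => //.
- move=> y; rewrite -[leRHS]mule1; apply: le_trans (lee_wpmul2l (c0 K0) (@r_ok K0 y)).
  apply: ex_le_scale => // [||u]; [by nneg..|].
  apply: ex_le_scale => // [||v1]; [by nneg..|].
  apply: ex_le_scale => // [||v2]; [by nneg..|].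
  apply: ex_le_scale => // [||x1]; [by nneg..|].
  apply: ex_le_scale => // x2; exact: D_le_b.
- move=> u y; rewrite -[leRHS]mule1; apply: le_trans (lee_wpmul2l (c0 K12) (@r_ok K12 u y)).
  apply: ex_le_scale => // [||v1]; [by nneg..|].
  apply: ex_le_scale => // [||v2]; [by nneg..|].
  apply: ex_le_scale => // [||x1]; [by nneg..|].
  apply: ex_le_scale => // x2; exact: D_le_b.
- move=> u v2 y; rewrite -[leRHS]mule1; apply: le_trans (lee_wpmul2l (c0 K1c) (@r_ok K1c u v2 y)).
  apply: ex_le_scale => // [||v1]; [by nneg..|].
  apply: ex_le_scale => // [||x1]; [by nneg..|].
  apply: ex_le_scale => // x2; exact: D_le_b.
- move=> u v2 x2 y; rewrite -[leRHS]mule1; apply: le_trans (lee_wpmul2l (c0 K1o) (@r_ok K1o u v2 x2 y)).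
  apply: ex_le_scale => // [||v1]; [by nneg..|].
  apply: ex_le_scale => // x1; exact: D_le_b.
- move=> u v1 y; rewrite -[leRHS]mule1; apply: le_trans (lee_wpmul2l (c0 K2c) (@r_ok K2c u v1 y)).
  apply: ex_le_scale => // [||v2]; [by nneg..|].
  apply: ex_le_scale => // [||x1]; [by nneg..|].
  apply: ex_le_scale => // x2; exact: D_le_b.
- move=> u v1 x1 y; rewrite -[leRHS]mule1; apply: le_trans (lee_wpmul2l (c0 K2o) (@r_ok K2o u v1 x1 y)).
  apply: ex_le_scale => // [||v2]; [by nneg..|].
  apply: ex_le_scale => // x2; exact: D_le_b.
- move=> u v1 v2 y; rewrite -[leRHS]mule1; apply: le_trans (lee_wpmul2l (c0' Kcc) (@r_ok Kcc u v1 v2 y)).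
  apply: ex_le_scale => // [||x1]; [by nneg..|].
  apply: ex_le_scale => // x2; exact: D_le_c.
- move=> u v1 v2 x2 y; rewrite -[leRHS]mule1; apply: le_trans (lee_wpmul2l (c0' Kc1) (@r_ok Kc1 u v1 v2 x2 y)).
  apply: ex_le_scale => // x1; exact: D_le_c.
- move=> u v1 v2 x1 y; rewrite -[leRHS]mule1; apply: le_trans (lee_wpmul2l (c0' Kc2) (@r_ok Kc2 u v1 v2 x1 y)).
  apply: ex_le_scale => // x2; exact: D_le_c.
- exact: ltW.
- exact: typ_le.
- by move=> u v1 v2; exact: typ_miss.
- by move=> w; exact: covered_le.
- by move=> w; apply: confusion_sum_le => //; rewrite invr_ge0 ltW.
Qed.

End OneShot.

(** * Blocks and the law of large numbers *)

Section Indep.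
Context (R : realType).
Local Open Scope ereal_scope.

Definition pairx O O' (E : expect R O) (K : O -> expect R O') : expect R (O * O') :=
  bindx E (fun o => bindx (K o) (fun o' => retx R (o, o'))).

Program Definition tilt O (E : expect R O) (w : O -> \bar R)
    (w0 : forall o, 0 <= w o) (w1 : E w = 1) : expect R O :=
  @Expect R O (fun F => E (fun o => w o * F o)) _ _ _ _.
Next Obligation. by move=> O E w w0 w1 c c0 /=; rewrite exZr// w1 mul1e. Qed.
Next Obligation.
move=> O E w w0 w1 F G F0 FG /=; apply: ex_le => o; first by rewrite mule_ge0.
by rewrite lee_wpmul2l.
Qed.
Next Obligation.
move=> O E w w0 w1 c F c0 F0 /=; rewrite -exZ//; last by move=> o; rewrite mule_ge0.
by apply: eq_ex => o; rewrite muleCA.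
Qed.
Next Obligation.
move=> O E w w0 w1 J F F0 /=; rewrite -ex_Sum; last by move=> *; rewrite mule_ge0.
by apply: eq_ex => o; rewrite SumZ.
Qed.

(* The coordinates [c _ i] are independent under [E], the [i]-th one with
   expectation [e i]. *)
Definition indep n O O1 (E : expect R O) (e : 'I_n -> expect R O1) (c : O -> 'I_n -> O1) :=
  forall g : 'I_n -> O1 -> \bar R, (forall i o, 0 <= g i o) ->
  E (fun o => \eprod_(i < n) g i (c o i)) = \eprod_(i < n) e i (g i).

Lemma indep_prod_mass (T : choiceType) n (p : 'I_n -> massfn R T) :
  indep (EE (prod_mass p)) (fun i => EE (p i)) (fun x i => tnth x i).
Proof. by move=> g g0; rewrite ex_prod. Qed.

(** A kernel that acts on the i-th coordinate through [c o i] alone preserves independence: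
    integrating it out leaves a product of functions of the single coordinates. *)
Lemma indep_pairx n O O' O1 O1' (E : expect R O) (e : 'I_n -> expect R O1) c
    (K : O -> expect R O') (k : 'I_n -> O1 -> expect R O1') c' :
  indep E e c -> (forall o, indep (K o) (fun i => k i (c o i)) c') ->
  indep (pairx E K) (fun i => pairx (e i) (k i)) (fun p i => (c p.1 i, c' p.2 i)).
Proof.
move=> hE hK g g0; rewrite /pairx bindxE.
transitivity (E (fun o => \eprod_(i < n) k i (c o i) (fun o' => g i (c o i, o')))).
  by apply: eq_ex => o; rewrite bindxE /= (hK o (fun i o' => g i (c o i, o'))).
rewrite (hE (fun i o => k i o (fun o' => g i (o, o'))))//.
by move=> i o; apply: ex_ge0.
Qed.

Lemma indep_pair_mass n O O1 (T : choiceType) (E : expect R O) (e : 'I_n -> expect R O1) c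
    (k : 'I_n -> O1 -> massfn R T) : indep E e c ->
  indep (pairx E (fun o => EE (prod_mass (fun i => k i (c o i)))))
    (fun i => pairx (e i) (fun o => EE (k i o))) (fun p i => (c p.1 i, tnth p.2 i)).
Proof. by move=> hE; apply: indep_pairx => // o; exact: indep_prod_mass. Qed.

Lemma indep_tilt n O O1 (E : expect R O) (e : 'I_n -> expect R O1) c
    (w : O -> \bar R) w0 w1 (w' : 'I_n -> O1 -> \bar R) w0' w1' :
  (forall o, w o = \eprod_(i < n) w' i (c o i)) -> indep E e c ->
  indep (@tilt O E w w0 w1) (fun i => @tilt O1 (e i) (w' i) (w0' i) (w1' i)) c.
Proof.
move=> hw hE g g0 /=.
rewrite -(hE (fun i o => w' i o * g i o)); last by move=> i o; rewrite mule_ge0.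
by apply: eq_ex => o; rewrite hw -big_split.
Qed.

Lemma indep_le1 n O O1 (E : expect R O) (e : 'I_n -> expect R O1) c
    (g : 'I_n -> O1 -> \bar R) (F : O -> \bar R) :
  indep E e c -> (forall i o, 0 <= g i o) -> (forall i, e i (g i) <= 1) ->
  (forall o, F o = \eprod_(i < n) g i (c o i)) -> E F <= 1.
Proof.
move=> hE g0 e1 hF; rewrite (_ : F = fun o => \eprod_(i < n) g i (c o i)); last exact/funext.
by rewrite hE//; apply: eprod_le1 => i; rewrite ex_ge0/=.
Qed.

End Indep.

Section Blocks.
Context (R : realType) (U V1 V2 X1 X2 Y : choiceType) (n : nat).
Variables (pU : massfn R U) (p1 : U -> massfn R V1) (p2 : U -> massfn R V2).
Variables (q1 : U -> V1 -> massfn R X1) (q2 : U -> V2 -> massfn R X2).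
Variable W : X1 -> X2 -> massfn R Y.
Variable lr : 'I_n -> U -> V1 -> V2 -> R.
Hypothesis lr_ge0 : forall i u v1 v2, 0 <= lr i u v1 v2.
Local Open Scope ereal_scope.

Definition nU : massfn R (n.-tuple U) := prod_mass (fun _ : 'I_n => pU).
Definition n1 (u : n.-tuple U) : massfn R (n.-tuple V1) := prod_mass (fun i => p1 (tnth u i)).
Definition n2 (u : n.-tuple U) : massfn R (n.-tuple V2) := prod_mass (fun i => p2 (tnth u i)).
Definition nq1 (u : n.-tuple U) (v1 : n.-tuple V1) : massfn R (n.-tuple X1) :=
  prod_mass (fun i => q1 (tnth u i) (tnth v1 i)).
Definition nq2 (u : n.-tuple U) (v2 : n.-tuple V2) : massfn R (n.-tuple X2) :=
  prod_mass (fun i => q2 (tnth u i) (tnth v2 i)).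
Definition nW (x1 : n.-tuple X1) (x2 : n.-tuple X2) : massfn R (n.-tuple Y) :=
  prod_mass (fun i => W (tnth x1 i) (tnth x2 i)).
Definition nlr (u : n.-tuple U) (v1 : n.-tuple V1) (v2 : n.-tuple V2) : R :=
  (\prod_(i < n) lr i (tnth u i) (tnth v1 i) (tnth v2 i))%R.
Definition nratio (r : 'I_n -> U -> V1 -> V2 -> X1 -> X2 -> Y -> R)
    (u : n.-tuple U) (v1 : n.-tuple V1) (v2 : n.-tuple V2) (x1 : n.-tuple X1)
    (x2 : n.-tuple X2) (y : n.-tuple Y) : R :=
  (\prod_(i < n) r i (tnth u i) (tnth v1 i) (tnth v2 i) (tnth x1 i) (tnth x2 i) (tnth y i))%R.

Lemma nlr_ge0 u v1 v2 : (0 <= nlr u v1 v2)%R.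
Proof. exact: prodr_ge0. Qed.

Lemma nlr1 : (forall i u v2, EE (p1 u) (fun v1 => (lr i u v1 v2)%:E) <= 1) ->
  forall u v2, EE (n1 u) (fun v1 => (nlr u v1 v2)%:E) <= 1.
Proof.
move=> h u v2; apply: (indep_le1 (indep_prod_mass _)
  (g := fun i v1 => (lr i (tnth u i) v1 (tnth v2 i))%:E)) => // [*|v1]; first by rewrite lee_fin.
exact: EFin_prod.
Qed.

Lemma nlr2 : (forall i u v1, EE (p2 u) (fun v2 => (lr i u v1 v2)%:E) <= 1) ->
  forall u v1, EE (n2 u) (fun v2 => (nlr u v1 v2)%:E) <= 1.
Proof.
move=> h u v1; apply: (indep_le1 (indep_prod_mass _)
  (g := fun i v2 => (lr i (tnth u i) (tnth v1 i) v2)%:E)) => // [*|v2]; first by rewrite lee_fin.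
exact: EFin_prod.
Qed.

Definition aux1 : expect R (U * V1 * V2) :=
  pairx (pairx (EE pU) (fun u => EE (p1 u))) (fun o => EE (p2 o.1)).
Definition auxn : expect R (n.-tuple U * n.-tuple V1 * n.-tuple V2) :=
  pairx (pairx (EE nU) (fun u => EE (n1 u))) (fun o => EE (n2 o.1)).
Definition coord3 (o : n.-tuple U * n.-tuple V1 * n.-tuple V2) i : U * V1 * V2 :=
  (tnth o.1.1 i, tnth o.1.2 i, tnth o.2 i).

Lemma indep_aux : indep auxn (fun=> aux1) coord3.
Proof.
exact: (indep_pair_mass (fun _ o => p2 o.1)
  (indep_pair_mass (fun _ => p1) (indep_prod_mass (fun=> pU)))).
Qed.

Definition elr i (o : U * V1 * V2) : \bar R := (lr i o.1.1 o.1.2 o.2)%:E.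
Lemma elr_ge0 i o : 0 <= elr i o. Proof. by rewrite lee_fin. Qed.
Hypothesis lr12 : forall i, aux1 (elr i) = 1.

Definition enlr (o : n.-tuple U * n.-tuple V1 * n.-tuple V2) : \bar R := (nlr o.1.1 o.1.2 o.2)%:E.
Lemma enlr_ge0 o : 0 <= enlr o. Proof. by rewrite lee_fin nlr_ge0. Qed.

Lemma enlrE o : enlr o = \eprod_(i < n) elr i (coord3 o i).
Proof. exact: EFin_prod. Qed.

Lemma enlr1 : auxn enlr = 1.
Proof.
rewrite (_ : enlr = fun o => \eprod_(i < n) elr i (coord3 o i)); last exact/funext/enlrE.
by rewrite (indep_aux (elr_ge0))// big1.
Qed.

Definition joint1 i : expect R (U * V1 * V2 * X1 * X2 * Y) :=
  pairx (pairx (pairx (tilt (elr_ge0 i) (lr12 i)) (fun o => EE (q1 o.1.1 o.1.2)))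
    (fun o => EE (q2 o.1.1.1 o.1.2))) (fun o => EE (W o.1.2 o.2)).
Definition jointn : expect R (n.-tuple U * n.-tuple V1 * n.-tuple V2 *
    n.-tuple X1 * n.-tuple X2 * n.-tuple Y) :=
  pairx (pairx (pairx (tilt enlr_ge0 enlr1) (fun o => EE (nq1 o.1.1 o.1.2)))
    (fun o => EE (nq2 o.1.1.1 o.1.2))) (fun o => EE (nW o.1.2 o.2)).

Lemma indep_joint : indep jointn joint1
  (fun o i => (coord3 o.1.1.1 i, tnth o.1.1.2 i, tnth o.1.2 i, tnth o.2 i)).
Proof.
have h : indep (tilt enlr_ge0 enlr1) (fun i => tilt (elr_ge0 i) (lr12 i)) coord3.
  by apply: indep_tilt; [exact: enlrE|exact: indep_aux].
exact: (indep_pair_mass (fun _ o => W o.1.2 o.2)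
  (indep_pair_mass (fun _ o => q2 o.1.1.1 o.1.2)
  (indep_pair_mass (fun _ o => q1 o.1.1 o.1.2) h))).
Qed.

Lemma jointnE F : joint nU n1 n2 nq1 nq2 nW nlr F =
  jointn (fun o => F o.1.1.1.1.1 o.1.1.1.1.2 o.1.1.1.2 o.1.1.2 o.1.2 o.2).
Proof. by []. Qed.

(** The fresh letters of a block are independent across coordinates and the block ratio is a
    product, so its mean is a product of means at most 1. Each kind has its own chain of fresh
    letters; the shared ones are parameters. *)
Lemma nratio_ok k (r : 'I_n -> U -> V1 -> V2 -> X1 -> X2 -> Y -> R) :
  (forall i u v1 v2 x1 x2 y, (0 <= r i u v1 v2 x1 x2 y)%R) ->
  (forall i, ratio_ok pU p1 p2 q1 q2 (lr i) k (r i)) ->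
  ratio_ok nU n1 n2 nq1 nq2 nlr k (nratio r).
Proof.
move=> r0.
have F0 i u v1 v2 x1 x2 y : 0 <= (lr i u v1 v2 * r i u v1 v2 x1 x2 y)%:E.
  by rewrite lee_fin mulr_ge0.
have r0' i u v1 v2 x1 x2 y : 0 <= (r i u v1 v2 x1 x2 y)%:E by rewrite lee_fin.
have FE u v1 v2 x1 x2 y : (nlr u v1 v2 * nratio r u v1 v2 x1 x2 y)%:E = \eprod_(i < n)
  (lr i (tnth u i) (tnth v1 i) (tnth v2 i) * r i (tnth u i) (tnth v1 i) (tnth v2 i)
    (tnth x1 i) (tnth x2 i) (tnth y i))%:E by rewrite /nlr /nratio -big_split EFin_prod.
case: k => h.
- move=> y.
  apply: (indep_le1 (indep_pair_mass (fun _ o => q2 o.1.1.1 o.1.2)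
    (indep_pair_mass (fun _ o => q1 o.1.1 o.1.2) indep_aux))
    (g := fun i o => (lr i o.1.1.1.1 o.1.1.1.2 o.1.1.2 * r i o.1.1.1.1 o.1.1.1.2 o.1.1.2 o.1.2 o.2 (tnth y i))%:E)
    (F := fun o => (nlr o.1.1.1.1 o.1.1.1.2 o.1.1.2 * nratio r o.1.1.1.1 o.1.1.1.2 o.1.1.2 o.1.2 o.2 y)%:E)) => [i o|i|o].
  + exact: F0.
  + exact: h.
  + exact: FE.
- move=> u y.
  apply: (indep_le1 (indep_pair_mass (fun i o => q2 (tnth u i) o.1.2)
    (indep_pair_mass (fun i o => q1 (tnth u i) o.1)
    (indep_pair_mass (fun i _ => p2 (tnth u i)) (indep_prod_mass (fun i => p1 (tnth u i))))))
    (g := fun i o => (lr i (tnth u i) o.1.1.1 o.1.1.2 * r i (tnth u i) o.1.1.1 o.1.1.2 o.1.2 o.2 (tnth y i))%:E)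
    (F := fun o => (nlr u o.1.1.1 o.1.1.2 * nratio r u o.1.1.1 o.1.1.2 o.1.2 o.2 y)%:E)) => [i o|i|o].
  + exact: F0.
  + exact: h.
  + exact: FE.
- move=> u v2 y.
  apply: (indep_le1 (indep_pair_mass (fun i _ => q2 (tnth u i) (tnth v2 i))
    (indep_pair_mass (fun i o => q1 (tnth u i) o) (indep_prod_mass (fun i => p1 (tnth u i)))))
    (g := fun i o => (lr i (tnth u i) o.1.1 (tnth v2 i) * r i (tnth u i) o.1.1 (tnth v2 i) o.1.2 o.2 (tnth y i))%:E)
    (F := fun o => (nlr u o.1.1 v2 * nratio r u o.1.1 v2 o.1.2 o.2 y)%:E)) => [i o|i|o].
  + exact: F0.
  + exact: h.
  + exact: FE.
- move=> u v2 x2 y.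
  apply: (indep_le1 (indep_pair_mass (fun i o => q1 (tnth u i) o)
    (indep_prod_mass (fun i => p1 (tnth u i))))
    (g := fun i o => (lr i (tnth u i) o.1 (tnth v2 i) * r i (tnth u i) o.1 (tnth v2 i) o.2 (tnth x2 i) (tnth y i))%:E)
    (F := fun o => (nlr u o.1 v2 * nratio r u o.1 v2 o.2 x2 y)%:E)) => [i o|i|o].
  + exact: F0.
  + exact: h.
  + exact: FE.
- move=> u v1 y.
  apply: (indep_le1 (indep_pair_mass (fun i o => q2 (tnth u i) o.1)
    (indep_pair_mass (fun i _ => q1 (tnth u i) (tnth v1 i)) (indep_prod_mass (fun i => p2 (tnth u i)))))
    (g := fun i o => (lr i (tnth u i) (tnth v1 i) o.1.1 * r i (tnth u i) (tnth v1 i) o.1.1 o.1.2 o.2 (tnth y i))%:E)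
    (F := fun o => (nlr u v1 o.1.1 * nratio r u v1 o.1.1 o.1.2 o.2 y)%:E)) => [i o|i|o].
  + exact: F0.
  + exact: h.
  + exact: FE.
- move=> u v1 x1 y.
  apply: (indep_le1 (indep_pair_mass (fun i o => q2 (tnth u i) o)
    (indep_prod_mass (fun i => p2 (tnth u i))))
    (g := fun i o => (lr i (tnth u i) (tnth v1 i) o.1 * r i (tnth u i) (tnth v1 i) o.1 (tnth x1 i) o.2 (tnth y i))%:E)
    (F := fun o => (nlr u v1 o.1 * nratio r u v1 o.1 x1 o.2 y)%:E)) => [i o|i|o].
  + exact: F0.
  + exact: h.
  + exact: FE.
- move=> u v1 v2 y.
  apply: (indep_le1 (indep_pair_mass (fun i _ => q2 (tnth u i) (tnth v2 i))
    (indep_prod_mass (fun i => q1 (tnth u i) (tnth v1 i))))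
    (g := fun i o => (r i (tnth u i) (tnth v1 i) (tnth v2 i) o.1 o.2 (tnth y i))%:E)
    (F := fun o => (nratio r u v1 v2 o.1 o.2 y)%:E)) => [i o|i|o].
  + exact: r0'.
  + exact: h.
  + exact: EFin_prod.
- move=> u v1 v2 x2 y.
  apply: (indep_le1 (indep_prod_mass (fun i => q1 (tnth u i) (tnth v1 i)))
    (g := fun i o => (r i (tnth u i) (tnth v1 i) (tnth v2 i) o (tnth x2 i) (tnth y i))%:E)
    (F := fun o => (nratio r u v1 v2 o x2 y)%:E)) => [i o|i|o].
  + exact: r0'.
  + exact: h.
  + exact: EFin_prod.
- move=> u v1 v2 x1 y.
  apply: (indep_le1 (indep_prod_mass (fun i => q2 (tnth u i) (tnth v2 i)))
    (g := fun i o => (r i (tnth u i) (tnth v1 i) (tnth v2 i) (tnth x1 i) o (tnth y i))%:E)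
    (F := fun o => (nratio r u v1 v2 x1 o y)%:E)) => [i o|i|o].
  + exact: r0'.
  + exact: h.
  + exact: EFin_prod.
Qed.

End Blocks.

(** * One-sided law of large numbers by truncation *)

Section LLN.
Context (R : realType) (T : choiceType) (P : massfn R T).

(** [1 - x <= expR (- x)] gives [expR x <= (1 - x)^-1], and (1 + x + 2 x^2) (1 - x) = 1 + x^2 (1 - 2
    x) is at least 1. *)
Lemma expR_le_quad (x : R) : x <= 2^-1 -> expR x <= 1 + x + 2 * x ^+ 2.
Proof.
move=> x2; have h : 0 < 1 - x by lra.
have := expR_ge1Dx (- x); rewrite expRN => h2.
have h3 : 1 - x <= (expR x)^-1 by lra.
have e0 := expR_gt0 x.
rewrite -[leLHS]invrK -[leRHS]invrK lef_pV2 ?posrE ?invr_gt0//; last nra.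
apply: le_trans h3.
have q0 : 0 < 1 + x + 2 * x ^+ 2 by nra.
rewrite -[leLHS]mul1r ler_pdivrMr//; nra.
Qed.

Local Open Scope ereal_scope.

Lemma indep_one n O (E : expect R O) (e : 'I_n -> expect R T) c i (G : T -> \bar R) :
  indep E e c -> (forall t, 0 <= G t) -> E (fun o => G (c o i)) = e i G.
Proof.
move=> hE G0.
pose g j := if j == i then G else (fun=> 1).
transitivity (E (fun o => \eprod_(j < n) g j (c o j))).
  apply: eq_ex => o; rewrite (bigD1 i)//= big1 ?mule1 => [|j /negbTE ji].
    by rewrite /g eqxx.
  by rewrite /g ji.
rewrite hE; last by move=> j t; rewrite /g; case: ifP.
rewrite (bigD1 i)//= big1 ?mule1 => [|j /negbTE ji]; first by rewrite /g eqxx.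
by rewrite /g ji ex_cst.
Qed.

Definition like n m (e : 'I_n -> expect R T) : Prop :=
  forall i : 'I_n, (i < m)%N -> forall G, (forall t, 0 <= G t) -> e i G = EE P G.

Lemma indep_pow n m O (E : expect R O) (e : 'I_n -> expect R T) c (G : T -> R) (rho : R) :
  (m <= n)%N -> indep E e c -> like m e -> (forall t, (0 <= G t)%R) ->
  EE P (fun t => (G t)%:E) <= rho%:E ->
  E (fun o => (\prod_(i < n | (i < m)%N) G (c o i))%:E) <= (rho ^+ m)%:E.
Proof.
move=> mn hE he G0 hr.
have Ge0 t : 0 <= (G t)%:E by rewrite lee_fin.
pose g (i : 'I_n) t := (if (i < m)%N then G t else 1%R)%:E.
rewrite [leLHS](_ : _ = E (fun o => \eprod_(i < n) g i (c o i))); last first.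
  by apply: eq_ex => o; rewrite big_mkcond/= EFin_prod.
rewrite hE; last by move=> i t; rewrite /g; case: ifP.
have rE : EE P (fun t => (G t)%:E) = (fine (EE P (fun t => (G t)%:E)))%:E.
  rewrite fineK// ge0_fin_numE; first by rewrite (le_lt_trans hr) ?ltry.
  exact: ex_ge0.
rewrite (eq_bigr (fun i : 'I_n => (if (i < m)%N then fine (EE P (fun t => (G t)%:E)) else 1%R)%:E)).
  rewrite -EFin_prod -big_mkcond/= -(big_ord_widen _ (fun=> fine _))// prodr_const card_ord.
  rewrite lee_fin lerXn2r// ?nnegrE.
  - by rewrite fine_ge0// ex_ge0.
  - by rewrite -lee_fin; apply: le_trans hr; apply: ex_ge0.
  - by rewrite -lee_fin -rE.
move=> i _; rewrite /g; case: ifP => im; last by rewrite ex_cst.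
by rewrite (he i im) -?rE.
Qed.

(* [h] is the truncation of [f] to a finite set, [d] what it loses. *)
Lemma LLN_trunc (f h d : T -> R) (K gam del eta a b : R) :
  (0 < del)%R -> (1 <= K)%R -> (del <= K)%R ->
  (forall t, (0 <= d t)%R) -> (forall t, (h t - d t <= f t)%R) ->
  (forall t, (`|h t - (gam + del)| <= K)%R) -> (`|gam + del| <= K)%R ->
  EE P (fun t => (Num.max (h t) 0)%:E) = a%:E ->
  EE P (fun t => (Num.max (- h t) 0)%:E) = b%:E ->
  (gam + 2 * del <= a - b)%R ->
  EE P (fun t => (d t)%:E) <= eta%:E ->
  exists2 rho : R, (0 <= rho < 1)%R &
  forall n m O (E : expect R O) (e : 'I_n -> expect R T) c,
    (0 < m)%N -> (m <= n)%N -> indep E e c -> like m e ->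
    E (fun o => ind R (\sum_(i < n | (i < m)%N) f (c o i) <= m%:R * gam)%R) <=
      (rho ^+ m + eta / del)%:E.
Proof.
move=> del0 K1 delK d0 hdf hK gK ha hb hab hd.
have K0 : (0 < K)%R by rewrite (lt_le_trans ltr01).
(* [s] minimises the Chernoff exponent [- s del + 2 s^2 K^2], which becomes [- s del / 2]. From
   [del <= K] follows [s K <= 1 / 4], within the range of [expR_le_quad]. *)
pose s : R := (del / (4 * K ^+ 2))%R.
have s0 : (0 < s)%R by rewrite divr_gt0// mulr_gt0// exprn_gt0.
have sK : (s * K <= 4^-1)%R.
  rewrite /s (_ : _ * K = del / K / 4)%R; last by field; rewrite gt_eqF.
  by rewrite ler_pdivrMr// mulVf ?pnatr_eq0// ler_pdivrMr// mul1r.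
have sd : (s * del / 2 = 2 * s ^+ 2 * K ^+ 2)%R by rewrite /s; field; rewrite gt_eqF.
pose G t := expR (- (s * (h t - (gam + del)))).
have G0 t : (0 <= G t)%R by exact: expR_ge0.
pose rho := (1 - s * del / 2)%R.
(* The positive and negative parts of [h] stand on opposite sides, so that no difference of
   expectations occurs after integration. *)
have Gle t : (G t + s * Num.max (h t) 0 <=
    1 + s * (gam + del) + 2 * s ^+ 2 * K ^+ 2 + s * Num.max (- h t) 0)%R.
  have hmax : (Num.max (h t) 0 - Num.max (- h t) 0 = h t)%R.
    by case: (lerP (h t) 0) => h1; case: (lerP (- h t) 0) => h2 //; lra.
  have hb' := hK t; rewrite ler_norml in hb'.
  have q : (- (s * (h t - (gam + del))) <= 2^-1)%R by nra.
  have := expR_le_quad q; rewrite -/(G t) => hq.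
  have : (2 * (- (s * (h t - (gam + del)))) ^+ 2 <= 2 * s ^+ 2 * K ^+ 2)%R.
    rewrite sqrrN exprMn -mulrA ler_pM2l// ler_pM2l ?exprn_gt0//.
    by rewrite -[leLHS]real_normK ?num_real// lerXn2r// nnegrE// ltW.
  by nra.
have rhoP : EE P (fun t => (G t)%:E) <= rho%:E.
  have C0 : (0 <= 1 + s * (gam + del) + 2 * s ^+ 2 * K ^+ 2)%R.
    by rewrite ler_norml in gK; nra.
  have m0 x : 0 <= (Num.max x 0 : R)%:E by rewrite lee_fin le_max lexx orbT.
  have se : 0 <= s%:E by rewrite lee_fin ltW.
  have ge t : 0 <= (G t)%:E by rewrite lee_fin.
  have : EE P (fun t => (G t)%:E + s%:E * (Num.max (h t) 0)%:E) <=
      EE P (fun t => (1 + s * (gam + del) + 2 * s ^+ 2 * K ^+ 2)%:E +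
        s%:E * (Num.max (- h t) 0)%:E).
    apply: ex_le => t; first by rewrite adde_ge0// mule_ge0.
    by rewrite -!EFinM -!EFinD lee_fin.
  rewrite exD => [||t]//; last by rewrite mule_ge0.
  rewrite exD => [|t|t]; [|by rewrite lee_fin|by rewrite mule_ge0].
  rewrite ex_cst ?lee_fin// !exZ// ha hb -!EFinM.
  set g := EE P _; have g0 : 0 <= g by exact: ex_ge0.
  case: g g0 => [g| |]//; rewrite -!EFinD !lee_fin => _ h1.
  by rewrite /rho; nra.
have rho01 : (0 <= rho < 1)%R.
  apply/andP; split; last by rewrite /rho gtrBl divr_gt0// mulr_gt0.
  by rewrite -lee_fin; apply: le_trans rhoP; apply: ex_ge0 => t; rewrite lee_fin.
exists rho => // n m O E e c m0 mn hE he.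
have mR : (0 < m%:R :> R)%R by rewrite ltr0n.
have cm0 : (0 <= (m%:R * del)^-1 :> R)%R by rewrite invr_ge0 ltW// mulr_gt0.
apply: (@le_trans _ _ (E (fun o => (\prod_(i < n | (i < m)%N) G (c o i))%:E +
    ((m%:R * del)^-1)%:E * \sum_(i < n | (i < m)%N) (d (c o i))%:E))).
  apply: ex_le => o; first exact: ind_ge0.
  have p0 : (0 <= \prod_(i < n | (i < m)%N) G (c o i))%R by apply: prodr_ge0.
  have q0 : (0 <= \sum_(i < n | (i < m)%N) d (c o i))%R by apply: sumr_ge0.
  rewrite sumEFin -EFinM -EFinD lee_fin.
  have [hf|_] := boolP (\sum_(i < n | (i < m)%N) f (c o i) <= _)%R; last by rewrite addr_ge0// mulr_ge0.
  have : (\sum_(i < n | (i < m)%N) (h (c o i) - d (c o i)) <= m%:R * gam)%R.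
    by apply: le_trans hf; apply: ler_sum.
  rewrite sumrB => hs.
  (* Either the truncated sum is small and the product of the [G] is at least 1, the Chernoff bound,
     or the truncation errors [d] add up to more than [m del], Markov's inequality. *)
  have [hh|hh] := lerP (\sum_(i < n | (i < m)%N) h (c o i)) (m%:R * (gam + del)).
    apply: ler_wpDr; first by rewrite mulr_ge0.
    rewrite /G -expR_sum -expR0 ler_expR sumrN oppr_ge0 -mulr_sumr.
    rewrite pmulr_rle0// sumrB subr_le0.
    by rewrite -(big_ord_widen n (fun=> (gam + del)%R))// sumr_const card_ord -mulr_natl.
  apply: ler_wpDl => //.
  by rewrite ler_pdivlMl ?mulr_gt0// mulr1; nra.
rewrite exD; [|by move=> o; rewrite lee_fin prodr_ge0|]; last first.
  by move=> o; rewrite mule_ge0 ?lee_fin// sume_ge0// => i _; rewrite lee_fin.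
rewrite EFinD; apply: leeD; first exact: (indep_pow mn hE he).
rewrite exZ ?lee_fin//; last by move=> o; rewrite sume_ge0// => i _; rewrite lee_fin.
rewrite ex_sum; last by move=> i o; rewrite lee_fin.
apply: (@le_trans _ _ (((m%:R * del)^-1)%:E * \sum_(i < n | (i < m)%N) eta%:E)).
  rewrite lee_wpmul2l ?lee_fin//; apply: lee_sum => i im.
  rewrite (indep_one i hE (G := fun t => (d t)%:E)) => [|t]; last by rewrite lee_fin.
  by rewrite (he i im) => [//|t]; rewrite lee_fin.
rewrite sumEFin -(big_ord_widen _ (fun=> eta))// sumr_const card_ord -EFinM lee_fin.
rewrite -mulr_natl le_eqVlt; apply/orP; left; apply/eqP.
by field; rewrite !gt_eqF.
Qed.

Lemma finite_bounded (A : set T) (f : T -> R) : finite_set A ->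
  exists2 K : R, (0 <= K)%R & forall t, A t -> (`|f t| <= K)%R.
Proof.
move=> fA; exists (\sum_(t <- finmap.enum_fset (fset_set A)) `|f t|)%R; first exact: sumr_ge0.
move=> t At; rewrite (big_rem t)/= ?lerDl ?sumr_ge0//.
by rewrite in_fset_set// inE.
Qed.

Lemma max0_mulr (x y : R) : (0 <= x)%R -> (Num.max (x * y) 0 = x * Num.max y 0)%R.
Proof.
move=> x0; have [y0|y0] := lerP y 0; last by rewrite max_l// mulr_ge0// ltW.
by rewrite max_r ?mulr0// mulr_ge0_le0.
Qed.

Lemma expr_small (rho eps : R) : (0 <= rho < 1)%R -> (0 < eps)%R ->
  exists M, forall m, (M <= m)%N -> (rho ^+ m <= eps)%R.
Proof.
move=> /andP[r0 r1] e0.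
have hr : (`|rho| < 1)%R by rewrite ger0_norm.
have /cvgrPdist_le /(_ _ e0) [M _ hM] := cvg_expr hr.
exists M => m Mm; have := hM m Mm; rewrite /= sub0r normrN ger0_norm//.
exact: exprn_ge0.
Qed.

(** A lower bound survives the truncation of the positive part, whose sum may be infinite. The
    negative part has a finite sum and can be cut at a small loss in the mean. An upper bound would
    not hold in this generality. *)
Lemma LLN_lower (f : T -> R) (gam eps : R) :
  gam%:E < signed_sum (fun t => P t * f t)%R -> (0 < eps)%R ->
  exists M, forall n m O (E : expect R O) (e : 'I_n -> expect R T) c,
    (M <= m)%N -> (m <= n)%N -> indep E e c -> like m e ->
    E (fun o => ind R (\sum_(i < n | (i < m)%N) f (c o i) <= m%:R * gam)%R) <= eps%:E.
Proof.
rewrite /signed_sum; set Sp := esum _ _; set Sm := esum _ _ => hgam eps0.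
pose fp t := Num.max (P t * f t)%R 0%R.
pose fm t := Num.max (- (P t * f t))%R 0%R.
have fp0 t : 0 <= (fp t)%:E by rewrite lee_fin le_max lexx orbT.
have fm0 t : 0 <= (fm t)%:E by rewrite lee_fin le_max lexx orbT.
have Sm0 : 0 <= Sm by exact: Sum_ge0.
have Sp0 : 0 <= Sp by exact: Sum_ge0.
(* An infinite negative part would make the difference [-oo], also against an infinite positive
   part, by the convention for [+oo - +oo]. *)
have [s Es] : exists s, Sm = s%:E.
  move: Sm0 hgam; case: Sm => [s| |]//; first by exists s.
  by move=> _; move: Sp0; case: Sp.
have {}hgam : (gam + s)%:E < Sp.
  move: hgam; rewrite Es; case: (Sp) => [x| |] //= h; last exact: ltry.
  by move: h; rewrite -EFinB !lte_fin; lra.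
move/ereal_sup_gt : (hgam) => [_ [A1 [finA1 _] <-]] hA1.
rewrite fsumEFin// lte_fin in hA1.
set a1 := (\sum_(_ \in A1) _)%R in hA1.
(* The finite set [A1] carries positive mass [gam + s + 2 del]: one [del] is the Chernoff margin,
   the other allows for the truncation. The next choice makes the truncation error [eta / del] equal
   to [eps / 2]. *)
pose del := ((a1 - s - gam) / 2)%R.
have del0 : (0 < del)%R by rewrite divr_gt0//; lra.
pose eta := (eps * del / 2)%R.
have eta0 : (0 < eta)%R by rewrite divr_gt0// mulr_gt0.
have : (s - eta)%:E < Sm by rewrite Es lte_fin ltrBlDr ltrDl.
move/ereal_sup_gt => [_ [A2 [finA2 _] <-]].
rewrite fsumEFin// lte_fin; set b1 := (\sum_(_ \in A2) _)%R => hA2.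
pose A := A1 `|` A2.
have finA : finite_set A by rewrite finite_setU.
pose h t := if t \in A then f t else 0%R.
pose d t := if t \in A then 0%R else Num.max (- f t)%R 0%R.
pose a := (\sum_(t \in A) fp t)%R.
pose b := (\sum_(t \in A) fm t)%R.
have ha1 : (a1 <= a)%R.
  rewrite -lee_fin /a1 /a -!fsumEFin//; apply: lee_fsum_nneg_subset => // t; last by move=> _; exact: fp0.
  by rewrite !inE; left.
have hb1 : (b1 <= b)%R.
  rewrite -lee_fin /b1 /b -!fsumEFin//; apply: lee_fsum_nneg_subset => // t; last by move=> _; exact: fm0.
  by rewrite !inE; right.
have Ea : \esum_(t in A) (fp t)%:E = a%:E by rewrite esum_fset// fsumEFin.
have Eb : \esum_(t in A) (fm t)%:E = b%:E by rewrite esum_fset// fsumEFin.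
have Ep : EE P (fun t => (Num.max (h t) 0)%:E) = a%:E.
  rewrite EEE -Ea [RHS]esum_mkcond; apply: eq_Sum => t.
  rewrite -EFinM -max0_mulr// /h; case: ifP => //.
  by rewrite mulr0 maxxx.
have Em : EE P (fun t => (Num.max (- h t) 0)%:E) = b%:E.
  rewrite EEE -Eb [RHS]esum_mkcond; apply: eq_Sum => t.
  rewrite -EFinM -max0_mulr// mulrN /h; case: ifP => //.
  by rewrite mulr0 oppr0 maxxx.
have Ed : EE P (fun t => (d t)%:E) <= eta%:E.
  have : Sm = \esum_(t in A) (fm t)%:E + EE P (fun t => (d t)%:E).
    rewrite /Sm (esumID A setT) => [|t _]; last exact: fm0.
    rewrite !setTI; congr (_ + _).
    rewrite EEE [LHS]esum_mkcond; apply: eq_Sum => t.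
    rewrite in_setC /d; case: ifP => [/negbTE ->|/negbFE ->]; last by rewrite mule0.
    by rewrite -EFinM -max0_mulr// mulrN.
  rewrite Es Eb; case: (EE P _) => [x| |]//; rewrite -EFinD => -[hx]; rewrite lee_fin; lra.
have bs : (b <= s)%R.
  rewrite -lee_fin -Eb -Es /Sm (esumID A setT) => [|t _]; last exact: fm0.
  by rewrite setTI leeDl// esum_ge0// => t _; exact: fm0.
have [K0 K00 hK0] := finite_bounded f finA.
pose K := (1 + del + `|gam + del| + K0)%R.
have gn := normr_ge0 (gam + del)%R.
have [|||||||rho rho01 hrho] := @LLN_trunc f h d K gam del eta a b del0 _ _ _ _ _ _ Ep Em _ Ed.
- by rewrite /K; lra.
- by rewrite /K; lra.
- by move=> t; rewrite /d; case: ifP => _; rewrite ?lexx// le_max lexx orbT.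
- move=> t; rewrite /h /d; case: ifP => _; first by rewrite subr0.
  by rewrite sub0r lerNl le_max lexx.
- move=> t; apply: le_trans (ler_normB _ _) _.
  have : (`|h t| <= K0)%R by rewrite /h; case: ifPn => [/set_mem/hK0|_]; rewrite ?normr0.
  by rewrite /K; lra.
- by rewrite /K; lra.
- by rewrite /del; lra.
have [M hM] := expr_small rho01 (divr_gt0 eps0 (ltr0n _ 2)).
exists M.+1 => n m O E e c Mm mn hE he.
apply: le_trans (hrho n m O E e c _ mn hE he) _; first exact: leq_ltn_trans Mm.
have := hM m (ltnW Mm); rewrite lee_fin /eta.
have -> : (eps * del / 2 / del = eps / 2)%R by field; rewrite gt_eqF.
by lra.
Qed.

(** Likelihood ratios are known to be positive only on the support of [P]; off it their logarithms
    carry no meaning, and these letters have to be excluded. *)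
Lemma null_coord n m O (E : expect R O) (e : 'I_n -> expect R T) c :
  indep E e c -> like m e ->
  E (fun o => \sum_(i < n | (i < m)%N) ind R (P (c o i) == 0%R)) = 0.
Proof.
move=> hE he; rewrite ex_sum; last by move=> *; exact: ind_ge0.
apply: big1 => i im; rewrite (indep_one i hE (G := fun t => ind R (P t == 0%R))); last first.
  by move=> t; exact: ind_ge0.
rewrite (he i im) ?EEE; last by move=> t; exact: ind_ge0.
apply: esum1 => t _; rewrite /ind -EFinM.
by have [->|_] := eqVneq (P t) 0%R; rewrite ?mul0r ?mulr0.
Qed.

Lemma log2_prod (n m : nat) (x : 'I_n -> R) :
  (forall i : 'I_n, (i < m)%N -> (0 < x i)%R) ->
  (\prod_(i < n | (i < m)%N) x i = 2 `^ (\sum_(i < n | (i < m)%N) log2 (x i)))%R.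
Proof.
move=> x0; have ln2 : (0 < ln 2 :> R)%R by rewrite ln_gt0// ltr1n.
elim/big_rec2: _ => [|i y1 y2 im ->]; first by rewrite powRr0.
rewrite powRD ?pnatr_eq0 ?implybT//; congr (_ * _)%R.
rewrite /log2 /powR pnatr_eq0/= divfK ?gt_eqF// lnK// posrE.
exact: x0.
Qed.

Lemma LLN_ratio (r : T -> R) (gam eps : R) :
  (forall t, P t != 0%R -> (0 < r t)%R) ->
  gam%:E < signed_sum (fun t => P t * log2 (r t))%R -> (0 < eps)%R ->
  exists M, forall n m O (E : expect R O) (e : 'I_n -> expect R T) c,
    (M <= m)%N -> (m <= n)%N -> indep E e c -> like m e ->
    E (fun o => ind R (~~ (2 `^ (m%:R * gam) <= \prod_(i < n | (i < m)%N) r (c o i))%R)) <= eps%:E.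
Proof.
move=> r0 hgam eps0; have [M hM] := LLN_lower hgam eps0.
exists M => n m O E e c Mm mn hE he.
rewrite -[leRHS]adde0 -(null_coord hE he).
apply: le_trans (leeD (hM _ _ _ _ _ _ Mm mn hE he) (lexx _)).
rewrite -exD; [|by move=> *; exact: ind_ge0|]; last first.
  by move=> o; apply: sume_ge0 => *; exact: ind_ge0.
apply: ex_le => o; first exact: ind_ge0.
have [/existsP[i /andP[im Pi]]|/existsPn hP] := boolP [exists i : 'I_n, (i < m)%N && (P (c o i) == 0%R)].
  rewrite [X in _ <= _ + X](bigD1 i)//= Pi; apply: (@le_trans _ _ (ind R true)).
    by rewrite lee_fin lern1 leq_b1.
  rewrite addeCA leeDl// adde_ge0//; first exact: ind_ge0.
  by apply: sume_ge0 => *; exact: ind_ge0.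
apply: (@le_trans _ _ (ind R (\sum_(i < n | (i < m)%N) log2 (r (c o i)) <= m%:R * gam)%R)); last first.
  by rewrite leeDl// sume_ge0// => *; exact: ind_ge0.
rewrite log2_prod; last first.
  by move=> i im; apply: r0; have := hP i; rewrite im.
rewrite lee_fin ler_nat.
have [_|hs] := lerP (\sum_(i < n | (i < m)%N) log2 (r (c o i))) (m%:R * gam).
  exact: leq_b1.
suff -> : (2 `^ (m%:R * gam) <= 2 `^ (\sum_(i < n | (i < m)%N) log2 (r (c o i))))%R by [].
by apply: ler_powR; [rewrite ler1n|exact: ltW].
Qed.

End LLN.

(** * Single-letter likelihood ratios *)

Section Laws.
Context (R : realType) (T : choiceType) (P : T -> R).
Hypothesis Ppmf : is_pmf P.
Local Open Scope ereal_scope.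

Let P0 t : (0 <= P t)%R. Proof. by case: Ppmf. Qed.
Let Pe0 t : 0 <= (P t)%:E. Proof. by rewrite lee_fin. Qed.

Lemma Prob_esum (E : set T) : (Prob P E)%:E = \esum_(t in E) (P t)%:E.
Proof.
have [_ P1] := Ppmf; rewrite /Prob fineK// ge0_fin_numE; last exact: esum_ge0.
apply: (@le_lt_trans _ _ 1); last exact: ltry.
by rewrite -P1 (esumID E setT)// setTI leeDl// esum_ge0.
Qed.

Lemma law_ge0 (A : choiceType) (X : T -> A) a : (0 <= law P X a)%R.
Proof. by rewrite -lee_fin /law Prob_esum esum_ge0. Qed.

Lemma lawE (A : choiceType) (X : T -> A) a :
  (law P X a)%:E = Sum (fun t => ((X t == a)%:R * P t)%:E).
Proof.
rewrite /law Prob_esum esum_mkcond; apply: eq_Sum => t.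
have [Xa|Xa] := eqVneq (X t) a; rewrite ?mul1r ?mul0r; first by rewrite mem_set.
by rewrite memNset// => /eqP; rewrite (negbTE Xa).
Qed.

Lemma Sum_delta (A : choiceType) (a : A) (F : A -> \bar R) : 0 <= F a ->
  (forall x, x != a -> F x = 0) -> Sum F = F a.
Proof.
move=> F0 Fa; rewrite (esumID [set a]) => [|x _]; last first.
  by have [->|/Fa ->] := eqVneq x a.
rewrite setTI esum_set1// esum1 ?adde0// => x [_ /= /eqP]; exact: Fa.
Qed.

Lemma Sum_law (A : choiceType) (X : T -> A) (phi : A -> R) : (forall a, (0 <= phi a)%R) ->
  Sum (fun a => (law P X a * phi a)%:E) = Sum (fun t => (P t * phi (X t))%:E).
Proof.
move=> phi0.
have t0 t a : 0 <= ((X t == a)%:R * P t * phi a)%:E.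
  by rewrite lee_fin !mulr_ge0.
transitivity (Sum (fun a => Sum (fun t => ((X t == a)%:R * P t * phi a)%:E))).
  apply: eq_Sum => a; rewrite mulrC EFinM lawE -SumZ ?lee_fin//; last first.
    by move=> t; rewrite lee_fin mulr_ge0.
  by apply: eq_Sum => t; rewrite -EFinM mulrC.
rewrite Sum_swap//; apply: eq_Sum => t.
rewrite (Sum_delta (a := X t))//; first by rewrite eqxx mul1r.
by move=> a; rewrite eq_sym => /negbTE ->; rewrite !mul0r.
Qed.

Lemma law_pmf (A : choiceType) (X : T -> A) : is_pmf (law P X).
Proof.
split; first exact: law_ge0.
have := @Sum_law A X (fun=> 1%R) (fun=> ler01).
under eq_Sum do rewrite mulr1; move=> ->.
by under eq_Sum do rewrite mulr1; case: Ppmf.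
Qed.

Lemma law_marginal (A B : choiceType) (X : T -> A) (Y : T -> B) (f : A -> B) b :
  (forall t, f (X t) = Y t) ->
  Sum (fun a => ((f a == b)%:R * law P X a)%:E) = (law P Y b)%:E.
Proof.
move=> hf; under eq_Sum => a do rewrite mulrC.
rewrite (@Sum_law _ X (fun a => (f a == b)%:R))// lawE.
by apply: eq_Sum => t; rewrite hf mulrC.
Qed.

Lemma law_le (A B : choiceType) (X : T -> A) (Y : T -> B) (f : A -> B) a :
  (forall t, f (X t) = Y t) -> (law P X a <= law P Y (f a))%R.
Proof.
move=> hf; rewrite -lee_fin !lawE; apply: le_Sum => t; rewrite lee_fin ler_wpM2r//.
by have [<-|_] := eqVneq (X t) a; rewrite ?hf ?eqxx.
Qed.

Lemma law_comp0 (A B : choiceType) (X : T -> A) (Y : T -> B) (f : A -> B) a :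
  (forall t, f (X t) = Y t) -> law P Y (f a) = 0%R -> law P X a = 0%R.
Proof.
by move=> hf h; apply/eqP; rewrite eq_le law_ge0 andbT -h; apply: law_le.
Qed.

Lemma law_gt0 (A : choiceType) (X : T -> A) t : P t != 0%R -> (0 < law P X (X t))%R.
Proof.
move=> Pt; rewrite lt_def law_ge0 andbT; apply: contra_neq Pt => h.
have := lawE X (X t); rewrite h => h'.
apply/eqP; rewrite eq_le P0 andbT -lee_fin [X in _ <= X]h'.
rewrite (esumID [set t]) => [|s _]; last by rewrite lee_fin mulr_ge0.
rewrite setTI esum_set1 ?eqxx ?mul1r//.
by rewrite leeDl// esum_ge0// => s _; rewrite lee_fin mulr_ge0.
Qed.

Section Ratio.
Context (A B C : choiceType) (X : T -> A) (Y : T -> B) (Z : T -> C).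

Definition cond_ratio x y z : R :=
  ((law P (fun t => (X t, Y t, Z t)) (x, y, z) / law P Z z)
   / ((law P (fun t => (X t, Z t)) (x, z) / law P Z z)
      * (law P (fun t => (Y t, Z t)) (y, z) / law P Z z)))%R.

Lemma cond_ratio_ge0 x y z : (0 <= cond_ratio x y z)%R.
Proof. by rewrite !(mulr_ge0, invr_ge0) ?law_ge0. Qed.

Lemma signed_sum_law (D : choiceType) (S : T -> D) (l : D -> R) :
  signed_sum (fun s => law P S s * l s)%R = signed_sum (fun t => P t * l (S t))%R.
Proof.
have h (l' : D -> R) : Sum (fun s => (Num.max (law P S s * l' s)%R 0%R)%:E) =
    Sum (fun t => (Num.max (P t * l' (S t))%R 0%R)%:E).
  under eq_Sum => s do rewrite max0_mulr ?law_ge0//.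
  under [RHS]eq_Sum => t do rewrite max0_mulr//.
  by apply: (@Sum_law _ S (fun s => Num.max (l' s) 0%R)) => a; rewrite le_max lexx orbT.
rewrite /signed_sum h; congr (_ - _).
by under eq_Sum do rewrite -mulrN; rewrite h; under [RHS]eq_Sum do rewrite -mulrN.
Qed.

(** Summing over outcomes instead of values puts all informations on the same space [T], where the
    law of large numbers for the letters applies. *)
Lemma cond_mutual_infoE : cond_mutual_info P X Y Z =
  signed_sum (fun t => P t * log2 (cond_ratio (X t) (Y t) (Z t)))%R.
Proof.
rewrite -(@signed_sum_law _ (fun t => (X t, Y t, Z t))
  (fun s => log2 (cond_ratio s.1.1 s.1.2 s.2))).
by congr signed_sum; apply/funext => -[[x y] z].
Qed.

Lemma cond_ratio_gt0 t : P t != 0%R -> (0 < cond_ratio (X t) (Y t) (Z t))%R.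
Proof.
move=> Pt; rewrite /cond_ratio.
have h1 := law_gt0 Z Pt; have h2 := law_gt0 (fun t => (X t, Z t)) Pt.
have h3 := law_gt0 (fun t => (Y t, Z t)) Pt.
have h4 := law_gt0 (fun t => (X t, Y t, Z t)) Pt.
by rewrite !(divr_gt0, mulr_gt0).
Qed.

(** p(x, z) times the ratio is p(x, y, z) p(z) / p(y, z), whose sum over x is p(z). As division by
    zero gives 0, null events only lose mass, and the equality weakens to [<=]. *)
Lemma cond_ratio_fiber y z :
  Sum (fun t => (P t * ((Z t == z)%:R * cond_ratio (X t) y z))%:E) <= (law P Z z)%:E.
Proof.
rewrite -(@Sum_law _ (fun t => (X t, Z t))
  (fun s => ((s.2 == z)%:R * cond_ratio s.1 y z)%R)); last first.
  by move=> s; rewrite mulr_ge0 ?cond_ratio_ge0.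
have t0 s : 0 <= (law P (fun t => (X t, Z t)) s *
    ((s.2 == z)%:R * cond_ratio s.1 y z))%:E.
  rewrite lee_fin; apply: mulr_ge0; first exact: law_ge0.
  by apply: mulr_ge0 => //; exact: cond_ratio_ge0.
pose k := (law P Z z / law P (fun t => (Y t, Z t)) (y, z))%R.
have k0 : (0 <= k)%R by rewrite divr_ge0 ?law_ge0.
apply: (@le_trans _ _ (Sum (fun s : A * B * C =>
    (k%:E * (((s.1.2, s.2) == (y, z))%:R * law P (fun t => (X t, Y t, Z t)) s)%:E)))).
  rewrite Sum_pair; last by move=> s; apply: t0.
  have e0 s : 0 <= k%:E * (((s.1.2, s.2) == (y, z))%:R * law P (fun t => (X t, Y t, Z t)) s)%:E.
    apply: mule_ge0; rewrite lee_fin //; apply: mulr_ge0 => //; exact: law_ge0.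
  rewrite Sum_pair// Sum_pair; last by move=> s; apply: Sum_ge0.
  apply: le_Sum => x /=.
  rewrite (Sum_delta (a := z)); [| |by move=> c /negbTE ->; rewrite mul0r mulr0]; last first.
    exact: t0.
  rewrite (Sum_delta (a := y)); [|by apply: Sum_ge0 => c; exact: (e0 (x, y, c))|]; last first.
    move=> b /negbTE by_; apply: esum1 => c _.
    by rewrite xpair_eqE by_ mul0r mule0.
  rewrite (Sum_delta (a := z)) => [||c /negbTE cz]; [|exact: (e0 (x, y, z))|]; last first.
    by rewrite xpair_eqE cz andbF mul0r mule0.
  rewrite !eqxx !mul1r -EFinM lee_fin /cond_ratio /k.
  have [z0|z0] := eqVneq (law P Z z) 0%R.
    by rewrite z0 invr0 !(mulr0, mul0r).
  have [xz0|xz0] := eqVneq (law P (fun t => (X t, Z t)) (x, z)) 0%R.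
    by rewrite xz0 mul0r !mulr_ge0 ?invr_ge0 ?law_ge0.
  have [yz0|yz0] := eqVneq (law P (fun t => (Y t, Z t)) (y, z)) 0%R.
    by rewrite yz0 !(mul0r, invr0, mulr0).
  by rewrite le_eqVlt; apply/orP; left; apply/eqP; field; rewrite ?z0 ?xz0 ?yz0.
rewrite SumZ ?lee_fin//; last by move=> s; rewrite lee_fin mulr_ge0 ?law_ge0.
rewrite (@law_marginal _ _ (fun t => (X t, Y t, Z t)) (fun t => (Y t, Z t)) (fun s => (s.1.2, s.2)))//.
rewrite -EFinM lee_fin /k.
have [->|yz0] := eqVneq (law P (fun t => (Y t, Z t)) (y, z)) 0%R.
  by rewrite mulr0 law_ge0.
by rewrite divfK.
Qed.

Lemma cond_ratio_null x y z : law P Z z = 0%R -> cond_ratio x y z = 0%R.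
Proof. by move=> h; rewrite /cond_ratio h invr0 !(mulr0, mul0r). Qed.

End Ratio.

End Laws.

Section LawsMore.
Context (R : realType) (T : choiceType) (P : T -> R).
Hypothesis Ppmf : is_pmf P.
Local Open Scope ereal_scope.

Lemma law_ext (A B : choiceType) (X : T -> A) (Y : T -> B) a b :
  (forall t, (X t == a) = (Y t == b)) -> law P X a = law P Y b.
Proof.
move=> h; congr Prob; apply/seteqP.
by split => t /= /eqP e; apply/eqP; [rewrite -h|rewrite h].
Qed.

Lemma law_sum_fst (A C : choiceType) (X : T -> A) (Z : T -> C) z :
  Sum (fun x => (law P (fun t => (X t, Z t)) (x, z))%:E) = (law P Z z)%:E.
Proof.
rewrite -(@law_marginal _ _ _ Ppmf _ _ (fun t => (X t, Z t)) Z snd)//.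
rewrite Sum_pair; last by move=> s; rewrite lee_fin mulr_ge0 ?law_ge0.
apply: eq_Sum => x; rewrite (Sum_delta (a := z))/= ?eqxx ?mul1r ?lee_fin ?law_ge0//.
by move=> c /negbTE ->; rewrite mul0r.
Qed.

(** A null [z] gets the marginal of [X] as a default, which makes the kernel a law for every [z];
    products with [law P Z z] do not see the choice. *)
Lemma cond_mass_proof (A C : choiceType) (X : T -> A) (Z : T -> C) z :
  is_pmf (fun x => if law P Z z == 0%R then law P X x
    else law P (fun t => (X t, Z t)) (x, z) / law P Z z)%R.
Proof.
have [_|z0] := eqVneq (law P Z z) 0%R; first exact: law_pmf.
split=> [x|]; first by rewrite divr_ge0 ?law_ge0.
under eq_Sum do rewrite mulrC EFinM.
rewrite SumZ ?lee_fin ?invr_ge0 ?law_ge0// => [|x]; last by rewrite lee_fin law_ge0.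
by rewrite law_sum_fst -EFinM mulVf.
Qed.

Definition law_mass (A : choiceType) (X : T -> A) : massfn R A := MassFn (law_pmf Ppmf X).
Definition cond_mass (A C : choiceType) (X : T -> A) (Z : T -> C) z : massfn R A :=
  MassFn (cond_mass_proof X Z z).

Lemma cond_massE (A C : choiceType) (X : T -> A) (Z : T -> C) x z :
  (law P Z z * cond_mass X Z z x = law P (fun t => (X t, Z t)) (x, z))%R.
Proof.
rewrite /=; have [h|h] := eqVneq (law P Z z) 0%R; last by rewrite mulrC divfK.
rewrite h mul0r; apply/esym/le_anti; rewrite law_ge0// andbT -h.
exact: (@law_le _ _ _ Ppmf _ _ _ _ snd (x, z)).
Qed.

Lemma cond_ratio_sym (A B C : choiceType) (X : T -> A) (Y : T -> B) (Z : T -> C) x y z :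
  cond_ratio P X Y Z x y z = cond_ratio P Y X Z y x z.
Proof.
rewrite /cond_ratio (@law_ext _ _ (fun t => (X t, Y t, Z t)) (fun t => (Y t, X t, Z t)) _ (y, x, z)).
  by congr (_ / _)%R; rewrite mulrC.
by move=> t; rewrite !xpair_eqE [(X t == x) && _]andbC.
Qed.

Lemma mutual_infoE (A B : choiceType) (X : T -> A) (Y : T -> B) :
  mutual_info P X Y = cond_mutual_info P X Y (fun=> tt).
Proof.
rewrite cond_mutual_infoE// -(@signed_sum_law _ _ _ Ppmf _ (fun t => (X t, Y t))
  (fun s => log2 (cond_ratio P X Y (fun=> tt) s.1 s.2 tt))).
congr signed_sum; apply/funext => -[x y] /=; congr (_ * log2 _)%R.
rewrite /cond_ratio (@law_ext _ _ (fun t => (X t, Y t, tt)) (fun t => (X t, Y t)) _ (x, y));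
  last by move=> t; rewrite !xpair_eqE eqxx andbT.
rewrite (@law_ext _ _ (fun t => (X t, tt)) X _ x); last by move=> t; rewrite xpair_eqE eqxx andbT.
rewrite (@law_ext _ _ (fun t => (Y t, tt)) Y _ y); last by move=> t; rewrite xpair_eqE eqxx andbT.
have -> : law P (fun=> tt) tt = 1%R.
  have [_ h] := Ppmf; apply/EFin_inj; rewrite lawE// -h; apply: eq_Sum => t.
  by rewrite eqxx mul1r.
by rewrite !divr1.
Qed.

(** [E] stands for the mean over the fresh letters of one kind and [c] for the mass of the shared
    ones: c E(ratio) is at most P(Z = z) = c E(1), hence at most c. On a null fibre, [c = 0], the
    ratio vanishes. *)
Lemma fiber_le1 (A B C : choiceType) (X : T -> A) (Y : T -> B) (Z : T -> C) y z
    (E : (A -> R) -> \bar R) (c : R) :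
  (0 <= c)%R ->
  (forall phi, (forall a, 0 <= phi a)%R ->
    Sum (fun t => (P t * ((Z t == z)%:R * phi (X t)))%:E) = c%:E * E phi) ->
  E (fun=> 1%R) <= 1 -> E (fun=> 0%R) <= 1 ->
  E (fun x => cond_ratio P X Y Z x y z) <= 1.
Proof.
move=> c0 hE E1 E0.
have hZ : (law P Z z)%:E = c%:E * E (fun=> 1%R).
  by rewrite -hE// lawE//; apply: eq_Sum => t; rewrite mulr1 mulrC.
have hr := hE _ (fun x => cond_ratio_ge0 Ppmf X Y Z x y z).
move: c0; rewrite le_eqVlt => /orP[/eqP c0|c0].
  rewrite (_ : (fun x => _) = (fun=> 0%R))//; apply/funext => x.
  apply: cond_ratio_null; apply/EFin_inj.
  by rewrite hZ -c0 mul0e.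
rewrite -(@lee_pmul2l _ c%:E) ?lte_fin// -hr.
apply: le_trans (cond_ratio_fiber Ppmf X Y Z y z) _.
by rewrite hZ lee_pmul2l ?lte_fin.
Qed.

Lemma fiber_cond (A C : choiceType) (X : T -> A) (Z : T -> C) z (phi : A -> R) :
  (forall a, 0 <= phi a)%R ->
  Sum (fun t => (P t * ((Z t == z)%:R * phi (X t)))%:E) =
  (law P Z z)%:E * EE (cond_mass X Z z) (fun x => (phi x)%:E).
Proof.
move=> phi0.
rewrite -(@Sum_law _ _ _ Ppmf _ (fun t => (X t, Z t)) (fun s => (s.2 == z)%:R * phi s.1)%R); last first.
  by move=> s; rewrite mulr_ge0.
have t0 s : 0 <= (law P (fun t => (X t, Z t)) s * ((s.2 == z)%:R * phi s.1))%:E.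
  by rewrite lee_fin mulr_ge0 ?mulr_ge0 ?law_ge0.
rewrite Sum_pair// EEE -SumZ ?lee_fin ?law_ge0//; last first.
  by move=> x; rewrite mule_ge0 ?lee_fin ?mass_ge0.
apply: eq_Sum => x; rewrite (Sum_delta (a := z)); last first.
- by move=> c /negbTE /= ->; rewrite mul0r mulr0.
- exact: t0.
by rewrite -!EFinM [in RHS]mulrA cond_massE eqxx mul1r.
Qed.

Lemma cond_ratio_mean (A B C : choiceType) (X : T -> A) (Y : T -> B) (Z : T -> C) y z :
  EE (cond_mass X Z z) (fun x => (cond_ratio P X Y Z x y z)%:E) <= 1.
Proof.
apply: (@fiber_le1 _ _ _ X Y Z y z (fun phi => EE (cond_mass X Z z) (fun x => (phi x)%:E)) (law P Z z)).
- exact: law_ge0.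
- by move=> phi; exact: fiber_cond.
- by rewrite ex_cst.
- by rewrite ex_cst.
Qed.

End LawsMore.

(** * The single-letter law and its factorisation *)

Section SingleLetter.
Context (R : realType) (U V1 V2 X1 X2 Y : choiceType).
Variables (puv : U * V1 * V2 -> R) (q1 : U -> V1 -> massfn R X1) (q2 : U -> V2 -> massfn R X2).
Variable W : X1 -> X2 -> massfn R Y.
Hypothesis puvP : is_pmf puv.
Local Open Scope ereal_scope.
Let T := (U * V1 * V2 * X1 * X2 * Y)%type.
Let P : T -> R := joint_law puv q1 q2 W.

Let puv0 s : (0 <= puv s)%R. Proof. by case: puvP. Qed.
Let P0 t : (0 <= P t)%R.
Proof. by case: t => [[[[[u v1] v2] x1] x2] y]; rewrite /P /= !(mulr_ge0, mass_ge0). Qed.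

Lemma Sum_joint5 (phi : U -> V1 -> V2 -> X1 -> X2 -> R) :
  (forall u v1 v2 x1 x2, (0 <= phi u v1 v2 x1 x2)%R) ->
  Sum (fun t : T => (P t * phi t.1.1.1.1.1 t.1.1.1.1.2 t.1.1.1.2 t.1.1.2 t.1.2)%:E) =
  Sum (fun u => Sum (fun v1 => Sum (fun v2 => Sum (fun x1 => Sum (fun x2 =>
    (puv (u, v1, v2) * q1 u v1 x1 * q2 u v2 x2 * phi u v1 v2 x1 x2)%:E))))).
Proof.
move=> phi0; rewrite !Sum_pair; try by move=> *; do ?apply: Sum_ge0 => ?; rewrite lee_fin mulr_ge0.
do 5 (apply: eq_Sum => ?) => /=.
under eq_Sum => y do rewrite mulrAC EFinM.
by rewrite SumZ ?lee_fin ?(mulr_ge0, mass_ge0)// mass_sum1 mule1.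
Qed.

Lemma Sum_joint3 (phi : U -> V1 -> V2 -> R) :
  (forall u v1 v2, (0 <= phi u v1 v2)%R) ->
  Sum (fun t : T => (P t * phi t.1.1.1.1.1 t.1.1.1.1.2 t.1.1.1.2)%:E) =
  Sum (fun u => Sum (fun v1 => Sum (fun v2 => (puv (u, v1, v2) * phi u v1 v2)%:E))).
Proof.
move=> phi0; rewrite (Sum_joint5 (phi := fun u v1 v2 _ _ => phi u v1 v2))//.
do 3 (apply: eq_Sum => ?).
under eq_Sum => x1.
  under eq_Sum => x2 do rewrite mulrAC EFinM.
  rewrite SumZ ?lee_fin ?(mulr_ge0, mass_ge0)// mass_sum1 mule1 mulrAC EFinM.
  over.
by rewrite SumZ ?lee_fin ?(mulr_ge0, mass_ge0)// mass_sum1 mule1.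
Qed.

Lemma joint_pmf : is_pmf P.
Proof.
split=> //; have := @Sum_joint3 (fun _ _ _ => 1%R) (fun _ _ _ => ler01).
under eq_Sum do rewrite mulr1; move=> ->.
under eq_Sum do under eq_Sum do under eq_Sum do rewrite mulr1.
have [_ <-] := puvP; rewrite Sum_pair; last by move=> s; rewrite lee_fin.
by rewrite Sum_pair// => s; apply: Sum_ge0 => v2; rewrite lee_fin.
Qed.

Let tu (t : T) : U := t.1.1.1.1.1.
Let tv1 (t : T) : V1 := t.1.1.1.1.2.
Let tv2 (t : T) : V2 := t.1.1.1.2.
Let tx1 (t : T) : X1 := t.1.1.2.
Let tx2 (t : T) : X2 := t.1.2.
Let ty (t : T) : Y := t.2.

Definition sU : massfn R U := law_mass joint_pmf tu.
Definition s1 : U -> massfn R V1 := cond_mass joint_pmf tv1 tu.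
Definition s2 : U -> massfn R V2 := cond_mass joint_pmf tv2 tu.
Definition slr u v1 v2 : R := cond_ratio P tv1 tv2 tu v1 v2 u.

Lemma slr_ge0 u v1 v2 : (0 <= slr u v1 v2)%R.
Proof. exact: (cond_ratio_ge0 joint_pmf). Qed.

Lemma law_puv u v1 v2 : law P (fun t => (tv1 t, tv2 t, tu t)) (v1, v2, u) = puv (u, v1, v2).
Proof.
apply: EFin_inj; rewrite (lawE joint_pmf).
under eq_Sum do rewrite mulrC.
have h u' v1' v2' : (0 <= ((v1', v2', u') == (v1, v2, u))%:R :> R)%R by [].
rewrite (Sum_joint3 (phi := fun u' v1' v2' => ((v1', v2', u') == (v1, v2, u))%:R))//.
have p0 u' v1' v2' : 0 <= (puv (u', v1', v2') * ((v1', v2', u') == (v1, v2, u))%:R)%:E.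
  by rewrite lee_fin mulr_ge0.
rewrite (Sum_delta (a := u)); last first.
- move=> u' /negbTE e; do 2 (apply: esum1 => ? _); by rewrite !xpair_eqE e andbF mulr0.
- by do 2 (apply: Sum_ge0 => ?).
rewrite (Sum_delta (a := v1)); last first.
- move=> v1' /negbTE e; apply: esum1 => ? _; by rewrite !xpair_eqE e mulr0.
- by apply: Sum_ge0 => ?.
rewrite (Sum_delta (a := v2))//; first by rewrite eqxx mulr1.
by move=> v2' /negbTE e; rewrite !xpair_eqE e andbF mulr0.
Qed.

(** The product rule for conditional laws. Wherever a factor vanishes, [puv] vanishes too, being
    dominated by the corresponding marginal. *)
Lemma slrE u v1 v2 : (sU u * s1 u v1 * s2 u v2 * slr u v1 v2 = puv (u, v1, v2))%R.
Proof.
rewrite -law_puv; set L := law P _ _; rewrite /slr /cond_ratio -/L.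
have e1 : (law P tu u * s1 u v1 = law P (fun t => (tv1 t, tu t)) (v1, u))%R by exact: cond_massE.
have e2 : (law P tu u * s2 u v2 = law P (fun t => (tv2 t, tu t)) (v2, u))%R by exact: cond_massE.
rewrite -e1 -e2 -[sU u]/(law P tu u).
have [u0|u0] := eqVneq (law P tu u) 0%R.
  by rewrite u0 !mul0r; apply/esym/(law_comp0 joint_pmf (f := snd) (Y := tu)).
have [a0|a0] := eqVneq (s1 u v1) 0%R.
  rewrite a0 !(mulr0, mul0r); apply/esym/(law_comp0 joint_pmf (f := fun s => (s.1.1, s.2))
    (Y := fun t => (tv1 t, tu t))) => //=.
  by rewrite -e1 a0 mulr0.
have [b0|b0] := eqVneq (s2 u v2) 0%R.
  rewrite b0 !(mulr0, mul0r); apply/esym/(law_comp0 joint_pmf (f := fun s => (s.1.2, s.2))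
    (Y := fun t => (tv2 t, tu t))) => //=.
  by rewrite -e2 b0 mulr0.
by field; rewrite u0 a0 b0.
Qed.

End SingleLetter.

(** * Fibre sums and means of the nine ratios *)

Section Fibers.
Context (R : realType) (U V1 V2 X1 X2 Y : choiceType).
Variables (puv : U * V1 * V2 -> R) (q1 : U -> V1 -> massfn R X1) (q2 : U -> V2 -> massfn R X2).
Variable W : X1 -> X2 -> massfn R Y.
Hypothesis puvP : is_pmf puv.
Variables (pU : massfn R U) (p1 : U -> massfn R V1) (p2 : U -> massfn R V2) (lr : U -> V1 -> V2 -> R).
Hypothesis lr0 : forall u v1 v2, 0 <= lr u v1 v2.
Hypothesis lrE : forall u v1 v2, pU u * p1 u v1 * p2 u v2 * lr u v1 v2 = puv (u, v1, v2).
Local Open Scope ereal_scope.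
Let T := (U * V1 * V2 * X1 * X2 * Y)%type.
Let P : T -> R := joint_law puv q1 q2 W.
Let tu (t : T) : U := t.1.1.1.1.1.
Let tv1 (t : T) : V1 := t.1.1.1.1.2.
Let tv2 (t : T) : V2 := t.1.1.1.2.
Let tx1 (t : T) : X1 := t.1.1.2.
Let tx2 (t : T) : X2 := t.1.2.
Let tx12 t := (tx1 t, tx2 t).
Let puv0 s : (0 <= puv s)%R. Proof. by case: puvP. Qed.

Ltac posr := rewrite ?lee_fin ?(mulr_ge0, mass_ge0) //.
Ltac dz := let e := fresh in intros ? e; move/negbTE: e => e; do ?(apply: esum1 => ? _);
  rewrite ?xpair_eqE ?e ?andbF /= ?mul0r ?mulr0.
Ltac sum_delta a0 := rewrite (Sum_delta (a := a0)); [|do ?(apply: Sum_ge0 => ?); posr|by dz].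
Ltac expand := rewrite EEE ?muleA -SumZ;
  [|do ?(apply: mule_ge0); posr|intros; apply: mule_ge0; [posr|nneg; posr]].

(** The nine fibre lemmas supply the hypothesis of [fiber_le1]. As long as some v_i is fresh, the
    shared letters are weighted by [pU], [p1], [p2] and the kernels as in the codebook, and [lr]
    stays inside the mean; for [Kcc], [Kc1] and [Kc2] it is part of the weight [puv]. *)
Lemma fiber_K0 (phi : X1 * X2 -> R) : (forall x, (0 <= phi x)%R) ->
  Sum (fun t : T => (P t * ((tt == tt)%:R * phi (tx12 t)))%:E) =
  1%:E * EE pU (fun u => EE (p1 u) (fun v1 => EE (p2 u) (fun v2 =>
    EE (q1 u v1) (fun x1 => EE (q2 u v2) (fun x2 => (lr u v1 v2 * phi (x1, x2))%:E))))).
Proof.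
move=> phi0; rewrite (Sum_joint5 q1 q2 W puvP (phi := fun _ _ _ x1 x2 => ((tt == tt)%:R * phi (x1, x2))%R)); last by move=> *; posr.
expand; apply: eq_Sum => u. expand; apply: eq_Sum => v1. expand; apply: eq_Sum => v2.
expand; apply: eq_Sum => x1. expand; apply: eq_Sum => x2.
by rewrite -!EFinM -lrE eqxx; congr EFin => /=; ring.
Qed.

Lemma fiber_K12 (phi : X1 * X2 -> R) u : (forall x, (0 <= phi x)%R) ->
  Sum (fun t : T => (P t * ((tu t == u)%:R * phi (tx12 t)))%:E) =
  (pU u)%:E * EE (p1 u) (fun v1 => EE (p2 u) (fun v2 =>
    EE (q1 u v1) (fun x1 => EE (q2 u v2) (fun x2 => (lr u v1 v2 * phi (x1, x2))%:E)))).
Proof.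
move=> phi0; rewrite (Sum_joint5 q1 q2 W puvP (phi := fun u' _ _ x1 x2 => ((u' == u)%:R * phi (x1, x2))%R)); last by move=> *; posr.
sum_delta u.
expand; apply: eq_Sum => v1. expand; apply: eq_Sum => v2.
expand; apply: eq_Sum => x1. expand; apply: eq_Sum => x2.
by rewrite -!EFinM -lrE eqxx; congr EFin => /=; ring.
Qed.

Lemma fiber_K1o (phi : X1 -> R) u v2 x2 : (forall x, (0 <= phi x)%R) ->
  Sum (fun t : T => (P t * (((tu t, tv2 t, tx2 t) == (u, v2, x2))%:R * phi (tx1 t)))%:E) =
  (pU u * p2 u v2 * q2 u v2 x2)%:E * EE (p1 u) (fun v1 =>
    EE (q1 u v1) (fun x1 => (lr u v1 v2 * phi x1)%:E)).
Proof.
move=> phi0; rewrite (Sum_joint5 q1 q2 W puvP (phi := fun u' v1' v2' x1' x2' =>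
  (((u', v2', x2') == (u, v2, x2))%:R * phi x1')%R)); last by move=> *; posr.
sum_delta u.
expand; apply: eq_Sum => v1. sum_delta v2.
expand; apply: eq_Sum => x1. sum_delta x2.
by rewrite -!EFinM -lrE eqxx; congr EFin => /=; ring.
Qed.

Lemma fiber_K1c (phi : X1 * X2 -> R) u v2 : (forall x, (0 <= phi x)%R) ->
  Sum (fun t : T => (P t * (((tu t, tv2 t) == (u, v2))%:R * phi (tx12 t)))%:E) =
  (pU u * p2 u v2)%:E * EE (p1 u) (fun v1 => EE (q1 u v1) (fun x1 => EE (q2 u v2) (fun x2 => (lr u v1 v2 * phi (x1, x2))%:E))).
Proof.
move=> phi0; rewrite (Sum_joint5 q1 q2 W puvP (phi := fun u' v1' v2' x1' x2' =>
  (((u', v2') == (u, v2))%:R * phi (x1', x2'))%R)); last by move=> *; posr.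
sum_delta u. expand; apply: eq_Sum => v1. sum_delta v2. expand; apply: eq_Sum => x1. expand; apply: eq_Sum => x2.
by rewrite -!EFinM -?lrE eqxx; congr EFin => /=; ring.
Qed.

Lemma fiber_K2c (phi : X1 * X2 -> R) u v1 : (forall x, (0 <= phi x)%R) ->
  Sum (fun t : T => (P t * (((tu t, tv1 t) == (u, v1))%:R * phi (tx12 t)))%:E) =
  (pU u * p1 u v1)%:E * EE (p2 u) (fun v2 => EE (q1 u v1) (fun x1 => EE (q2 u v2) (fun x2 => (lr u v1 v2 * phi (x1, x2))%:E))).
Proof.
move=> phi0; rewrite (Sum_joint5 q1 q2 W puvP (phi := fun u' v1' v2' x1' x2' =>
  (((u', v1') == (u, v1))%:R * phi (x1', x2'))%R)); last by move=> *; posr.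
sum_delta u. sum_delta v1. expand; apply: eq_Sum => v2. expand; apply: eq_Sum => x1. expand; apply: eq_Sum => x2.
by rewrite -!EFinM -?lrE eqxx; congr EFin => /=; ring.
Qed.

Lemma fiber_K2o (phi : X2 -> R) u v1 x1 : (forall x, (0 <= phi x)%R) ->
  Sum (fun t : T => (P t * (((tu t, tv1 t, tx1 t) == (u, v1, x1))%:R * phi (tx2 t)))%:E) =
  (pU u * p1 u v1 * q1 u v1 x1)%:E * EE (p2 u) (fun v2 => EE (q2 u v2) (fun x2 => (lr u v1 v2 * phi x2)%:E)).
Proof.
move=> phi0; rewrite (Sum_joint5 q1 q2 W puvP (phi := fun u' v1' v2' x1' x2' =>
  (((u', v1', x1') == (u, v1, x1))%:R * phi x2')%R)); last by move=> *; posr.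
sum_delta u. sum_delta v1. expand; apply: eq_Sum => v2. sum_delta x1. expand; apply: eq_Sum => x2.
by rewrite -!EFinM -?lrE eqxx; congr EFin => /=; ring.
Qed.

Lemma fiber_Kcc (phi : X1 * X2 -> R) u v1 v2 : (forall x, (0 <= phi x)%R) ->
  Sum (fun t : T => (P t * (((tu t, tv1 t, tv2 t) == (u, v1, v2))%:R * phi (tx12 t)))%:E) =
  (puv (u, v1, v2))%:E * EE (q1 u v1) (fun x1 => EE (q2 u v2) (fun x2 => (phi (x1, x2))%:E)).
Proof.
move=> phi0; rewrite (Sum_joint5 q1 q2 W puvP (phi := fun u' v1' v2' x1' x2' =>
  (((u', v1', v2') == (u, v1, v2))%:R * phi (x1', x2'))%R)); last by move=> *; posr.
sum_delta u. sum_delta v1. sum_delta v2. expand; apply: eq_Sum => x1. expand; apply: eq_Sum => x2.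
by rewrite -!EFinM -?lrE eqxx; congr EFin => /=; ring.
Qed.

Lemma fiber_Kc1 (phi : X1 -> R) u v1 v2 x2 : (forall x, (0 <= phi x)%R) ->
  Sum (fun t : T => (P t * (((tu t, tv1 t, tv2 t, tx2 t) == (u, v1, v2, x2))%:R * phi (tx1 t)))%:E) =
  (puv (u, v1, v2) * q2 u v2 x2)%:E * EE (q1 u v1) (fun x1 => (phi x1)%:E).
Proof.
move=> phi0; rewrite (Sum_joint5 q1 q2 W puvP (phi := fun u' v1' v2' x1' x2' =>
  (((u', v1', v2', x2') == (u, v1, v2, x2))%:R * phi x1')%R)); last by move=> *; posr.
sum_delta u. sum_delta v1. sum_delta v2. expand; apply: eq_Sum => x1. sum_delta x2.
by rewrite -!EFinM -?lrE eqxx; congr EFin => /=; ring.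
Qed.

Lemma fiber_Kc2 (phi : X2 -> R) u v1 v2 x1 : (forall x, (0 <= phi x)%R) ->
  Sum (fun t : T => (P t * (((tu t, tv1 t, tv2 t, tx1 t) == (u, v1, v2, x1))%:R * phi (tx2 t)))%:E) =
  (puv (u, v1, v2) * q1 u v1 x1)%:E * EE (q2 u v2) (fun x2 => (phi x2)%:E).
Proof.
move=> phi0; rewrite (Sum_joint5 q1 q2 W puvP (phi := fun u' v1' v2' x1' x2' =>
  (((u', v1', v2', x1') == (u, v1, v2, x1))%:R * phi x2')%R)); last by move=> *; posr.
sum_delta u. sum_delta v1. sum_delta v2. sum_delta x1. expand; apply: eq_Sum => x2.
by rewrite -!EFinM -?lrE eqxx; congr EFin => /=; ring.
Qed.

Hypothesis lr1 : forall u v2, EE (p1 u) (fun v1 => (lr u v1 v2)%:E) <= 1.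
Hypothesis lr2 : forall u v1, EE (p2 u) (fun v2 => (lr u v1 v2)%:E) <= 1.

Lemma joint_mean (F : T -> \bar R) : (forall t, 0 <= F t) ->
  EE pU (fun u => EE (p1 u) (fun v1 => EE (p2 u) (fun v2 => (lr u v1 v2)%:E *
    EE (q1 u v1) (fun x1 => EE (q2 u v2) (fun x2 => EE (W x1 x2) (fun y =>
      F (u, v1, v2, x1, x2, y)))))))
  = Sum (fun t => (P t)%:E * F t).
Proof.
move=> F0.
have P0 t : 0 <= (P t)%:E * F t.
  rewrite mule_ge0// lee_fin; case: t => [[[[[u v1] v2] x1] x2] y].
  by rewrite /P/= !(mulr_ge0, mass_ge0).
rewrite [RHS]Sum_pair// Sum_pair; last by intros; do ?(apply: Sum_ge0 => ?).
do 3 (rewrite Sum_pair; last by intros; do ?(apply: Sum_ge0 => ?)).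
have expand (A : choiceType) (p : massfn R A) (c : \bar R) (G : A -> \bar R) :
    0 <= c -> (forall a, 0 <= G a) -> c * EE p G = Sum (fun a => c * (p a)%:E * G a).
  move=> c0 G0; rewrite EEE -SumZ//; last by move=> a; rewrite mule_ge0// lee_fin mass_ge0.
  by apply: eq_Sum => a; rewrite muleA.
have L0 u v1 v2 : 0 <= (lr u v1 v2)%:E by rewrite lee_fin.
rewrite -[LHS]mul1e.
do 3 (rewrite expand; [|by do ?apply: mule_ge0 => //; rewrite ?lee_fin ?mass_ge0|
  by intros; repeat (first [apply: mule_ge0 => // | apply: ex_ge0; intros])]; apply: eq_Sum => ?).
rewrite muleA.
do 3 (rewrite expand; [|by do ?apply: mule_ge0 => //; rewrite ?lee_fin ?mass_ge0|
  by intros; repeat (first [apply: mule_ge0 => // | apply: ex_ge0; intros])]; apply: eq_Sum => ?).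
by rewrite /P /= -!EFinM -lrE mul1r.
Qed.

Lemma lr12 : EE pU (fun u => EE (p1 u) (fun v1 => EE (p2 u) (fun v2 => (lr u v1 v2)%:E))) = 1.
Proof.
have [_ <-] := joint_pmf q1 q2 W puvP.
transitivity (Sum (fun t => (P t)%:E * 1)); last by apply: eq_Sum => t; rewrite mule1.
rewrite -joint_mean//; apply: eq_ex => u; apply: eq_ex => v1; apply: eq_ex => v2.
under [in RHS]eq_ex => x1 do under eq_ex => x2 do rewrite ex_cst//.
by under [in RHS]eq_ex => x1 do rewrite ex_cst//; rewrite ex_cst// mule1.
Qed.

Let ty (t : T) : Y := t.2.

(** The ratios compare [y] with the fresh channel inputs only and leave out the fresh auxiliary
    letters, just as the informations of the region do. *)
Definition sratio (k : kind) (u : U) (v1 : V1) (v2 : V2) (x1 : X1) (x2 : X2) (y : Y) : R :=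
  match k with
  | K0 => cond_ratio P tx12 ty (fun=> tt) (x1, x2) y tt
  | K12 => cond_ratio P tx12 ty tu (x1, x2) y u
  | K1c => cond_ratio P tx12 ty (fun t => (tu t, tv2 t)) (x1, x2) y (u, v2)
  | K1o => cond_ratio P tx1 ty (fun t => (tu t, tv2 t, tx2 t)) x1 y (u, v2, x2)
  | K2c => cond_ratio P tx12 ty (fun t => (tu t, tv1 t)) (x1, x2) y (u, v1)
  | K2o => cond_ratio P tx2 ty (fun t => (tu t, tv1 t, tx1 t)) x2 y (u, v1, x1)
  | Kcc => cond_ratio P tx12 ty (fun t => (tu t, tv1 t, tv2 t)) (x1, x2) y (u, v1, v2)
  | Kc1 => cond_ratio P tx1 ty (fun t => (tu t, tv1 t, tv2 t, tx2 t)) x1 y (u, v1, v2, x2)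
  | Kc2 => cond_ratio P tx2 ty (fun t => (tu t, tv1 t, tv2 t, tx1 t)) x2 y (u, v1, v2, x1)
  end.

Lemma sratio_ge0 k u v1 v2 x1 x2 y : (0 <= sratio k u v1 v2 x1 x2 y)%R.
Proof. by case: k; exact: (cond_ratio_ge0 (joint_pmf q1 q2 W puvP)). Qed.

Ltac null := do ?(apply: ex_le1 => ?; first by [nneg; rewrite mulr0|nneg; rewrite lee_fin mulr0|rewrite lee_fin]);
  rewrite ?mulr0 lee_fin.

Lemma sratio_ok k : ratio_ok pU p1 p2 q1 q2 lr k (sratio k).
Proof.
have PP := joint_pmf q1 q2 W puvP.
have l0 u v1 v2 : 0 <= (lr u v1 v2)%:E by rewrite lee_fin.
case: k => /=.
- move=> y; apply: (@fiber_le1 _ _ _ PP _ _ _ tx12 ty (fun=> tt) y tt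
    (fun phi => EE (pU) (fun u => EE (p1 u) (fun v1 => EE (p2 u) (fun v2 => EE (q1 u v1) (fun x1 => EE (q2 u v2) (fun x2 => (lr u v1 v2 * phi (x1, x2))%:E)))))) 1%R) => [|phi phi0||].
  + by rewrite ?(mulr_ge0, mass_ge0)//; case: puvP.
  + exact: fiber_K0.
  + rewrite -lr12 le_eqVlt; apply/orP; left; apply/eqP.
    apply: eq_ex => u; apply: eq_ex => v1; apply: eq_ex => v2; rewrite mulr1.
    by under eq_ex => x1 do rewrite ex_cst//; rewrite ex_cst.
  + by null.
- move=> u y; apply: (@fiber_le1 _ _ _ PP _ _ _ tx12 ty tu y (u)
    (fun phi => EE (p1 u) (fun v1 => EE (p2 u) (fun v2 => EE (q1 u v1) (fun x1 => EE (q2 u v2) (fun x2 => (lr u v1 v2 * phi (x1, x2))%:E))))) (pU u)) => [|phi phi0||].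
  + by rewrite ?(mulr_ge0, mass_ge0)//; case: puvP.
  + exact: fiber_K12.
  + apply: ex_le1 => v1; first by nneg; rewrite lee_fin mulr1.
    under eq_ex => v2 do under eq_ex => x1 do rewrite mulr1 ex_cst//.
    by under eq_ex => v2 do rewrite ex_cst//; exact: lr2.
  + by null.
- move=> u v2 y; apply: (@fiber_le1 _ _ _ PP _ _ _ tx12 ty (fun t => (tu t, tv2 t)) y (u, v2)
    (fun phi => EE (p1 u) (fun v1 => EE (q1 u v1) (fun x1 => EE (q2 u v2) (fun x2 => (lr u v1 v2 * phi (x1, x2))%:E)))) (pU u * p2 u v2)%R) => [|phi phi0||].
  + by rewrite ?(mulr_ge0, mass_ge0)//; case: puvP.
  + exact: fiber_K1c.
  + under eq_ex => v1 do under eq_ex => x1 do rewrite mulr1 ex_cst//.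
    by under eq_ex => v1 do rewrite ex_cst//; exact: lr1.
  + by null.
- move=> u v2 x2 y; apply: (@fiber_le1 _ _ _ PP _ _ _ tx1 ty (fun t => (tu t, tv2 t, tx2 t)) y (u, v2, x2)
    (fun phi => EE (p1 u) (fun v1 => EE (q1 u v1) (fun x1 => (lr u v1 v2 * phi x1)%:E))) (pU u * p2 u v2 * q2 u v2 x2)%R) => [|phi phi0||].
  + by rewrite ?(mulr_ge0, mass_ge0)//; case: puvP.
  + exact: fiber_K1o.
  + by under eq_ex => v1 do rewrite mulr1 ex_cst//; exact: lr1.
  + by null.
- move=> u v1 y; apply: (@fiber_le1 _ _ _ PP _ _ _ tx12 ty (fun t => (tu t, tv1 t)) y (u, v1)
    (fun phi => EE (p2 u) (fun v2 => EE (q1 u v1) (fun x1 => EE (q2 u v2) (fun x2 => (lr u v1 v2 * phi (x1, x2))%:E)))) (pU u * p1 u v1)%R) => [|phi phi0||].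
  + by rewrite ?(mulr_ge0, mass_ge0)//; case: puvP.
  + exact: fiber_K2c.
  + under eq_ex => v2 do under eq_ex => x1 do rewrite mulr1 ex_cst//.
    by under eq_ex => v2 do rewrite ex_cst//; exact: lr2.
  + by null.
- move=> u v1 x1 y; apply: (@fiber_le1 _ _ _ PP _ _ _ tx2 ty (fun t => (tu t, tv1 t, tx1 t)) y (u, v1, x1)
    (fun phi => EE (p2 u) (fun v2 => EE (q2 u v2) (fun x2 => (lr u v1 v2 * phi x2)%:E))) (pU u * p1 u v1 * q1 u v1 x1)%R) => [|phi phi0||].
  + by rewrite ?(mulr_ge0, mass_ge0)//; case: puvP.
  + exact: fiber_K2o.
  + by under eq_ex => v2 do rewrite mulr1 ex_cst//; exact: lr2.
  + by null.
- move=> u v1 v2 y; apply: (@fiber_le1 _ _ _ PP _ _ _ tx12 ty (fun t => (tu t, tv1 t, tv2 t)) y (u, v1, v2)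
    (fun phi => EE (q1 u v1) (fun x1 => EE (q2 u v2) (fun x2 => (phi (x1, x2))%:E))) (puv (u, v1, v2))) => [|phi phi0||].
  + by rewrite ?(mulr_ge0, mass_ge0)//; case: puvP.
  + exact: fiber_Kcc.
  + by null.
  + by null.
- move=> u v1 v2 x2 y; apply: (@fiber_le1 _ _ _ PP _ _ _ tx1 ty (fun t => (tu t, tv1 t, tv2 t, tx2 t)) y (u, v1, v2, x2)
    (fun phi => EE (q1 u v1) (fun x1 => (phi x1)%:E)) (puv (u, v1, v2) * q2 u v2 x2)%R) => [|phi phi0||].
  + by rewrite ?(mulr_ge0, mass_ge0)//; case: puvP.
  + exact: fiber_Kc1.
  + by rewrite ex_cst.
  + by null.
- move=> u v1 v2 x1 y; apply: (@fiber_le1 _ _ _ PP _ _ _ tx2 ty (fun t => (tu t, tv1 t, tv2 t, tx1 t)) y (u, v1, v2, x1)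
    (fun phi => EE (q2 u v2) (fun x2 => (phi x2)%:E)) (puv (u, v1, v2) * q1 u v1 x1)%R) => [|phi phi0||].
  + by rewrite ?(mulr_ge0, mass_ge0)//; case: puvP.
  + exact: fiber_Kc2.
  + by rewrite ex_cst.
  + by null.
Qed.

End Fibers.

(** * Nonnegativity of divergence and its equality case *)

Section Divergence.
Context (R : realType) (T : choiceType) (P : massfn R T) (r : T -> R).
Local Open Scope ereal_scope.
Hypothesis r_ge0 : forall t, (0 <= r t)%R.
Hypothesis r_gt0 : forall t, P t != 0%R -> (0 < r t)%R.
Hypothesis rV : Sum (fun t => (P t * (r t)^-1)%:E) <= 1.

Let ln2 : (0 < ln 2 :> R)%R. Proof. by rewrite ln_gt0// ltr1n. Qed.
Let c : R := ((ln 2)^-1)%R.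
Let c0 : (0 < c)%R. Proof. by rewrite invr_gt0. Qed.

Lemma ln_ge_1V (x : R) : (0 < x)%R -> (1 - x^-1 <= ln x)%R.
Proof.
move=> x0; have y0 : (0 < x^-1)%R by rewrite invr_gt0.
have h : (-1 < x^-1 - 1)%R by lra.
have := le_ln1Dx h; rewrite (_ : 1 + (x^-1 - 1) = x^-1)%R; last by ring.
by rewrite lnV// => h'; lra.
Qed.

Lemma ln_eq_1V (x : R) : (0 < x)%R -> ln x = (1 - x^-1)%R -> x = 1%R.
Proof.
move=> x0 h; have [h0|h0] := eqVneq (- ln x)%R 0%R.
  by apply: ln_inj; rewrite ?posrE// ln1; lra.
have := expR_gt1Dx h0; rewrite expRN lnK// h => h'.
by exfalso; lra.
Qed.

Let f t : R := (P t * log2 (r t))%R.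
Let fp t := Num.max (f t) 0%R.
Let fm t := Num.max (- f t)%R 0%R.

(** This is [ln r >= 1 - 1 / r] times [P t / ln 2], with the negative terms moved across so that
    both sides can be summed in the extended reals. The equality case is recorded for
    [divergence_eq0]. *)
Lemma log2_split t :
  (fm t + c * P t <= fp t + c * (P t * (r t)^-1) ?= iff (P t == 0%R) || (r t == 1%R))%R.
Proof.
have hmax : (fp t - fm t = f t)%R.
  by rewrite /fp /fm; case: (lerP (f t) 0) => h1; case: (lerP (- f t) 0) => h2 //; lra.
have [Pt|Pt] := eqVneq (P t) 0%R.
  have f0 : f t = 0%R by rewrite /f Pt mul0r.
  by rewrite /fp /fm f0 oppr0 Pt !(mul0r, mulr0); split; rewrite ?lexx ?eqxx.
have rt := r_gt0 Pt.
have Ef : f t = (c * (P t * ln (r t)))%R by rewrite /f /log2 /c; ring.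
have Pt0 : (0 < P t)%R by rewrite lt_def Pt mass_ge0.
have E : (fp t + c * (P t * (r t)^-1) - (fm t + c * P t) = c * P t * (ln (r t) - (1 - (r t)^-1)))%R.
  rewrite (_ : fp t = fm t + f t)%R; last by rewrite -hmax; ring.
  by rewrite Ef; ring.
split.
  by rewrite -subr_ge0 E mulr_ge0 ?subr_ge0 ?ln_ge_1V// mulr_ge0// ltW.
rewrite eq_sym -subr_eq0 E mulf_eq0 mulf_eq0 (negbTE Pt) (gt_eqF c0) /= subr_eq0.
apply/eqP/eqP => [|->]; first exact: ln_eq_1V.
by rewrite ln1 invr1 subrr.
Qed.

Let Sp := Sum (fun t => (fp t)%:E).
Let Sm := Sum (fun t => (fm t)%:E).
Let fp0 t : 0 <= (fp t)%:E. Proof. by rewrite lee_fin le_max lexx orbT. Qed.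
Let fm0 t : 0 <= (fm t)%:E. Proof. by rewrite lee_fin le_max lexx orbT. Qed.
Let V0 t : 0 <= (c * (P t * (r t)^-1))%:E.
Proof.
rewrite lee_fin; apply: mulr_ge0; first exact: ltW.
by rewrite mulr_ge0 ?mass_ge0 ?invr_ge0.
Qed.
Let cP0 t : 0 <= (c * P t)%:E. Proof. by rewrite lee_fin mulr_ge0 ?mass_ge0// ltW. Qed.

Let SV : Sum (fun t => (c * (P t * (r t)^-1))%:E) <= c%:E.
Proof.
under eq_Sum do rewrite EFinM.
rewrite SumZ; [|by rewrite lee_fin ltW|
  by move=> t; rewrite lee_fin mulr_ge0 ?mass_ge0 ?invr_ge0].
by rewrite -[leRHS]mule1 lee_wpmul2l// lee_fin ltW.
Qed.

Let Sc : Sum (fun t => (c * P t)%:E) = c%:E.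
Proof.
under eq_Sum do rewrite EFinM.
rewrite SumZ; [|by rewrite lee_fin ltW|by move=> t; rewrite lee_fin mass_ge0].
by rewrite mass_sum1 mule1.
Qed.

Lemma divergence_neg_fin : exists2 s : R, (0 <= s)%R & Sm = s%:E.
Proof.
have Sm0 : 0 <= Sm by exact: Sum_ge0.
have : Sm <= c%:E.
  apply: le_trans SV; apply: le_Sum => t; rewrite lee_fin.
  have := log2_split t; rewrite /fp /fm => -[+ _].
  have cP : (0 <= c * P t)%R by rewrite -lee_fin.
  have V : (0 <= c * (P t * (r t)^-1))%R by rewrite -lee_fin.
  by case: (lerP (f t) 0) => h1; case: (lerP (- f t) 0) => h2 //; lra.
by case: Sm Sm0 => [s| |]// s0 _; exists s.
Qed.

Lemma divergence_ge0 : 0 <= signed_sum f.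
Proof.
have [s s0 Es] := divergence_neg_fin.
rewrite /signed_sum -/Sp -/Sm Es.
have : Sm + c%:E <= Sp + c%:E.
  apply: (@le_trans _ _ (Sp + Sum (fun t => (c * (P t * (r t)^-1))%:E))); last exact: leeD.
  rewrite -Sc -!SumD//; apply: le_Sum => t; rewrite -!EFinD lee_fin.
  by case: (log2_split t).
by rewrite leeD2rE// Es sube_ge0.
Qed.

(** The slack in [log2_split] is nonnegative and sums to at most 0, so it vanishes at every
    point. *)
Lemma divergence_eq0 : signed_sum f <= 0 -> forall t, P t != 0%R -> r t = 1%R.
Proof.
have [s s0 Es] := divergence_neg_fin.
rewrite /signed_sum -/Sp -/Sm Es sube_le0 => hle t Pt.
pose d t := (fp t + c * (P t * (r t)^-1) - (fm t + c * P t))%R.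
have d0 x : 0 <= (d x)%:E by rewrite lee_fin subr_ge0; case: (log2_split x).
have : Sum (fun t => (d t)%:E) + (s%:E + c%:E) <= s%:E + c%:E.
  rewrite -{1}Es -Sc -!SumD//; last by move=> x; rewrite adde_ge0.
  rewrite Sc; apply: (@le_trans _ _ (Sp + Sum (fun t => (c * (P t * (r t)^-1))%:E))).
    rewrite -SumD//; apply: le_Sum => x; rewrite -!EFinD lee_fin /d.
    by rewrite le_eqVlt; apply/orP; left; apply/eqP; ring.
  by apply: leeD.
rewrite -[X in _ <= X -> _]add0e leeD2rE// => Sd.
have : (d t)%:E <= 0.
  apply: le_trans Sd; rewrite (esumID [set t] setT)// setTI esum_set1// leeDl//.
  exact: esum_ge0.
rewrite lee_fin subr_le0 => hd; have [h1 h2] := log2_split t.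
have /eqP : (fm t + c * P t == fp t + c * (P t * (r t)^-1))%R by rewrite eq_le h1.
by move/eqP; rewrite h2 (negbTE Pt) => /eqP.
Qed.

(** Below [gam] both parts are finite and the sum may change sign. The one-sided law of large
    numbers for [r^-1] then bounds [r] from above. *)
Lemma divergence_flip (gam : R) : signed_sum f < gam%:E ->
  (- gam)%:E < signed_sum (fun t => P t * log2 (r t)^-1)%R.
Proof.
have [s s0 Es] := divergence_neg_fin.
rewrite /signed_sum -/Sp -/Sm Es.
have h t : (P t * log2 (r t)^-1 = - f t)%R.
  have [Pt|Pt] := eqVneq (P t) 0%R; first by rewrite /f Pt !mul0r oppr0.
  by rewrite /f /log2 lnV ?posrE ?r_gt0//; ring.
under [X in _ -> _ < X - _]eq_Sum do rewrite h.
under [X in _ -> _ < _ - X]eq_Sum do rewrite h opprK.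
rewrite -/Sp -/Sm Es; have := Sum_ge0 fp0; rewrite -/Sp.
by case: Sp => [p| |]//= _; rewrite -?EFinB ?lte_fin; lra.
Qed.

End Divergence.

Lemma ratio_ok_one (R : realType) (U V1 V2 X1 X2 Y : choiceType)
    (pU : massfn R U) (p1 : U -> massfn R V1) (p2 : U -> massfn R V2)
    (q1 : U -> V1 -> massfn R X1) (q2 : U -> V2 -> massfn R X2) k :
  ratio_ok pU p1 p2 q1 q2 (fun _ _ _ => 1) k (fun _ _ _ _ _ (_ : Y) => 1).
Proof.
have h : (0 <= (1 * 1 : R)%:E)%E by rewrite mulr1.
by case: k => /= *; do ?(apply: ex_le1 => *; first by nneg); rewrite ?mulr1.
Qed.

Lemma ind_le_kinds (R : realType) (F : kind -> bool) k :
  (ind R (F k) <= \sum_(j <- kinds) ind R (F j))%E.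
Proof.
rewrite sumEFin lee_fin /kinds !big_cons big_nil.
have h j : 0 <= (F j)%:R :> R by [].
have := h K0; have := h K12; have := h K1c; have := h K1o; have := h K2c; have := h K2o.
have := h Kcc; have := h Kc1; have := h Kc2.
by case: k => *; lra.
Qed.

(** * Codes for the facilitator *)

Section Active.
Context (R : realType) (U V1 V2 X1 X2 Y : choiceType).
Variables (puv : U * V1 * V2 -> R) (q1 : U -> V1 -> massfn R X1) (q2 : U -> V2 -> massfn R X2).
Variable W : X1 -> X2 -> massfn R Y.
Hypothesis puvP : is_pmf puv.
Local Open Scope ereal_scope.
Let T := (U * V1 * V2 * X1 * X2 * Y)%type.
Let P : massfn R T := MassFn (joint_pmf q1 q2 W puvP).
Let pU := sU q1 q2 W puvP.
Let p1 := s1 q1 q2 W puvP.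
Let p2 := s2 q1 q2 W puvP.
Let lr := slr puv q1 q2 W.
Let sr := sratio puv q1 q2 W.
Let lr_t (t : T) := lr t.1.1.1.1.1 t.1.1.1.1.2 t.1.1.1.2.
Let sr_t k (t : T) := sr k t.1.1.1.1.1 t.1.1.1.1.2 t.1.1.1.2 t.1.1.2 t.1.2 t.2.

Let lr0 u v1 v2 : (0 <= lr u v1 v2)%R. Proof. exact: slr_ge0. Qed.
Let sr0 k u v1 v2 x1 x2 y : (0 <= sr k u v1 v2 x1 x2 y)%R. Proof. exact: sratio_ge0. Qed.
Let lrE u v1 v2 : (pU u * p1 u v1 * p2 u v2 * lr u v1 v2 = puv (u, v1, v2))%R.
Proof. exact: slrE. Qed.
Let lr1 u v2 : EE (p1 u) (fun v1 => (lr u v1 v2)%:E) <= 1.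
Proof. exact: cond_ratio_mean. Qed.
Let lr2 u v1 : EE (p2 u) (fun v2 => (lr u v1 v2)%:E) <= 1.
Proof.
under eq_ex => v2 do rewrite /lr /slr cond_ratio_sym.
exact: cond_ratio_mean.
Qed.
Let lr12' : EE pU (fun u => EE (p1 u) (fun v1 => EE (p2 u) (fun v2 => (lr u v1 v2)%:E))) = 1.
Proof. exact: (lr12 q1 q2 W puvP lr0 lrE). Qed.
Let sr_ok k : ratio_ok pU p1 p2 q1 q2 lr k (sr k).
Proof. exact: (sratio_ok q1 q2 W puvP lr0 lrE lr1 lr2). Qed.

Lemma lr_t_gt0 t : P t != 0%R -> (0 < lr_t t)%R.
Proof. exact: (cond_ratio_gt0 (joint_pmf q1 q2 W puvP)). Qed.

Lemma sr_t_gt0 k t : P t != 0%R -> (0 < sr_t k t)%R.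
Proof. by case: k => Pt; exact: (cond_ratio_gt0 (joint_pmf q1 q2 W puvP) _ _ _ Pt). Qed.

(** Back under the law with independent v1 and v2, this is the mean of [lr * lr^-1], the indicator
    of [lr != 0]. *)
Lemma lr_tV : Sum (fun t => (P t * (lr_t t)^-1)%:E) <= 1.
Proof.
under eq_Sum do rewrite EFinM.
have l0 u v1 v2 : 0 <= ((lr u v1 v2)^-1)%:E by rewrite lee_fin invr_ge0.
rewrite -(@joint_mean _ _ _ _ _ _ _ puv q1 q2 W puvP pU p1 p2 lr lr0 lrE (fun t => ((lr_t t)^-1)%:E)); last by move=> t; exact: l0.
have m0 u v1 v2 : 0 <= (lr u v1 v2)%:E * (((lr u v1 v2)^-1)%:E) by rewrite mule_ge0// lee_fin.
apply: ex_le1 => u.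
  by nneg; rewrite mule_ge0 ?lee_fin//; nneg; exact: l0.
apply: ex_le1 => v1.
  by nneg; rewrite mule_ge0 ?lee_fin//; nneg; exact: l0.
apply: ex_le1 => v2.
  by rewrite mule_ge0 ?lee_fin//; nneg; exact: l0.
rewrite /lr_t /=.
under eq_ex => x1 do under eq_ex => x2 do rewrite ex_cst//.
under eq_ex => x1 do rewrite ex_cst//.
rewrite ex_cst// -EFinM lee_fin.
by have [->|h] := eqVneq (lr u v1 v2) 0%R; rewrite ?mul0r ?ler01// mulfV.
Qed.

Section Block.
Variables (n m : nat).

(* Letters from the [m]-th on are ignored by facilitator and decoder. *)
Definition lrf (i : 'I_n) u v1 v2 : R := if (i < m)%N then lr u v1 v2 else 1%R.
Definition srf k (i : 'I_n) u v1 v2 x1 x2 y : R := if (i < m)%N then sr k u v1 v2 x1 x2 y else 1%R.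

Lemma lrf_ge0 i u v1 v2 : (0 <= lrf i u v1 v2)%R. Proof. by rewrite /lrf; case: ifP. Qed.
Lemma srf_ge0 k i u v1 v2 x1 x2 y : (0 <= srf k i u v1 v2 x1 x2 y)%R.
Proof. by rewrite /srf; case: ifP. Qed.

Lemma lrf1 i u v2 : EE (p1 u) (fun v1 => (lrf i u v1 v2)%:E) <= 1.
Proof. by rewrite /lrf; case: (i < m)%N => //; rewrite ex_cst. Qed.
Lemma lrf2 i u v1 : EE (p2 u) (fun v2 => (lrf i u v1 v2)%:E) <= 1.
Proof. by rewrite /lrf; case: (i < m)%N => //; rewrite ex_cst. Qed.

Lemma lrf12 i : aux1 pU p1 p2 (elr lrf i) = 1.
Proof.
rewrite /elr /lrf; case: (i < m)%N; last by rewrite ex_cst.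
exact: lr12'.
Qed.

Lemma srf_ok k i : ratio_ok pU p1 p2 q1 q2 (lrf i) k (srf k i).
Proof.
rewrite /lrf /srf; case: (i < m)%N; [exact: sr_ok|exact: ratio_ok_one].
Qed.

Let J := jointn q1 q2 W lrf_ge0 lrf12.
Let e := joint1 q1 q2 W lrf_ge0 lrf12.
Let coord (o : n.-tuple U * n.-tuple V1 * n.-tuple V2 * n.-tuple X1 * n.-tuple X2 * n.-tuple Y) i : T :=
  (coord3 o.1.1.1 i, tnth o.1.1.2 i, tnth o.1.2 i, tnth o.2 i).

Lemma like_joint1 : like P m e.
Proof.
move=> i im G G0; rewrite EEE -(joint_mean q1 q2 W puvP lr0 lrE)//.
rewrite /e /joint1 /pairx /= /elr /lrf im.
by do 3 (apply: eq_ex => ?).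
Qed.

Let nratioE k o : (\prod_(i < n | (i < m)%N) sr_t k (coord o i))%R =
  nratio (srf k) o.1.1.1.1.1 o.1.1.1.1.2 o.1.1.1.2 o.1.1.2 o.1.2 o.2.
Proof. by rewrite big_mkcond. Qed.

Let nlrE o : (\prod_(i < n | (i < m)%N) lr_t (coord o i))%R =
  nlr lrf o.1.1.1.1.1 o.1.1.1.1.2 o.1.1.1.2.
Proof. by rewrite big_mkcond. Qed.

Lemma below_blockE (th : R) k :
  joint (nU n pU) (n1 p1) (n2 p2) (nq1 q1) (nq2 q2) (nW W) (nlr lrf)
    (fun u v1 v2 x1 x2 y => ind R (~~ (th <= nratio (srf k) u v1 v2 x1 x2 y)%R)) =
  J (fun o => ind R (~~ (th <= \prod_(i < n | (i < m)%N) sr_t k (coord o i))%R)).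
Proof. by rewrite (jointnE _ _ _ lrf_ge0 lrf12); apply: eq_ex => o; rewrite nratioE. Qed.

Lemma lr_blockE (Q : pred R) :
  joint (nU n pU) (n1 p1) (n2 p2) (nq1 q1) (nq2 q2) (nW W) (nlr lrf)
    (fun u v1 v2 _ _ _ => ind R (Q (nlr lrf u v1 v2))) =
  J (fun o => ind R (Q (\prod_(i < n | (i < m)%N) lr_t (coord o i))%R)).
Proof. by rewrite (jointnE _ _ _ lrf_ge0 lrf12); apply: eq_ex => o; rewrite nlrE. Qed.

Variables (A1 A2 B1 B2 C1 C2 Z1 Z2 : finType).
Variables (w0 : msg A1 A2 B1 B2 C1 C2) (z0 : Z1 * Z2).
Let M : R := #|{: Z1 * Z2}|%:R.
Variables (lam Lam : R) (theta : kind -> R) (d1 d2 miss eta : R).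
Hypotheses (lam_gt0 : (0 < lam)%R) (Lam_ge1 : (1 <= Lam)%R) (theta_gt0 : forall k, (0 < theta k)%R).
Hypothesis miss_gt0 : (0 < miss)%R.
Hypothesis lr_typ : joint (nU n pU) (n1 p1) (n2 p2) (nq1 q1) (nq2 q2) (nW W) (nlr lrf)
  (fun u v1 v2 _ _ _ => ind R (~~ (lam <= nlr lrf u v1 v2 <= Lam)%R)) <= d1%:E.
Hypothesis r_typ : forall k, joint (nU n pU) (n1 p1) (n2 p2) (nq1 q1) (nq2 q2) (nW W) (nlr lrf)
  (fun u v1 v2 x1 x2 y => ind R (~~ (theta k <= nratio (srf k) u v1 v2 x1 x2 y)%R)) <= d2%:E.
Let cb k : R := ((lam * theta k)^-1)%R.
Let cc k : R := ((theta k)^-1)%R.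
Hypothesis eta_gt : ((Lam - 1) / M + 2 * (d1 + (9 * d2) / miss) + miss +
  confusion_count A1 A2 B1 B2 C1 C2 Z1 Z2 (cb K0) (cb K12) (cb K1c) (cb K1o) (cb K2c)
    (cb K2o) (cc Kcc) (cc Kc1) (cc Kc2) lam^-1 < eta)%R.

Lemma block_code :
  exists D T0 (c : codebook (n.-tuple U) (n.-tuple V1) (n.-tuple V2) (n.-tuple X1)
                    (n.-tuple X2) A1 A2 B1 B2 C1 C2 Z1 Z2),
  \sum_w ((#|{: msg A1 A2 B1 B2 C1 C2}|%:R)^-1)%:E * err (nW W) D T0 w0 z0 c w < eta%:E.
Proof.
have [|||||||c hc] := @one_shot R _ _ _ _ _ _ (nU n pU) (n1 p1) (n2 p2) (nq1 q1) (nq2 q2)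
  (nW W) (nlr lrf) _ (fun k => nratio (srf k)) lam Lam theta _ _ lam_gt0 Lam_ge1 theta_gt0
  A1 A2 B1 B2 C1 C2 Z1 Z2 w0 z0 _ _ _ d1 (9 * d2)%R miss eta miss_gt0 lr_typ _ eta_gt.
- by move=> *; apply: nlr_ge0; exact: lrf_ge0.
- by move=> k *; apply: prodr_ge0 => i _; exact: srf_ge0.
- by move=> k; apply: nratio_ok; [exact: lrf_ge0|exact: srf_ge0|exact: srf_ok].
- by apply: nlr1; [exact: lrf_ge0|exact: lrf1].
- by apply: nlr2; [exact: lrf_ge0|exact: lrf2].
- exact: (enlr1 lrf_ge0 lrf12).
- rewrite (jointnE _ _ _ lrf_ge0 lrf12).
  (* Union bound over the nine ratios, the origin of the factor 9 in [eta_gt]. *)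
  apply: (@le_trans _ _ (jointn q1 q2 W lrf_ge0 lrf12 (fun o => \sum_(k <- kinds)
    ind R (~~ (theta k <= nratio (srf k) o.1.1.1.1.1 o.1.1.1.1.2 o.1.1.1.2 o.1.1.2 o.1.2 o.2)%R)))).
    apply: ex_le => o; first exact: ind_ge0.
    have s0 (s : seq kind) (F : kind -> bool) : 0 <= \sum_(k <- s) ind R (F k).
      by apply: sume_ge0 => *; exact: ind_ge0.
    rewrite /above; case: asboolP => [_|]; first exact: s0.
    move/existsNP => [k /negP hk].
    apply: le_trans (@ind_le_kinds R (fun k => ~~ (theta k <= nratio (srf k) o.1.1.1.1.1
      o.1.1.1.1.2 o.1.1.1.2 o.1.1.2 o.1.2 o.2)%R) k).
    by rewrite hk.
  rewrite ex_sum; last by move=> *; exact: ind_ge0.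
  apply: (@le_trans _ _ (\sum_(k <- kinds) d2%:E)).
    apply: lee_sum => k _; apply: le_trans (r_typ k).
    by rewrite (jointnE _ _ _ lrf_ge0 lrf12).
  by rewrite sumEFin lee_fin /kinds !big_cons big_nil; lra.
by eexists; eexists; exists c; exact: hc.
Qed.

End Block.

Lemma ratio_typical k (gam eps : R) :
  gam%:E < signed_sum (fun t => P t * log2 (sr_t k t))%R -> (0 < eps)%R ->
  exists M, forall n m, (M <= m)%N -> (m <= n)%N ->
  joint (nU n pU) (n1 p1) (n2 p2) (nq1 q1) (nq2 q2) (nW W) (nlr (@lrf n m))
    (fun u v1 v2 x1 x2 y =>
      ind R (~~ (2 `^ (m%:R * gam) <= nratio (@srf n m k) u v1 v2 x1 x2 y)%R)) <= eps%:E.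
Proof.
move=> hg eps0; have [M hM] := LLN_ratio (@sr_t_gt0 k) hg eps0.
exists M => n m Mm mn; rewrite below_blockE.
exact: (hM n m _ _ _ _ Mm mn (indep_joint _ _ _ _ _) (@like_joint1 n m)).
Qed.

(** The upper threshold is a lower threshold for the inverse density, and each side receives half of
    [eps]. Here the information has to be finite, unlike in [ratio_typical]. *)
Lemma lr_typical (a b eps : R) :
  a%:E < signed_sum (fun t => P t * log2 (lr_t t))%R ->
  signed_sum (fun t => P t * log2 (lr_t t))%R < b%:E -> (0 < eps)%R ->
  exists M, forall n m, (M <= m)%N -> (m <= n)%N ->
  joint (nU n pU) (n1 p1) (n2 p2) (nq1 q1) (nq2 q2) (nW W) (nlr (@lrf n m))
    (fun u v1 v2 _ _ _ =>
      ind R (~~ (2 `^ (m%:R * a) <= nlr (@lrf n m) u v1 v2 <= 2 `^ (m%:R * b))%R)) <= eps%:E.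
Proof.
move=> ha hb eps0; have e20 : (0 < eps / 2)%R by rewrite divr_gt0.
have hflip : (- b)%:E < signed_sum (fun t => P t * log2 (lr_t t)^-1)%R.
  by apply: (divergence_flip _ lr_t_gt0 lr_tV hb) => t; exact: lr0.
have [M hM] := LLN_ratio lr_t_gt0 ha e20.
have rV t : P t != 0%R -> (0 < (lr_t t)^-1)%R by rewrite invr_gt0; exact: lr_t_gt0.
have [M' hM'] := LLN_ratio rV hflip e20.
exists (maxn M M') => n m; rewrite geq_max => /andP[Mm M'm] mn.
rewrite (@lr_blockE n m (fun x => ~~ (2 `^ (m%:R * a) <= x <= 2 `^ (m%:R * b))%R)).
rewrite (_ : eps%:E = (eps / 2)%:E + (eps / 2)%:E); last by rewrite -EFinD; congr EFin; lra.
apply: le_trans (leeD (hM n m _ _ _ _ Mm mn (indep_joint _ _ _ _ _) (@like_joint1 n m))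
  (hM' n m _ _ _ _ M'm mn (indep_joint _ _ _ _ _) (@like_joint1 n m))).
rewrite -exD; [|by move=> ?; exact: ind_ge0..].
apply: ex_le => o; first exact: ind_ge0.
rewrite negb_and prodfV.
set x := (\prod_(i < n | _) _)%R.
have x0 : (0 <= x)%R by apply: prodr_ge0 => i _; exact: lr0.
rewrite -EFinD lee_fin -natrD ler_nat.
case: (2 `^ (m%:R * a) <= x)%R => //=.
have [//|hx] := lerP x (2 `^ (m%:R * b))%R.
suff -> : (2 `^ (m%:R * - b) <= x^-1)%R = false by [].
have b0 : (0 < 2 `^ (m%:R * b) :> R)%R by rewrite powR_gt0.
have xp : (0 < x)%R := lt_trans b0 hx.
by apply/negbTE; rewrite -ltNge mulrN powRN ltf_pV2 ?posrE.
Qed.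

(** Almost surely all [m] letters lie in the support, where the density is 1, so both thresholds can
    be 1 at every block length. *)
Lemma lr_typical_one (eps : R) : (forall t, P t != 0%R -> lr_t t = 1%R) -> (0 <= eps)%R ->
  forall n m,
  joint (nU n pU) (n1 p1) (n2 p2) (nq1 q1) (nq2 q2) (nW W) (nlr (@lrf n m))
    (fun u v1 v2 _ _ _ => ind R (~~ (1 <= nlr (@lrf n m) u v1 v2 <= 1)%R)) <= eps%:E.
Proof.
move=> h1 eps0 n m.
rewrite (@lr_blockE n m (fun x => ~~ (1 <= x <= 1)%R)).
apply: (@le_trans _ _ 0); last by rewrite lee_fin.
rewrite -(null_coord (indep_joint _ _ _ (@lrf_ge0 n m) (@lrf12 n m)) (@like_joint1 n m)).
apply: ex_le => o; first exact: ind_ge0.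
have [/existsP[i /andP[im Pi]]|/existsPn hP] := boolP [exists i : 'I_n, (i < m)%N &&
    (P (coord3 o.1.1.1 i, tnth o.1.1.2 i, tnth o.1.2 i, tnth o.2 i) == 0%R)].
  rewrite [leRHS](bigD1 i)//= Pi; apply: (@le_trans _ _ (ind R true)).
    by rewrite lee_fin lern1 leq_b1.
  by rewrite leeDl// sume_ge0// => *; exact: ind_ge0.
rewrite big1 ?lexx => [|i im]; first by apply: sume_ge0 => *; exact: ind_ge0.
by apply: h1; have := hP i; rewrite im.
Qed.

End Active.

(** * From a codebook to a code with facilitator *)

Section CodeOfCodebook.
Context (R : realType).

Lemma Sum_fin (F : finType) (f : F -> \bar R) : (forall t, 0 <= f t)%E ->
  Sum f = (\sum_t f t)%E.
Proof.
move=> f0; rewrite esum_fset; [|exact: finite_finset|by []].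
rewrite fsbig_finite; last exact: finite_finset.
rewrite (perm_big (index_enum F)) //; apply: uniq_perm; rewrite ?index_enum_uniq//.
  exact: finmap.fset_uniq.
by move=> x; rewrite mem_index_enum in_fset_set; [rewrite in_setT|exact: finite_finset].
Qed.

Definition embed (F : finType) N (h : (#|F| <= N)%N) (x : F) : 'I_N := widen_ord h (enum_rank x).
Definition unembed (F : finType) N (x0 : F) (j : 'I_N) : F := nth x0 (enum F) j.

Lemma embedK (F : finType) N (h : (#|F| <= N)%N) x0 : cancel (embed h) (unembed x0).
Proof. by move=> x; rewrite /unembed /= nth_enum_rank. Qed.

Context (U V1 V2 X1 X2 Y : choiceType) (n : nat) (W : X1 -> X2 -> Y -> R).
Hypothesis hW : is_mac W.
Definition mac_mass (x1 : X1) (x2 : X2) : massfn R Y := MassFn (hW x1 x2).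
Variables (A1 A2 B1 B2 C1 C2 Z1 Z2 : finType) (Cin1 Cin2 Cout1 Cout2 : R).
Variables (a10 : A1) (a20 : A2) (b10 : B1) (b20 : B2) (c10 : C1) (c20 : C2) (z10 : Z1) (z20 : Z2).
Hypotheses (h1 : (#|{: A1 * B1}| <= num_idx n Cin1)%N) (h2 : (#|{: A2 * B2}| <= num_idx n Cin2)%N).
Hypotheses (g1 : (#|{: A2 * Z1}| <= num_idx n Cout1)%N) (g2 : (#|{: A1 * Z2}| <= num_idx n Cout2)%N).
Let m1 := (A1 * B1 * C1)%type.
Let m2 := (A2 * B2 * C2)%type.
Let msg := msg A1 A2 B1 B2 C1 C2.
Let w0 : msg := ((a10, a20), b10, b20, c10, c20).
Let z0 := (z10, z20).
Variables (D : n.-tuple U -> n.-tuple V1 -> n.-tuple V2 -> n.-tuple X1 -> n.-tuple X2 -> n.-tuple Y -> bool)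
  (T0 : n.-tuple U -> n.-tuple V1 -> n.-tuple V2 -> bool).
Variable c : codebook (n.-tuple U) (n.-tuple V1) (n.-tuple V2) (n.-tuple X1) (n.-tuple X2)
  A1 A2 B1 B2 C1 C2 Z1 Z2.
Let nWm : n.-tuple X1 -> n.-tuple X2 -> massfn R (n.-tuple Y) := nW mac_mass.

Definition join_msg (s : m1) (t : m2) : msg :=
  ((s.1.1, t.1.1), s.1.2, t.1.2, s.2, t.2).

(** [c10] and [c20] are dummies: the facilitator does not receive the private parts, and by [sel_eq]
    the selection ignores them. *)
Let zsel (p : A1 * B1) (q : A2 * B2) : Z1 * Z2 :=
  csel T0 z0 c ((p.1, q.1), p.2, q.2, c10, c20).

Let cf1 (i : 'I_(num_idx n Cin1)) : A1 * B1 := unembed (a10, b10) i.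
Let cf2 (i : 'I_(num_idx n Cin2)) : A2 * B2 := unembed (a20, b20) i.

(** Encoder 1 receives a_2 and its own index z_1, which with its message determine the codeword.
    This pair has to fit into [Cout1], hence [g1]; symmetrically for encoder 2. *)
Definition cf_code_of : cf_code X1 X2 Y Cin1 Cin2 Cout1 Cout2 n #|{: m1}| #|{: m2}| :=
  @CFCode R X1 X2 Y Cin1 Cin2 Cout1 Cout2 n #|{: m1}| #|{: m2}|
    (fun w => embed h1 (enum_val w).1)
    (fun w => embed h2 (enum_val w).1)
    (fun i j => embed g1 ((cf2 j).1, (zsel (cf1 i) (cf2 j)).1))
    (fun i j => embed g2 ((cf1 i).1, (zsel (cf1 i) (cf2 j)).2))
    (fun w k => let s : m1 := enum_val w in let r := unembed (a20, z10) k in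
       cx1 c ((s.1.1, r.1), s.1.2, r.2, s.2))
    (fun w k => let s : m2 := enum_val w in let r := unembed (a10, z20) k in
       cx2 c ((r.1, s.1.1), s.1.2, r.2, s.2))
    (fun y => let w := decode D T0 w0 z0 c y in
       (enum_rank ((w.1.1.1.1.1, w.1.1.1.2, w.1.2) : m1),
        enum_rank ((w.1.1.1.1.2, w.1.1.2, w.2) : m2))).

Let jm (w : 'I_#|{: m1}| * 'I_#|{: m2}|) : msg := join_msg (enum_val w.1) (enum_val w.2).

Lemma cf_zsel w1 w2 :
  zsel (cf1 (to_cf1 cf_code_of w1)) (cf2 (to_cf2 cf_code_of w2)) = csel T0 z0 c (jm (w1, w2)).
Proof. by rewrite /zsel /cf1 /cf2 !embedK; apply: sel_eq. Qed.

Lemma input1E w1 w2 : input1 cf_code_of w1 w2 =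
  cx1 c (j1 (jm (w1, w2)) (csel T0 z0 c (jm (w1, w2)))).
Proof. by rewrite /input1 /= embedK -cf_zsel /cf1 /cf2 !embedK. Qed.

Lemma input2E w1 w2 : input2 cf_code_of w1 w2 =
  cx2 c (j2 (jm (w1, w2)) (csel T0 z0 c (jm (w1, w2)))).
Proof. by rewrite /input2 /= embedK -cf_zsel /cf1 /cf2 !embedK. Qed.

Lemma dec_jm w y : (dec cf_code_of y != w) = (decode D T0 w0 z0 c y != jm w).
Proof.
congr (~~ _); case: w => w1 w2 /=; set w := decode _ _ _ _ _ _.
apply/eqP/eqP => [[<- <-]|->].
  by rewrite /jm /= !enum_rankK; case: w => -[[[[? ?] ?] ?] ?] ?.
rewrite /jm /join_msg /=; congr (_, _); apply: enum_val_inj; rewrite enum_rankK.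
  by case: (enum_val w1) => -[].
by case: (enum_val w2) => -[].
Qed.

Lemma jm_bij : bijective jm.
Proof.
exists (fun w : msg => (enum_rank ((w.1.1.1.1.1, w.1.1.1.2, w.1.2) : m1),
        enum_rank ((w.1.1.1.1.2, w.1.1.2, w.2) : m2))) => [[w1 w2]|w].
  rewrite /jm /join_msg /=; congr (_, _); apply: enum_val_inj; rewrite enum_rankK.
    by case: (enum_val w1) => -[].
  by case: (enum_val w2) => -[].
by rewrite /jm /= !enum_rankK; case: w => -[[[[? ?] ?] ?] ?] ?.
Qed.

Lemma error_prob_le (eta : R) :
  (\sum_w ((#|{: msg}|%:R)^-1)%:E * err nWm D T0 w0 z0 c w < eta%:E)%E ->
  error_prob W cf_code_of <= eta.
Proof.
move=> herr; rewrite /error_prob /Prob.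
set S := esum _ _.
have law0 t : (0 <= (code_law W cf_code_of t)%:E)%E.
  case: t => -[w1 w2] y; rewrite lee_fin /code_law !mulr_ge0 ?invr_ge0//.
  by apply: prodr_ge0 => i _; case: (hW (tnth (input1 cf_code_of w1 w2) i)
    (tnth (input2 cf_code_of w1 w2) i)).
have ES : S = (\sum_w ((#|{: msg}|%:R)^-1)%:E * err nWm D T0 w0 z0 c w)%E.
  rewrite /S esum_mkcond Sum_pair; last by move=> t; case: ifP.
  rewrite Sum_fin; last by move=> w; apply: Sum_ge0 => y; case: ifP.
  rewrite [RHS](reindex jm); last exact: onW_bij jm_bij.
  apply: eq_bigr => -[w1 w2] _; rewrite /err EEE -SumZ ?lee_fin ?invr_ge0//; last first.
    by move=> y; rewrite mule_ge0// ?lee_fin ?mass_ge0.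
  apply: eq_Sum => y.
  have -> : ((w1, w2, y) \in [set t | dec cf_code_of t.2 <> t.1]) = (dec cf_code_of y != (w1, w2)).
    apply/idP/idP => [/set_mem/= /eqP//|/eqP h]; exact: mem_set.
  rewrite dec_jm /ind; case: (_ != _); last by rewrite !mule0.
  rewrite mule1 -EFinM /code_law input1E input2E; congr EFin.
  rewrite -[in RHS]/(mac_ext W _ _ _); congr (_ * _).
  rewrite -invfM -natrM -!card_prod; congr (_%:R^-1).
  by rewrite !card_prod; lia.
move: herr; rewrite -ES; have : (0 <= S)%E by apply: esum_ge0.
by case: S {ES} => [s| |]//= _; rewrite lte_fin => /ltW.
Qed.

End CodeOfCodebook.

(** * Alphabet sizes and exponents *)

Section Numerics.
Context (R : realType).

Definition p2x (m : nat) (x : R) : R := 2 `^ (m%:R * x).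
Definition sz (m : nat) (x : R) : R := (num_idx m x)%:R.

Lemma p2x_gt0 m x : 0 < p2x m x. Proof. exact: powR_gt0. Qed.

Lemma p2xD m x y : p2x m (x + y) = p2x m x * p2x m y.
Proof. by rewrite /p2x mulrDr powRD// pnatr_eq0 implybT. Qed.

Lemma p2x0 m : p2x m 0 = 1. Proof. by rewrite /p2x mulr0 powRr0. Qed.

Lemma le_p2x m x y : x <= y -> p2x m x <= p2x m y.
Proof. by move=> xy; rewrite /p2x ler_powR ?ler1n// ler_wpM2l. Qed.

Lemma p2x_ge1 m x : 0 <= x -> 1 <= p2x m x.
Proof. by move=> x0; rewrite -(p2x0 m); exact: le_p2x. Qed.

Lemma sz_le m x : sz m x <= p2x m x.
Proof. by rewrite /sz /num_idx truncn_le ltW// powR_gt0. Qed.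

Lemma num_idx_gt0 m (x : R) : 0 <= x -> (0 < num_idx m x)%N.
Proof. by move=> x0; rewrite /num_idx truncn_gt0 -/(p2x m x) p2x_ge1. Qed.

Lemma sz_ge1 m x : 0 <= x -> 1 <= sz m x.
Proof. by move=> x0; rewrite /sz ler1n num_idx_gt0. Qed.

Lemma sz_ge m x : 0 <= x -> p2x m x / 2 <= sz m x.
Proof.
move=> x0; have h1 := sz_ge1 m x0; have := truncnS_gt (p2x m x).
by rewrite -addn1 natrD -/(sz m x) => h2; lra.
Qed.

Lemma sz0 m : sz m 0 = 1.
Proof. by rewrite /sz /num_idx mulr0 powRr0 truncn1. Qed.

(** The left side is an integer not above 2^(n z), hence not above its floor. *)
Lemma num_idx_mul m n (x y z : R) : m%:R * (x + y) <= n%:R * z ->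
  (num_idx m x * num_idx m y <= num_idx n z)%N.
Proof.
move=> h; rewrite [leqRHS]/num_idx truncn_ge_nat; last exact/ltW/powR_gt0.
rewrite natrM; apply: (@le_trans _ _ (p2x m (x + y))).
  by rewrite p2xD ler_pM// sz_le.
by rewrite ler_powR ?ler1n.
Qed.

Lemma p2x_small (x eps : R) : 0 < x -> 0 < eps ->
  exists M, forall m, (M <= m)%N -> p2x m (- x) <= eps.
Proof.
move=> x0 e0; pose rho := 2 `^ (- x) : R.
have r01 : 0 <= rho < 1.
  rewrite powR_ge0/= /rho powRN invf_lt1 ?powR_gt0//.
  by rewrite /powR pnatr_eq0 /= expR_gt1 mulr_gt0// ln_gt0// ltr1n.
have [M hM] := expr_small r01 e0; exists M => m /hM.
by rewrite /rho -powR_mulrn ?powR_ge0// -powRrM mulrC.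
Qed.

Lemma log2_powR (x : R) : log2 (2 `^ x) = x.
Proof.
have h : 0 < ln 2 :> R by rewrite ln_gt0// ltr1n.
by rewrite /log2 ln_powR mulfK// gt_eqF.
Qed.

(** Each of the three floors at worst halves its power, so together they lose log2 8 = 3 bits. *)
Lemma log2_size m x y z : 0 <= x -> 0 <= y -> 0 <= z ->
  m%:R * (x + y + z) - 3 <= log2 (sz m x * sz m y * sz m z).
Proof.
move=> x0 y0 z0.
have h : 0 < ln 2 :> R by rewrite ln_gt0// ltr1n.
rewrite -[leLHS]log2_powR /log2 ler_pM2r ?invr_gt0// ler_ln ?posrE ?powR_gt0//; last first.
  by rewrite !mulr_gt0// (lt_le_trans ltr01)// sz_ge1.
rewrite powRD ?pnatr_eq0 ?implybT// -/(p2x m _) !p2xD.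
have -> : 2 `^ (- 3) = 8^-1 :> R by rewrite powRN -[3]/(3%:R) powR_mulrn// -natrX.
have hx := sz_ge m x0; have hy := sz_ge m y0; have hz := sz_ge m z0.
have px := p2x_gt0 m x; have py := p2x_gt0 m y; have pz := p2x_gt0 m z.
have -> : p2x m x * p2x m y * p2x m z / 8 = (p2x m x / 2) * (p2x m y / 2) * (p2x m z / 2).
  by field.
have h2 t : 0 <= p2x m t / 2 by rewrite divr_ge0// ltW// p2x_gt0.
by apply: ler_pM => //; [rewrite mulr_ge0|apply: ler_pM].
Qed.

(* Message rate [r] is split into the part [ra] known to both encoders, the
   part [rb] known to the facilitator and the private part [rc]. *)
Definition ra (r c0 : R) := Num.min r c0.
Definition rb (r c0 cin : R) := Num.min r cin - Num.min r c0.
Definition rc (r cin : R) := r - Num.min r cin.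

(** The last two implications are the purpose of the greedy split: a part of positive rate forces
    the earlier ones to be full. *)
Lemma rate_split r c0 cin : 0 <= r -> 0 <= c0 -> c0 <= cin ->
  [/\ 0 <= ra r c0, 0 <= rb r c0 cin, 0 <= rc r cin & ra r c0 + rb r c0 cin + rc r cin = r] /\
  [/\ ra r c0 <= c0, ra r c0 + rb r c0 cin <= cin,
    0 < rb r c0 cin -> ra r c0 = c0 & 0 < rc r cin -> ra r c0 + rb r c0 cin = cin].
Proof.
move=> r0 c00 cc; rewrite /ra /rb /rc.
by case: (lerP r c0) => h1; case: (lerP r cin) => h2; do !split; move=> *; lra.
Qed.

Lemma sz_sub1 m x : 0 <= x -> 0 <= sz m x - 1 <= p2x m x.
Proof. by move=> x0; have := sz_ge1 m x0; have := sz_le m x; lra. Qed.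

Definition rate_gap (R1 R2 Cin1 Cin2 C10 C20 : R) (k : kind) : R :=
  match k with
  | K0 => R1 + R2
  | K12 => R1 + R2 - C10 - C20
  | K1c => R1 + R2 - Cin2 - C10
  | K1o => R1 - C10
  | K2c => R1 + R2 - Cin1 - C20
  | K2o => R2 - C20
  | Kcc => R1 + R2 - Cin1 - Cin2
  | Kc1 => R1 - Cin1
  | Kc2 => R2 - Cin2
  end.

Section Counts.
Variables (m : nat) (R1 R2 Cin1 Cin2 C10 C20 : R).
Hypotheses (R10 : 0 <= R1) (R20 : 0 <= R2) (C100 : 0 <= C10) (C200 : 0 <= C20).
Hypotheses (C1 : C10 <= Cin1) (C2 : C20 <= Cin2).
Let a : R := sz m (ra R1 C10) * sz m (ra R2 C20).
Let b1 := sz m (rb R1 C10 Cin1).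
Let b2 := sz m (rb R2 C20 Cin2).
Let c1 := sz m (rc R1 Cin1).
Let c2 := sz m (rc R2 Cin2).

Definition fake_count (k : kind) : R :=
  match k with
  | K0 => (a - 1) * b1 * b2 * c1 * c2
  | K12 => (b1 - 1) * (b2 - 1) * c1 * c2
  | K1c => (b1 - 1) * c1 * (c2 - 1)
  | K1o => (b1 - 1) * c1
  | K2c => (b2 - 1) * (c1 - 1) * c2
  | K2o => (b2 - 1) * c2
  | Kcc => (c1 - 1) * (c2 - 1)
  | Kc1 => c1 - 1
  | Kc2 => c2 - 1
  end.

(** A part of rate 0 has an alphabet of size 1 and cannot be wrong, so the count vanishes. Otherwise
    [rate_split] says that the earlier parts are full, and the rates of the parts that may differ
    add up to exactly [rate_gap]. *)
Lemma fake_count_le k : fake_count k <= p2x m (rate_gap R1 R2 Cin1 Cin2 C10 C20 k).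
Proof.
have [[ra10 rb10 rc10 S1] [_ _ B1 K1]] := rate_split R10 C100 C1.
have [[ra20 rb20 rc20 S2] [_ _ B2 K2]] := rate_split R20 C200 C2.
have sub x : 0 <= x -> 0 <= sz m x - 1 <= p2x m x by exact: sz_sub1.
have full x : 0 <= x -> 0 <= sz m x <= p2x m x.
  by move=> x0; rewrite sz_le andbT.
have prod (x y P Q : R) : 0 <= x <= P -> 0 <= y <= Q -> 0 <= x * y <= P * Q.
  by move=> /andP[x0 xP] /andP[y0 yQ]; rewrite mulr_ge0//= ler_pM.
have pos (x : R) : 0 <= x -> x = 0 \/ 0 < x.
  by rewrite le_eqVlt => /orP[/eqP <-|]; [left|right].
have pp := p2x_gt0 m.
case: k => /=.
- have ha : 0 <= a - 1 <= p2x m (ra R1 C10) * p2x m (ra R2 C20).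
    have /andP[_ ha] := prod _ _ _ _ (full _ ra10) (full _ ra20).
    rewrite -/a in ha; rewrite subr_ge0 (le_trans _ ha) ?gerBl// andbT.
    by rewrite /a -[leLHS]mulr1 ler_pM// sz_ge1.
  have /andP[_] := prod _ _ _ _ (prod _ _ _ _ (prod _ _ _ _ (prod _ _ _ _ ha (full _ rb10)) (full _ rb20))
    (full _ rc10)) (full _ rc20).
  rewrite -!p2xD -/b1 -/b2 -/c1 -/c2 => /le_trans; apply; apply: le_p2x; lra.
- have [h|h1] := pos _ rb10; first by rewrite /b1 h sz0 subrr !mul0r ltW.
  have [h|h2] := pos _ rb20; first by rewrite /b2 h sz0 subrr mulr0 !mul0r ltW.
  have /andP[_] := prod _ _ _ _ (prod _ _ _ _ (prod _ _ _ _ (sub _ rb10) (sub _ rb20))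
    (full _ rc10)) (full _ rc20).
  rewrite -!p2xD => /le_trans; apply; apply: le_p2x; have := B1 h1; have := B2 h2; lra.
- have [h|h1] := pos _ rb10; first by rewrite /b1 h sz0 subrr !mul0r ltW.
  have [h|h2] := pos _ rc20; first by rewrite /c2 h sz0 subrr mulr0 ltW.
  have /andP[_] := prod _ _ _ _ (prod _ _ _ _ (sub _ rb10) (full _ rc10)) (sub _ rc20).
  rewrite -!p2xD => /le_trans; apply; apply: le_p2x; have := B1 h1; have := K2 h2; lra.
- have [h|h1] := pos _ rb10; first by rewrite /b1 h sz0 subrr !mul0r ltW.
  have /andP[_] := prod _ _ _ _ (sub _ rb10) (full _ rc10).
  rewrite -!p2xD => /le_trans; apply; apply: le_p2x; have := B1 h1; lra.
- have [h|h1] := pos _ rb20; first by rewrite /b2 h sz0 subrr !mul0r ltW.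
  have [h|h2] := pos _ rc10; first by rewrite /c1 h sz0 subrr mulr0 mul0r ltW.
  have /andP[_] := prod _ _ _ _ (prod _ _ _ _ (sub _ rb20) (sub _ rc10)) (full _ rc20).
  rewrite -!p2xD => /le_trans; apply; apply: le_p2x; have := B2 h1; have := K1 h2; lra.
- have [h|h1] := pos _ rb20; first by rewrite /b2 h sz0 subrr !mul0r ltW.
  have /andP[_] := prod _ _ _ _ (sub _ rb20) (full _ rc20).
  rewrite -!p2xD => /le_trans; apply; apply: le_p2x; have := B2 h1; lra.
- have [h|h1] := pos _ rc10; first by rewrite /c1 h sz0 subrr mul0r ltW.
  have [h|h2] := pos _ rc20; first by rewrite /c2 h sz0 subrr mulr0 ltW.
  have /andP[_] := prod _ _ _ _ (sub _ rc10) (sub _ rc20).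
  rewrite -!p2xD => /le_trans; apply; apply: le_p2x; have := K1 h1; have := K2 h2; lra.
- have [h|h1] := pos _ rc10; first by rewrite /c1 h sz0 subrr ltW.
  have /andP[_] := sub _ rc10.
  by move=> /le_trans; apply; apply: le_p2x; have := K1 h1; lra.
- have [h|h2] := pos _ rc20; first by rewrite /c2 h sz0 subrr ltW.
  have /andP[_] := sub _ rc20.
  by move=> /le_trans; apply; apply: le_p2x; have := K2 h2; lra.
Qed.

End Counts.

End Numerics.

Lemma kinds_min (R : realType) (g : kind -> R) : (forall k, 0 < g k) ->
  exists2 d : R, 0 < d & forall k, d <= g k.
Proof.
move=> g0; exists (\big[Num.min/g K0]_(k <- kinds) g k).
  rewrite /kinds; elim: [:: _; _; _; _; _; _; _; _; _] => [|k s ih]; rewrite ?big_nil//.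
  by rewrite big_cons lt_min g0.
rewrite /kinds !big_cons big_nil => k.
by case: k; rewrite !ge_min lexx ?orbT.
Qed.

Lemma rate_loss (R : realType) (kap eps r s m n : R) : 0 <= r <= s -> 0 <= kap ->
  kap * (s + 1) <= eps / 2 -> (1 - kap) * n < m + 1 -> 0 <= n ->
  s + 4 < n * (eps / 2) -> n * (r - eps) < m * r - 3.
Proof.
move=> /andP[r0 rs] k0 ks mn n0 ns.
have h1 : ((1 - kap) * n - 1) * r <= m * r by rewrite ler_wpM2r//; lra.
have h2 : kap * r * n <= eps / 2 * n.
  rewrite ler_wpM2r// (le_trans _ ks)// ler_wpM2l//; lra.
rewrite (_ : n * (r - eps) = ((1 - kap) * n - 1) * r + kap * r * n + r - 2 * (n * (eps / 2)));
  last by field.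
by rewrite (mulrC n) in ns *; lra.
Qed.

(** * Choice of parameters and conclusion *)

Section Assembly.
Context (R : realType) (U V1 V2 X1 X2 Y : choiceType).
Variables (puv : U * V1 * V2 -> R) (q1 : U -> V1 -> massfn R X1) (q2 : U -> V2 -> massfn R X2).
Variable W : X1 -> X2 -> Y -> R.
Hypotheses (hW : is_mac W) (puvP : is_pmf puv).
Variables (Cin1 Cin2 Cout1 Cout2 R1 R2 C10 C20 : R).
Hypotheses (R10 : 0 <= R1) (R20 : 0 <= R2) (C100 : 0 <= C10) (C200 : 0 <= C20).
Hypotheses (C10in : C10 <= Cin1) (C20in : C20 <= Cin2).
Hypotheses (C10out : C10 <= Cout2) (C20out : C20 <= Cout1).
Let Wm := mac_mass hW.
Let T := (U * V1 * V2 * X1 * X2 * Y)%type.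
Let P : massfn R T := MassFn (joint_pmf q1 q2 Wm puvP).
Let lr_t (t : T) := slr puv q1 q2 Wm t.1.1.1.1.1 t.1.1.1.1.2 t.1.1.1.2.
Let sr_t k (t : T) := sratio puv q1 q2 Wm k t.1.1.1.1.1 t.1.1.1.1.2 t.1.1.1.2 t.1.1.2 t.1.2 t.2.
Let T_ := rate_gap R1 R2 Cin1 Cin2 C10 C20.
Hypothesis rates : forall k, ((T_ k)%:E < signed_sum (fun t => P t * log2 (sr_t k t))%R)%E.
Hypothesis cover : (signed_sum (fun t => (P t * log2 (lr_t t))%R) <=
  ((Cout1 - C20) + (Cout2 - C10))%:E)%E.

Let pU := sU q1 q2 Wm puvP.
Let p1 := s1 q1 q2 Wm puvP.
Let p2 := s2 q1 q2 Wm puvP.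

(** Opposite demands meet here: the index pairs must outnumber [Lam] for covering, exceed [lam] by
    no more than 2^(del m) for packing, and fit into what the common parts leave of the links. *)
Lemma cover_params (kap del : R) : 0 < kap < 1 -> 0 < del ->
  exists (rz1 rz2 : R) (lam Lam : nat -> R),
  [/\ 0 <= rz1, 0 <= rz2, (C20 + rz1) * (1 - kap) <= Cout1, (C10 + rz2) * (1 - kap) <= Cout2 &
  [/\ forall m, 0 < lam m, forall m, 1 <= Lam m, forall m, sz m rz1 * sz m rz2 / lam m <= p2x m del,
    forall eps, 0 < eps -> exists M, forall m, (M <= m)%N ->
      (Lam m - 1) / (sz m rz1 * sz m rz2) <= eps &
    forall eps, 0 < eps -> exists M, forall n m, (M <= m)%N -> (m <= n)%N ->
      (joint (nU n pU) (n1 p1) (n2 p2) (nq1 q1) (nq2 q2) (nW Wm)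
        (nlr (@lrf _ _ _ _ _ _ _ puv q1 q2 Wm n m))
        (fun u v1 v2 _ _ _ => ind R (~~ (lam m <=
          nlr (@lrf _ _ _ _ _ _ _ puv q1 q2 Wm n m) u v1 v2 <= Lam m)%R)) <= eps%:E)%E]].
Proof.
move=> /andP[kap0 kap1] del0.
have [h1 h2] := (C10out, C20out); have [h3 h4] := (C100, C200).
have lrt_ge0 t : 0 <= lr_t t by exact: slr_ge0.
have lrt_gt0 := @lr_t_gt0 _ _ _ _ _ _ _ puv q1 q2 Wm puvP.
have lrtV := @lr_tV _ _ _ _ _ _ _ puv q1 q2 Wm puvP.
have I0 := divergence_ge0 lrt_ge0 lrt_gt0 lrtV.
(* Without any capacity towards the encoders a shorter block gains nothing. But then [cover] bounds
   the information by 0, the density is 1 on the support, and a single index pair with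
   [lam = Lam = 1] suffices. *)
have [C00|C0] := lerP (Cout1 + Cout2) 0.
  exists 0, 0, (fun=> 1), (fun=> 1); split; rewrite ?addr0//.
  - have -> : C20 = 0 by apply/le_anti/andP; split; lra.
    by rewrite mul0r; lra.
  - have -> : C10 = 0 by apply/le_anti/andP; split; lra.
    by rewrite mul0r; lra.
  split => // [m|eps eps0|eps eps0].
  - by rewrite sz0 mulr1 divr1 p2x_ge1// ltW.
  - by exists 0%N => m _; rewrite subrr mul0r ltW.
  - exists 0%N => n m _ _; apply: lr_typical_one; last exact: ltW.
    apply: (divergence_eq0 lrt_ge0 lrt_gt0 lrtV).
    apply: le_trans cover _; rewrite lee_fin; lra.
have [I EI] : exists I : R, signed_sum (fun t => P t * log2 (lr_t t)) = I%:E.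
  move: I0 cover; rewrite -/lr_t.
  by case: signed_sum => [I| |]// _ _; exists I.
move: I0 cover; rewrite EI !lee_fin => I0 hI.
(* Using only the fraction [1 - kap] of the letters multiplies the link capacity per used letter by
   [k1 > 1]. [B1] and [B2] are what remains for the indices, and [Cout1 + Cout2 > 0] makes
   [I < B1 + B2] strict. *)
pose k1 := (1 - kap)^-1.
have k1P : 1 < k1 by rewrite invf_gt1; lra.
have k1E : k1 * (1 - kap) = 1 by rewrite mulVf// gt_eqF; lra.
pose B1 := Cout1 * k1 - C20; pose B2 := Cout2 * k1 - C10.
have O1 : 0 <= Cout1 by lra.
have O2 : 0 <= Cout2 by lra.
have B10 : 0 <= B1 by rewrite /B1; nra.
have B20 : 0 <= B2 by rewrite /B2; nra.
have BI : I < B1 + B2 by rewrite /B1 /B2; nra.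
(* The index pairs get exponent I + 3 eta: this is 2 eta above [Lam], so that covering succeeds, and
   4 eta above [lam], which must stay within [del]. The second bound makes I + 3 eta fit into B1 +
   B2. *)
pose eta := Num.min (del / 4) ((B1 + B2 - I) / 3).
have eta0 : 0 < eta by rewrite lt_min !divr_gt0//; lra.
have eta1 : 4 * eta <= del.
  have : eta <= del / 4 by rewrite /eta ge_min lexx.
  lra.
have eta2 : I + 3 * eta <= B1 + B2.
  have : eta <= (B1 + B2 - I) / 3 by rewrite /eta ge_min lexx orbT.
  lra.
pose S := I + 3 * eta.
pose rz1 := Num.min B1 S; pose rz2 := S - rz1.
have [rz10 rz20 rz1B rz2B] : [/\ 0 <= rz1, 0 <= rz2, rz1 <= B1 & rz2 <= B2].
  have S0 : 0 <= S by rewrite /S; lra.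
  split; first by rewrite le_min B10.
  - by rewrite subr_ge0 ge_min lexx orbT.
  - by rewrite ge_min lexx.
  - by rewrite lerBlDl -lerBlDr le_min; apply/andP; split; rewrite /S; lra.
have rzS : rz1 + rz2 = S by rewrite /rz2; ring.
exists rz1, rz2, (fun m => p2x m (I - eta)), (fun m => p2x m (I + eta)); split => //.
- have -> : Cout1 = Cout1 * k1 * (1 - kap) by rewrite -mulrA k1E mulr1.
  by rewrite ler_wpM2r//; rewrite /B1 in rz1B; lra.
- have -> : Cout2 = Cout2 * k1 * (1 - kap) by rewrite -mulrA k1E mulr1.
  by rewrite ler_wpM2r//; rewrite /B2 in rz2B; lra.
split.
- by move=> m; exact: p2x_gt0.
- by move=> m; apply: p2x_ge1; lra.
- move=> m; rewrite ler_pdivrMr ?p2x_gt0// -p2xD.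
  apply: (@le_trans _ _ (p2x m rz1 * p2x m rz2)).
    by rewrite ler_pM ?sz_le// (le_trans ler01)// sz_ge1.
  by rewrite -p2xD rzS; apply: le_p2x; rewrite /S; lra.
- move=> eps eps0; have [M hM] := p2x_small (mulr_gt0 (ltr0n R 2) eta0) (divr_gt0 eps0 (ltr0n _ 4)).
  exists M => m /hM hm.
  have s1g := sz_ge m rz10; have s2g := sz_ge m rz20.
  have z1 := sz_ge1 m rz10; have z2 := sz_ge1 m rz20.
  have s12 : p2x m S / 4 <= sz m rz1 * sz m rz2.
    rewrite -rzS p2xD (_ : _ / 4 = (p2x m rz1 / 2) * (p2x m rz2 / 2)); last by field.
    by apply: ler_pM => //; rewrite divr_ge0// ltW// p2x_gt0.
  rewrite ler_pdivrMr; last by rewrite mulr_gt0//; lra.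
  apply: (@le_trans _ _ (p2x m (I + eta))); first by rewrite gerBl.
  apply: (@le_trans _ _ (eps * (p2x m S / 4))); last by rewrite ler_pM2l.
  rewrite (_ : I + eta = - (2 * eta) + S); last by rewrite /S; ring.
  rewrite p2xD (_ : eps * _ = (eps / 4) * p2x m S); last by ring.
  by rewrite ler_pM2r// p2x_gt0.
- move=> eps eps0; apply: lr_typical => //; rewrite -/lr_t EI.
  + by rewrite lte_fin; lra.
  + by rewrite lte_fin; lra.
Qed.

Let A1 m : finType := 'I_(num_idx m (ra R1 C10)).
Let A2 m : finType := 'I_(num_idx m (ra R2 C20)).
Let B1 m : finType := 'I_(num_idx m (rb R1 C10 Cin1)).
Let B2 m : finType := 'I_(num_idx m (rb R2 C20 Cin2)).
Let C1 m : finType := 'I_(num_idx m (rc R1 Cin1)).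
Let C2 m : finType := 'I_(num_idx m (rc R2 Cin2)).

(** The ratio of index pairs to [lam] enters once for the sent indices and at most once more for
    those of the wrong message. So at most 2 del of the margin 3 del is spent, and each of the nine
    patterns keeps 2^(- del m). *)
Lemma confusion_bound (m : nat) (rz1 rz2 lam del : R) (gam : kind -> R) :
  0 <= rz1 -> 0 <= rz2 -> 0 < lam -> 0 <= del ->
  sz m rz1 * sz m rz2 / lam <= p2x m del -> (forall k, T_ k + 3 * del <= gam k) ->
  confusion_count (A1 m) (A2 m) (B1 m) (B2 m) (C1 m) (C2 m)
    'I_(num_idx m rz1) 'I_(num_idx m rz2)
    (lam * p2x m (gam K0))^-1 (lam * p2x m (gam K12))^-1 (lam * p2x m (gam K1c))^-1
    (lam * p2x m (gam K1o))^-1 (lam * p2x m (gam K2c))^-1 (lam * p2x m (gam K2o))^-1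
    (p2x m (gam Kcc))^-1 (p2x m (gam Kc1))^-1 (p2x m (gam Kc2))^-1 lam^-1
  <= 9 * p2x m (- del).
Proof.
move=> rz10 rz20 lam0 del0 hL hg.
pose N := fake_count m R1 R2 Cin1 Cin2 C10 C20.
pose t k := N k / p2x m (gam k).
set L := sz m rz1 * sz m rz2 / lam in hL.
have L0 : 0 <= L.
  by rewrite divr_ge0 ?ltW// mulr_gt0// (lt_le_trans ltr01)// sz_ge1.
pose q := p2x m (- (3 * del)).
have tq k : t k <= q.
  rewrite /t ler_pdivrMr ?p2x_gt0// -p2xD.
  by apply: le_trans (fake_count_le m R10 R20 C100 C200 C10in C20in k) _; apply: le_p2x; have := hg k; rewrite /T_; lra.
have -> : confusion_count (A1 m) (A2 m) (B1 m) (B2 m) (C1 m) (C2 m)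
    'I_(num_idx m rz1) 'I_(num_idx m rz2)
    (lam * p2x m (gam K0))^-1 (lam * p2x m (gam K12))^-1 (lam * p2x m (gam K1c))^-1
    (lam * p2x m (gam K1o))^-1 (lam * p2x m (gam K2c))^-1 (lam * p2x m (gam K2o))^-1
    (p2x m (gam Kcc))^-1 (p2x m (gam Kc1))^-1 (p2x m (gam Kc2))^-1 lam^-1
  = L * (L * (t K0 + t K12 + t K1c + t K1o + t K2c + t K2o) + (t Kcc + t Kc1 + t Kc2)).
  rewrite /confusion_count /A1 /A2 /B1 /B2 /C1 /C2 !card_prod !card_ord !natrM.
  rewrite -/(sz m rz1) -/(sz m rz2) /t /N /L /=.
  rewrite -/(sz m (ra R1 C10)) -/(sz m (ra R2 C20)) -/(sz m (rb R1 C10 Cin1)).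
  rewrite -/(sz m (rb R2 C20 Cin2)) -/(sz m (rc R1 Cin1)) -/(sz m (rc R2 Cin2)).
  have g k : p2x m (gam k) != 0 by rewrite gt_eqF ?p2x_gt0.
  field; by rewrite !g gt_eqF.
have q0 : 0 < q by exact: p2x_gt0.
have D1 : 1 <= p2x m del by exact: p2x_ge1.
have E : p2x m (- del) = p2x m del * p2x m del * q.
  by rewrite -!p2xD /q; congr p2x; ring.
rewrite E.
have h1 : t K0 + t K12 + t K1c + t K1o + t K2c + t K2o <= 6 * q.
  have := tq K0; have := tq K12; have := tq K1c; have := tq K1o; have := tq K2c; have := tq K2o.
  by lra.
have h2 : t Kcc + t Kc1 + t Kc2 <= 3 * q.
  by have := tq Kcc; have := tq Kc1; have := tq Kc2; lra.
set X := t K0 + _ + _ + _ + _ + _ in h1 *; set Z := t Kcc + _ + _ in h2 *.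
set DD := p2x m del in hL D1 *.
have LX : L * X <= DD * (6 * q).
  apply: (@le_trans _ _ (L * (6 * q))); first by rewrite ler_wpM2l.
  by rewrite ler_wpM2r// mulr_ge0// ltW.
have ZD : Z <= DD * (3 * q).
  apply: le_trans h2 _; rewrite -[leLHS]mul1r ler_wpM2r// mulr_ge0// ltW//.
apply: (@le_trans _ _ (L * (DD * (6 * q) + DD * (3 * q)))).
  by rewrite ler_wpM2l// lerD.
apply: (@le_trans _ _ (DD * (DD * (6 * q) + DD * (3 * q)))); last first.
  by rewrite le_eqVlt; apply/orP; left; apply/eqP; ring.
have DD0 : 0 <= DD by rewrite (le_trans ler01).
have q0' : 0 <= q by exact: ltW.
by rewrite ler_wpM2r// addr_ge0// mulr_ge0// mulr_ge0.
Qed.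

Lemma card_gt0_ord m (x : R) : 0 <= x -> 'I_(num_idx m x).
Proof. by move=> x0; exists 0%N; exact: num_idx_gt0. Qed.

Lemma truncn_frac_large (kap : R) (M : nat) : 0 < kap < 1 ->
  exists N, forall n, (N <= n)%N -> (M <= Num.truncn ((1 - kap) * n%:R))%N.
Proof.
move=> /andP[k0 k1]; have h : 0 < 1 - kap by lra.
exists (Num.truncn (M%:R / (1 - kap))).+1 => n hn.
rewrite truncn_ge_nat; last by rewrite mulr_ge0// ltW.
rewrite mulrC -ler_pdivrMr//; apply/ltW/(lt_le_trans (truncnS_gt _)).
by rewrite ler_nat.
Qed.

Lemma rate_region_achievable : achievable W Cin1 Cin2 Cout1 Cout2 R1 R2.
Proof.
have [[h1 h2] [h3 h4]] := ((C10out, C20out), (C100, C200)).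
have [[h5 h6] [h7 h8]] := ((C10in, C20in), (R10, R20)).
split => // eps eps0.
(* The strict inequalities leave room for a threshold exponent above that of the number of wrong
   messages and below the information. An infinite information admits any threshold, here
   [T_ k + 1]. *)
have /choice[gam hgam] : forall k, exists g,
    T_ k < g /\ (g%:E < signed_sum (fun t => P t * log2 (sr_t k t))%R)%E.
  move=> k.
  have := rates k; case: signed_sum => [x| |]// h.
    exists ((T_ k + x) / 2); move: h; rewrite !lte_fin => h; split; lra.
  by exists (T_ k + 1); split; [lra|exact: ltry].
have [del3 del30 hdel3] : exists2 d : R, 0 < d & forall k, d <= gam k - T_ k.
  by apply: kinds_min => k; rewrite subr_gt0; case: (hgam k).
pose del := del3 / 3.
have del0 : 0 < del by rewrite divr_gt0.
have hdel k : T_ k + 3 * del <= gam k by have := hdel3 k; rewrite /del; lra.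
pose kap := Num.min (1 / 2) (eps / (2 * (R1 + R2 + 1))).
have RR : 0 < R1 + R2 + 1 by lra.
have kap01 : 0 < kap < 1.
  apply/andP; split; first by rewrite lt_min !divr_gt0// mulr_gt0.
  by rewrite gt_min; apply/orP; left; lra.
have kapR : kap * (R1 + R2 + 1) <= eps / 2.
  have : kap <= eps / (2 * (R1 + R2 + 1)) by rewrite ge_min lexx orbT.
  rewrite -(ler_pM2r RR) => /le_trans; apply; rewrite le_eqVlt; apply/orP; left; apply/eqP.
  by field; rewrite gt_eqF.
have [rz1 [rz2 [lam [Lam [[rz10 rz20 hz1 hz2] [lam0 Lam1 hL hLam htyp]]]]]] :=
  cover_params kap01 del0.
(* Error budget: covering [e], atypical triples [2 * (e + e)], misses [e], confusion [e], in all
   [7 e < eps]. The level [e * e / 9] for the ratios undoes the union bound over nine kinds and the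
   division by [miss = e]. *)
pose e := eps / 8.
have e0 : 0 < e by rewrite divr_gt0.
have [M1 hM1] := hLam e e0.
have [M2 hM2] := htyp e e0.
have e20 : 0 < e * e / 9 by rewrite divr_gt0// mulr_gt0.
have /choice[M3 hM3] : forall k, exists M3, forall n m, (M3 <= m)%N -> (m <= n)%N ->
    (joint (nU n pU) (n1 p1) (n2 p2) (nq1 q1) (nq2 q2) (nW Wm)
      (nlr (@lrf _ _ _ _ _ _ _ puv q1 q2 Wm n m))
      (fun u v1 v2 x1 x2 y => ind R (~~ (p2x m (gam k) <=
        nratio (@srf _ _ _ _ _ _ _ puv q1 q2 Wm n m k) u v1 v2 x1 x2 y)%R)) <= (e * e / 9)%:E)%E.
  by move=> k; apply: ratio_typical => //; case: (hgam k).
have [M4 hM4] := p2x_small del0 (divr_gt0 e0 (ltr0n R 9)).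
pose Mk := \max_(k <- kinds) M3 k.
have hMk k : (M3 k <= Mk)%N.
  by rewrite /Mk /kinds !big_cons big_nil; case: k; rewrite !leq_max leqnn ?orbT.
have [N hN] := truncn_frac_large (maxn (maxn M1 M2) (maxn Mk M4)) kap01.
(* From this length on [R1 + R2 + 4 < n eps / 2], the condition of [rate_loss]. *)
pose N5 := (Num.truncn ((R1 + R2 + 4) / (eps / 2))).+1.
exists (maxn N N5) => // n; rewrite /= geq_max => /andP[/hN].
set m := Num.truncn _; rewrite !geq_max => /andP[/andP[m1 m2] /andP[mk m4]] n5.
have [k0 k1] := andP kap01.
have k1' : 0 < 1 - kap by lra.
have mn' : m%:R <= (1 - kap) * n%:R :> R.
  by rewrite /m truncn_le mulr_ge0// ltW.
have mlt : (1 - kap) * n%:R < m%:R + 1 :> R.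
  by rewrite natr1 /m; exact: truncnS_gt.
have n0 : 0 <= n%:R :> R by [].
have mn : (m <= n)%N by rewrite -(ler_nat R); nra.
have [[ra10 rb10 rc10 S1] [raC1 rab1 _ _]] := rate_split h7 h3 h5.
have [[ra20 rb20 rc20 S2] [raC2 rab2 _ _]] := rate_split h8 h4 h6.
have [[[w1 w2] w3] [[w4 w5] w6]] := ((card_gt0_ord m ra10, card_gt0_ord m ra20, card_gt0_ord m rb10),
  (card_gt0_ord m rb20, card_gt0_ord m rc10, card_gt0_ord m rc20)).
have [z1 z2] := (card_gt0_ord m rz10, card_gt0_ord m rz20).
have hsize : (Lam m - 1) / #|{: 'I_(num_idx m rz1) * 'I_(num_idx m rz2)}|%:R <= e.
  by rewrite card_prod !card_ord natrM; exact: hM1.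
have hconf := confusion_bound rz10 rz20 (lam0 m) (ltW del0) (hL m) hdel.
have [|D [T0 [c hc]]] := @block_code R U V1 V2 X1 X2 Y puv q1 q2 Wm puvP n m
  (A1 m) (A2 m) (B1 m) (B2 m) (C1 m) (C2 m) 'I_(num_idx m rz1) 'I_(num_idx m rz2)
  ((w1, w2), w3, w4, w5, w6) (z1, z2) (lam m) (Lam m) (fun k => p2x m (gam k)) e (e * e / 9) e eps
  (lam0 m) (Lam1 m) (fun k => p2x_gt0 m (gam k)) e0 (hM2 n m m2 mn)
  (fun k => hM3 k n m (leq_trans (hMk k) mk) mn) _.
  have he : (2 * (e + 9 * (e * e / 9) / e) = 4 * e) by field; rewrite gt_eqF.
  have h9 : 9 * p2x m (- del) <= e.
    by have := hM4 m m4; rewrite ler_pdivlMr// mulrC.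
  rewrite he; apply: (@le_lt_trans _ _ (e + 4 * e + e + e)).
    by rewrite !lerD//; apply: le_trans hconf h9.
  by rewrite /e; lra.
have m0 : 0 <= m%:R :> R by [].
have nn : m%:R <= n%:R :> R by rewrite ler_nat.
have s1 : (#|{: A1 m * B1 m}| <= num_idx n Cin1)%N.
  rewrite card_prod !card_ord; apply: num_idx_mul.
  apply: (@le_trans _ _ (m%:R * Cin1)); first by rewrite ler_wpM2l.
  by rewrite ler_wpM2r// (le_trans h3).
have s2 : (#|{: A2 m * B2 m}| <= num_idx n Cin2)%N.
  rewrite card_prod !card_ord; apply: num_idx_mul.
  apply: (@le_trans _ _ (m%:R * Cin2)); first by rewrite ler_wpM2l.
  by rewrite ler_wpM2r// (le_trans h4).
have s3 : (#|{: A2 m * 'I_(num_idx m rz1)}| <= num_idx n Cout1)%N.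
  rewrite card_prod !card_ord; apply: num_idx_mul.
  apply: (@le_trans _ _ ((1 - kap) * n%:R * (C20 + rz1))).
    by apply: ler_pM; rewrite ?addr_ge0 ?lerD2r.
  by rewrite mulrAC mulrC ler_wpM2l// mulrC.
have s4 : (#|{: A1 m * 'I_(num_idx m rz2)}| <= num_idx n Cout2)%N.
  rewrite card_prod !card_ord; apply: num_idx_mul.
  apply: (@le_trans _ _ ((1 - kap) * n%:R * (C10 + rz2))).
    by apply: ler_pM; rewrite ?addr_ge0 ?lerD2r.
  by rewrite mulrAC mulrC ler_wpM2l// mulrC.
exists #|{: A1 m * B1 m * C1 m}|, #|{: A2 m * B2 m * C2 m}|,
  (cf_code_of w1 w2 w3 w4 w5 w6 z1 z2 s1 s2 s3 s4 D T0 c).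
have n5' : (R1 + R2 + 4) < n%:R * (eps / 2).
  rewrite -ltr_pdivrMr ?divr_gt0//; apply: (lt_le_trans (truncnS_gt _)).
  by rewrite ler_nat.
have npos : 0 < n%:R :> R.
  by rewrite ltr0n (leq_trans _ n5).
split.
- by apply/card_gt0P; exists (w1, w3, w5).
- by apply/card_gt0P; exists (w2, w4, w6).
- exact: (error_prob_le s1 s2 s3 s4 hc).
- rewrite !card_prod !card_ord !natrM ltr_pdivlMl//.
  apply: lt_le_trans (log2_size m ra10 rb10 rc10).
  by rewrite S1; apply: rate_loss kapR mlt n0 n5'; [lra|exact: ltW].
- rewrite !card_prod !card_ord !natrM ltr_pdivlMl//.
  apply: lt_le_trans (log2_size m ra20 rb20 rc20).
  by rewrite S2; apply: rate_loss kapR mlt n0 n5'; [lra|exact: ltW].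
Qed.

End Assembly.

Theorem theorem2 (R : realType) (X1 X2 Y : choiceType)
    (W : X1 -> X2 -> Y -> R) (Cin1 Cin2 Cout1 Cout2 : R)
    (hW : is_mac W)
    (hCin1 : 0 <= Cin1) (hCin2 : 0 <= Cin2)
    (hCout1 : 0 <= Cout1) (hCout2 : 0 <= Cout2)
    (R1 R2 : R) :
  rate_region W Cin1 Cin2 Cout1 Cout2 (R1, R2) ->
  achievable W Cin1 Cin2 Cout1 Cout2 R1 R2.
Proof.
move=> [R10 R20 [C10 [C20 [U [V1 [V2 [puv [q1 [q2]]]]]]]]].
move=> /[let] P /[let] u /[let] v1 /[let] v2 /[let] x1 /[let] x2 /[let] y /[let] x12.
have uE : u = (fun t => t.1.1.1.1.1) by apply/funext => -[[[[[]]]]].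
have v1E : v1 = (fun t => t.1.1.1.1.2) by apply/funext => -[[[[[]]]]].
have v2E : v2 = (fun t => t.1.1.1.2) by apply/funext => -[[[[[]]]]].
have x1E : x1 = (fun t => t.1.1.2) by apply/funext => -[[[[[]]]]].
have x2E : x2 = (fun t => t.1.2) by apply/funext => -[[[[[]]]]].
have yE : y = (fun t => t.2) by apply/funext => -[[[[[]]]]].
rewrite {}/x12; clearbody u v1 v2 x1 x2 y; subst u v1 v2 x1 x2 y.
move=> [[C100 C200 puvP q1P q2P]].
rewrite !le_min => -[[/andP[C10in C10out] /andP[C20in C20out] cover]].
move=> [[rc1 rc2 r1o r2o] [[rcc r1c r2c] [r12 r0]]].
pose Q1 u v := MassFn (q1P u v); pose Q2 u v := MassFn (q2P u v).
have PP := joint_pmf Q1 Q2 (mac_mass hW) puvP.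
have gap (a b : R) (x : \bar R) : (a%:E < x + b%:E -> (a - b)%:E < x)%E.
  by rewrite EFinB lteBlDr.
have gap2 (a b c : R) (x : \bar R) : (a%:E < x + b%:E + c%:E -> (a - b - c)%:E < x)%E.
  by move=> /gap/gap; congr (_%:E < _)%E; ring.
apply: (@rate_region_achievable _ _ _ _ _ _ _ puv Q1 Q2 W hW puvP _ _ _ _ _ _ C10 C20) => //.
(* Informations given [v2] serve the patterns with b_1 wrong and b_2 right, where v_2 may be shared,
   and those given [v1] the reverse; hence [r2c] for [K1c] and [r1c] for [K2c]. *)
- case; rewrite /rate_gap/=.
  + by move: r0; rewrite (mutual_infoE PP) (cond_mutual_infoE PP).
  + by move/gap2: r12; rewrite (cond_mutual_infoE PP).
  + by move/gap2: r2c; rewrite (cond_mutual_infoE PP).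
  + by move/gap: r1o; rewrite (cond_mutual_infoE PP).
  + by move/gap2: r1c; rewrite (cond_mutual_infoE PP).
  + by move/gap: r2o; rewrite (cond_mutual_infoE PP).
  + by move/gap2: rcc; rewrite (cond_mutual_infoE PP).
  + by move/gap: rc1; rewrite (cond_mutual_infoE PP).
  + by move/gap: rc2; rewrite (cond_mutual_infoE PP).
- by move: cover; rewrite (cond_mutual_infoE PP).
Qed.
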